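(* Let $\{X(t)\}_{t\ge 0}=\{X(t,\omega)\}$ be the stochastic replicator process with payoff matrix $A\in\mathbb{R}^{n\times n}$, noise parameters $\sigma_1,\dots,\sigma_n$ and initial value $\mathbf{x}_0\in\operatorname{int}\Delta$, and let $\tilde A=(a_{ij}-\tfrac12\sigma_i^2)_{i,j}$. (a) For almost every $\omega$ for which $$\frac1T\int_0^T X(t,\omega)\,dt$$ converges as $T\to\infty$, the limit is a Nash equilibrium of $\tilde A$. (b) The following implication holds for almost all $\omega$. If the limit $$\mathbf{y}=\mathbf{y}(\omega)=\lim_{k\to\infty}\frac{1}{T_k(\omega)}\int_0^{T_k(\omega)}X(t,\omega)\,dt$$ exists for a sequence of times $T_k(\omega)$ with $$T_k(\omega)\nearrow\infty\quad\text{and}\quad \frac{\log X_i(T_k(\omega),\omega)}{T_k(\omega)}\to 0,\qquad i=1,\dots,n,$$ then $\mathbf{y}$ is a Nash equilibrium of $\tilde A$ with $\{\tilde A\mathbf{y}\}_1=\cdots=\{\tilde A\mathbf{y}\}_n$.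
   Context: Setting. $n\ge2$; $A=(a_{ij})\in\mathbb{R}^{n\times n}$ is an arbitrary payoff matrix; $\sigma_1,\dots,\sigma_n>0$; $W=(W_1,\dots,W_n)^T$ is a standard $n$-dimensional Brownian motion (independent components). $\Delta=\{\mathbf{y}\in[0,1]^n:y_1+\cdots+y_n=1\}$ and $\operatorname{int}\Delta=\{\mathbf{y}\in\Delta: y_i>0\ \forall i\}$. The stochastic replicator process $\{X(t)\}$ is a strong solution of the Itô equation $$dX(t)=\mathbf{b}(X(t))\,dt+C(X(t))\,dW(t),\qquad X(0)=\mathbf{x}_0\in\operatorname{int}\Delta,$$ with $\mathbf{b}(\mathbf{x})=[\operatorname{diag}(x_1,\dots,x_n)-\mathbf{x}\mathbf{x}^T][A-\operatorname{diag}(\sigma_1^2,\dots,\sigma_n^2)]\mathbf{x}$ and $C(\mathbf{x})=[\operatorname{diag}(x_1,\dots,x_n)-\mathbf{x}\mathbf{x}^T]\operatorname{diag}(\sigma_1,\dots,\sigma_n)$ for $\mathbf{x}\in\Delta$. Equivalently, $X_i=Z_i/(Z_1+\cdots+Z_n)$ where $dZ_i(t)=Z_i(t)[\{AX(t)\}_i\,dt+\sigma_i\,dW_i(t)]$, $Z_i(0)>0$. Almost surely $X(t)\in\operatorname{int}\Delta$ for all $t\ge0$. The modified payoff matrix is $\tilde A=(\tilde a_{ij})$, $\tilde a_{ij}=a_{ij}-\tfrac12\sigma_i^2$. $\{\mathbf{v}\}_i$ denotes the $i$th component of $\mathbf{v}$. A point $\mathbf{p}\in\Delta$ is a Nash equilibrium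 of $\tilde A$ if $\mathbf{p}^T\tilde A\mathbf{p}\ge\mathbf{q}^T\tilde A\mathbf{p}$ for all $\mathbf{q}\in\Delta$. *)

(* Defs.v *)
From HB Require Import structures.
From mathcomp Require Import all_boot all_order all_algebra.
From mathcomp Require Import all_classical all_reals all_analysis.

Set Implicit Arguments.
Unset Strict Implicit.
Unset Printing Implicit Defensive.
Import Order.TTheory GRing.Theory Num.Theory.
Import numFieldNormedType.Exports.
Local Open Scope classical_set_scope.
Local Open Scope ring_scope.

(* Processes are indexed by all of [R]; only the times [0 <= t] matter: nothing
   is assumed about, and nothing depends on, their values at negative times. *)

Definition measurable_wrt d (T : measurableType d) (R : realType)
    (G : set (set T)) (f : T -> R) : Prop :=
  forall V : set R, measurable V -> G (f @^-1` V).

Definition adapted d (T : measurableType d) (R : realType)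
    (F : R -> set (set T)) (H : R -> T -> R) : Prop :=
  forall t : R, 0 <= t -> measurable_wrt (F t) (H t).

(* sigma(B_t : t in D) *)
Definition sigma_process d (T : measurableType d) (R : realType)
    (B : R -> T -> R) (D : set R) : set (set T) :=
  <<s [set E | exists2 t, D t &
         exists2 V : set R, measurable V & E = B t @^-1` V] >>.

Definition indep_sigma d (T : measurableType d) (R : realType)
    (P : probability T R) (G1 G2 : set (set T)) : Prop :=
  forall E1 E2, G1 E1 -> G2 E2 -> P (E1 `&` E2) = (P E1 * P E2)%E.

(* As each [G i] contains the whole space, the product rule over the full index
   set implies the one over every subset of indices. *)
Definition mutual_indep_sigma d (T : measurableType d) (R : realType)
    (P : probability T R) (n : nat) (G : 'I_n -> set (set T)) : Prop :=
  forall E : 'I_n -> set T, (forall i, G i (E i)) ->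
    P (\bigcap_i E i) = (\prod_(i < n) P (E i))%E.

Definition continuous_paths d (T : measurableType d) (R : realType)
    (P : probability T R) (B : R -> T -> R) : Prop :=
  {ae P, forall w, {within `[0, +oo[, continuous (fun t => B t w)}}.

(* [normal_prob m s] is parametrized by the standard deviation [s]. *)
Definition brownian_motion d (T : measurableType d) (R : realType)
    (P : probability T R) (B : R -> T -> R) : Prop :=
  [/\ forall t : R, 0 <= t -> measurable_fun setT (B t),
      {ae P, forall w, B 0 w = 0},
      continuous_paths P B,
      forall s t : R, 0 <= s -> s < t -> forall V : set R, measurable V ->
        P ((fun w => B t w - B s w) @^-1` V) =
        normal_prob 0 (Num.sqrt (t - s)) V
    & forall s t : R, 0 <= s -> s < t ->
        indep_sigma P (sigma_process B `[0, s])
          (sigma_process (fun (_ : R) w => B t w - B s w) setT)].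

Definition standard_brownian_motion d (T : measurableType d) (R : realType)
    (P : probability T R) (n : nat) (W : R -> T -> 'cV[R]_n) : Prop :=
  (forall i, brownian_motion P (fun t w => W t w i 0)) /\
  mutual_indep_sigma P
    (fun i => sigma_process (fun t w => W t w i 0) `[0, +oo[).

(* The filtration generated by W, augmented by the P-null events. *)
Definition brownian_filtration d (T : measurableType d) (R : realType)
    (P : probability T R) (n : nat) (W : R -> T -> 'cV[R]_n) (t : R) :
    set (set T) :=
  <<s (\bigcup_i sigma_process (fun s w => W s w i 0) `[0, t]) `|`
      [set N | measurable N /\ P N = 0%E] >>.

(* The process \sum_(k < size) coef k * 1_]time k, time k.+1]. *)
Record simple_process (T : Type) (R : realType) := SimpleProcess {
  sp_size : nat ;
  sp_time : nat -> R ;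
  sp_coef : nat -> T -> R }.

Definition simple_predictable d (T : measurableType d) (R : realType)
    (F : R -> set (set T)) (S : simple_process T R) : Prop :=
  [/\ 0 <= sp_time S 0%N,
      {homo sp_time S : k l / (k <= l)%N >-> k <= l}
    & forall k, (k < sp_size S)%N ->
        measurable_wrt (F (sp_time S k)) (sp_coef S k) /\
        exists M, forall w, `|sp_coef S k w| <= M].

Definition sp_val (T : Type) (R : realType) (S : simple_process T R)
    (t : R) (w : T) : R :=
  \sum_(k < sp_size S)
    sp_coef S k w * \1_(`]sp_time S k, sp_time S k.+1]) t.

Definition sp_integral (T : Type) (R : realType) (S : simple_process T R)
    (B : R -> T -> R) (t : R) (w : T) : R :=
  \sum_(k < sp_size S)
    sp_coef S k w * (B (Num.min (sp_time S k.+1) t) w -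
                     B (Num.min (sp_time S k) t) w).

(* [I] is (a continuous version of) the Ito integral process
   (\int_0^t H_s dB_s)_(t >= 0) of the measurable, [F]-adapted process [H] with
   E \int_0^t H_s^2 ds < oo: at each time it is the limit in L^2(P) of integrals
   of simple processes that converge to [H] in L^2([0, t] x P). *)
Definition ito_integral d (T : measurableType d) (R : realType)
    (P : probability T R) (F : R -> set (set T))
    (B H I : R -> T -> R) : Prop :=
  [/\ measurable_fun [set p : R * T | 0 <= p.1] (fun p => H p.1 p.2),
      adapted F H,
      forall t : R, 0 <= t ->
        (\int[P]_w \int[lebesgue_measure]_(s in `[0%R, t])
           ((H s w) ^+ 2)%:E < +oo)%E,
      continuous_paths P I
    & forall t : R, 0 <= t ->
        measurable_fun setT (I t) /\
        exists S : nat -> simple_process T R,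
          [/\ forall m, simple_predictable F (S m),
              ((fun m => \int[P]_w \int[lebesgue_measure]_(s in `[0%R, t])
                  ((H s w - sp_val (S m) s w) ^+ 2)%:E) @ \oo --> 0)%E
            & ((fun m => \int[P]_w
                  ((I t w - sp_integral (S m) B t w) ^+ 2)%:E)
                 @ \oo --> 0)%E]].

Definition simplex (R : realType) (n : nat) : set 'cV[R]_n :=
  [set y | (forall i, 0 <= y i 0 <= 1) /\ \sum_i y i 0 = 1].

Definition int_simplex (R : realType) (n : nat) : set 'cV[R]_n :=
  [set y | simplex y /\ forall i, 0 < y i 0].

(* diag(x) - x x^T *)
Definition replicator_mx (R : realType) (n : nat) (x : 'cV[R]_n) : 'M[R]_n :=
  diag_mx x^T - x *m x^T.

Definition drift (R : realType) (n : nat) (A : 'M[R]_n) (sigma : 'I_n -> R)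
    (x : 'cV[R]_n) : 'cV[R]_n :=
  replicator_mx x *m (A - diag_mx (\row_i (sigma i ^+ 2))) *m x.

Definition diffusion (R : realType) (n : nat) (sigma : 'I_n -> R)
    (x : 'cV[R]_n) : 'M[R]_n :=
  replicator_mx x *m diag_mx (\row_i sigma i).

(* Strong solution of dX = drift(X) dt + diffusion(X) dW, X(0) = x0. The
   coefficients are only meant on the simplex, which is the state space of X.
   [I i j] is the stochastic integral of the (i, j) entry of diffusion(X) with
   respect to the j-th component of W. *)
Definition replicator_process d (T : measurableType d) (R : realType)
    (P : probability T R) (n : nat) (A : 'M[R]_n) (sigma : 'I_n -> R)
    (W : R -> T -> 'cV[R]_n) (x0 : 'cV[R]_n) (X : R -> T -> 'cV[R]_n) : Prop :=
  [/\ forall i, adapted (brownian_filtration P W) (fun t w => X t w i 0),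
      forall i, continuous_paths P (fun t w => X t w i 0),
      {ae P, forall w (t : R), 0 <= t -> simplex (X t w)},
      {ae P, forall w, X 0 w = x0}
    & exists I : 'I_n -> 'I_n -> R -> T -> R,
        (forall i j, ito_integral P (brownian_filtration P W)
           (fun t w => W t w j 0)
           (fun t w => diffusion sigma (X t w) i j) (I i j)) /\
        {ae P, forall w (t : R), 0 <= t -> forall i,
           X t w i 0 = x0 i 0
             + Rintegral lebesgue_measure `[0, t]
                 (fun s => drift A sigma (X s w) i 0)
             + \sum_j I i j t w}].

Definition modified_payoff (R : realType) (n : nat) (A : 'M[R]_n)
    (sigma : 'I_n -> R) : 'M[R]_n :=
  \matrix_(i, j) (A i j - 2^-1 * sigma i ^+ 2).

Definition nash_equilibrium (R : realType) (n : nat) (M : 'M[R]_n)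
    (p : 'cV[R]_n) : Prop :=
  simplex p /\
  forall q, simplex q -> (q^T *m M *m p) 0 0 <= (p^T *m M *m p) 0 0.

(* (1/t) \int_0^t x(s) ds for a path x *)
Definition time_average (R : realType) (n : nat) (x : R -> 'cV[R]_n) (t : R) :
    'cV[R]_n :=
  t^-1 *: \col_i Rintegral lebesgue_measure `[0, t] (fun s => x s i 0).

(* Main.v *)
Require Import Defs.
From HB Require Import structures.
From mathcomp Require Import all_boot all_order all_algebra.
From mathcomp Require Import all_classical all_reals all_analysis.
From mathcomp Require Import measurable_realfun ring lra.
Import Order.TTheory GRing.Theory Num.Theory.
Import numFieldNormedType.Exports.
Local Open Scope classical_set_scope.
Local Open Scope ring_scope.

Set Implicit Arguments.
Unset Strict Implicit.
Unset Printing Implicit Defensive.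

(** Write B for the modified payoff matrix. Ito's formula gives, for i and j distinct, ln(X_i(t) /
    X_j(t)) = ln(x0_i / x0_j) + int_0^t ((B X)_i - (B X)_j) ds + sigma_i W_i(t) - sigma_j W_j(t),
    because the drifts of ln X_i and ln X_j differ from (B X)_i and (B X)_j by the same term. Divide
    by t. Since W(t) / t tends to 0 almost surely, the exponential growth rate of X_i / X_j has the
    same limit as (B y_t)_i - (B y_t)_j, where y_t is the time average. If y_t tends to y and (B
    y)_i < (B y)_j, then X_i decays exponentially, its average tends to 0, and y_i = 0: thus y
    charges only best replies and is a Nash equilibrium. Along times where ln X_i / T_k tends to 0
    for every i, the growth rates vanish, so all (B y)_i are equal, which again makes y an
    equilibrium. The deterministic part is [time_average_nash] and [subsequence_nash].

    The formula for the ratio, [replicator_ratio], is proved directly from the definition of the Ito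
    integral. With p the [logistic] of the candidate log ratio it reads x_i (1 - p) - x_j p = 0. On
    a grid of mesh h this gap Z is formed from Euler sums for X_i, X_j and from a discretized log
    ratio. Both the noise and the drift of Z are multiples of Z up to the Euler errors, so
    [one_step_moment] bounds the growth of E Z^2 over a step by c h (E Z^2 + squared Euler error +
    sqrt h), and the discrete Gronwall argument of [euler_gap_bound] makes E Z^2 small. The Euler
    error tends to 0 ([euler_error]) by the Ito isometry, in the form [ito_integral_dist]. Fatou's
    lemma yields the identity at each rational time, and continuity at all times.

    The strong law [brownian_slln] follows from fourth moments of dyadic increments and a chaining
    argument. *)

Section moments.

(** * Random variables with finite moments of all orders, and their expectations *)

Context {d : measure_display} {T : measurableType d} {R : realType}.
Variable P : probability T R.
Implicit Types f g : T -> R.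

(** Variables with all even moments finite form an algebra containing the bounded variables and the
    Brownian increments, so the polynomials met below are integrable without further estimates. *)
Definition Lall f := measurable_fun setT f /\
  forall m, (\int[P]_w ((f w) ^+ m.*2)%:E < +oo)%E.

Definition Ex f : R := Rintegral P setT f.

Lemma even_pow_ge0 (x : R) m : 0 <= x ^+ m.*2.
Proof. by rewrite exprn_even_ge0 // odd_double. Qed.

Lemma Lall_le f g : measurable_fun setT f -> Lall g ->
  (forall w, `|f w| <= `|g w|) -> Lall f.
Proof.
move=> mf [mg ig] fg; split => // m; apply: le_lt_trans (ig m).
apply: ge0_le_integral => //.
- by move=> x _; rewrite lee_fin even_pow_ge0.
- by apply/measurable_EFinP; exact: measurable_funX.
- by apply/measurable_EFinP; exact: measurable_funX.
- move=> x _; rewrite lee_fin -[leLHS]ger0_norm ?even_pow_ge0//.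
  rewrite -[leRHS]ger0_norm ?even_pow_ge0// !normrX.
  by rewrite lerXn2r ?nnegrE.
Qed.

Lemma Lall_cst (c : R) : Lall (fun=> c).
Proof.
split => // m; rewrite integral_cst //= probability_setT mule1 ltry //.
Qed.

Lemma Lall_bounded f M : measurable_fun setT f -> (forall w, `|f w| <= M) ->
  Lall f.
Proof.
move=> mf fM; apply: (Lall_le mf (Lall_cst M)) => w.
exact: (le_trans (fM w) (ler_norm _)).
Qed.

Lemma sum_even_pow_le (x y : R) m :
  (x + y) ^+ m.*2 <= 2 ^+ m.*2 * (x ^+ m.*2 + y ^+ m.*2).
Proof.
rewrite -[leLHS]ger0_norm ?even_pow_ge0// normrX.
have hxy : `|x + y| <= 2 * Num.max `|x| `|y|.
  rewrite (le_trans (ler_normD _ _)) // mulrDl !mul1r lerD // le_max lexx ?orbT//.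
apply: (@le_trans _ _ ((2 * Num.max `|x| `|y|) ^+ m.*2)).
  by rewrite lerXn2r ?nnegrE // (le_trans (normr_ge0 _) hxy).
rewrite exprMn ler_pM2l ?exprn_gt0//.
have nE (z : R) : `|z| ^+ m.*2 = z ^+ m.*2.
  by rewrite -normrX ger0_norm ?even_pow_ge0.
case: (leP `|x| `|y|) => _; rewrite nE.
  by rewrite lerDr even_pow_ge0.
by rewrite lerDl even_pow_ge0.
Qed.

Lemma Lall_lty_sum (c : R) f g m : 0 <= c -> Lall f -> Lall g ->
  (\int[P]_w (c * (f w ^+ m.*2 + g w ^+ m.*2))%:E < +oo)%E.
Proof.
move=> c0 [mf hf] [mg hg].
have mfm : measurable_fun setT (fun w => (f w ^+ m.*2)%:E).
  by apply/measurable_EFinP; exact: measurable_funX.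
have mgm : measurable_fun setT (fun w => (g w ^+ m.*2)%:E).
  by apply/measurable_EFinP; exact: measurable_funX.
under eq_integral do rewrite EFinM EFinD.
rewrite ge0_integralZl //.
- rewrite ge0_integralD //.
  + by rewrite lte_mul_pinfty// lte_add_pinfty.
  + by move=> x _; rewrite lee_fin even_pow_ge0.
  + by move=> x _; rewrite lee_fin even_pow_ge0.
- exact: emeasurable_funD mfm mgm.
- by move=> x _; rewrite -EFinD lee_fin addr_ge0 ?even_pow_ge0.
Qed.

Lemma LallD f g : Lall f -> Lall g -> Lall (fun w => f w + g w).
Proof.
move=> hf hg; have [mf _] := hf; have [mg _] := hg.
split=> [|m]; first exact: measurable_funD.
have c0 : 0 <= 2 ^+ m.*2 :> R by rewrite exprn_ge0.
apply: le_lt_trans (Lall_lty_sum m c0 hf hg).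
apply: ge0_le_integral => //.
- by move=> x _; rewrite lee_fin even_pow_ge0.
- by apply/measurable_EFinP; apply: measurable_funX; exact: measurable_funD.
- apply/measurable_EFinP; apply: measurable_funM => //.
  by apply: measurable_funD; exact: measurable_funX.
- by move=> x _; rewrite lee_fin sum_even_pow_le.
Qed.

(** The inequality a b <= a^2 + b^2, with a and b the powers of order 2m, trades the 2m-th moment of
    the product for the 4m-th moments of the factors. *)
Lemma LallM f g : Lall f -> Lall g -> Lall (fun w => f w * g w).
Proof.
move=> hf hg; have [mf _] := hf; have [mg _] := hg.
split=> [|m]; first exact: measurable_funM.
apply: le_lt_trans (Lall_lty_sum m.*2 ler01 hf hg).
apply: ge0_le_integral => //.
- by move=> x _; rewrite lee_fin even_pow_ge0.
- by apply/measurable_EFinP; apply: measurable_funX; exact: measurable_funM.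
- apply/measurable_EFinP; apply: measurable_funM => //.
  by apply: measurable_funD; exact: measurable_funX.
- move=> x _; rewrite mul1r lee_fin exprMn -[m.*2.*2]muln2 !exprM.
  have := sqr_ge0 (f x ^+ m.*2 - g x ^+ m.*2).
  have := even_pow_ge0 (f x) m; have := even_pow_ge0 (g x) m.
  move: (f x ^+ _) (g x ^+ _) => a b; nra.
Qed.

Lemma LallZ (c : R) f : Lall f -> Lall (fun w => c * f w).
Proof. by move=> hf; exact: LallM (Lall_cst c) hf. Qed.

Lemma LallN f : Lall f -> Lall (fun w => - f w).
Proof.
move=> hf; rewrite (_ : (fun w => - f w) = fun w => -1 * f w); first exact: LallZ.
by apply/funext => w; rewrite mulN1r.
Qed.

Lemma LallB f g : Lall f -> Lall g -> Lall (fun w => f w - g w).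
Proof. by move=> hf hg; exact: LallD hf (LallN hg). Qed.

Lemma LallX f m : Lall f -> Lall (fun w => f w ^+ m).
Proof.
move=> hf; elim: m => [|m IH].
  rewrite (_ : (fun w => _) = fun=> 1); first exact: Lall_cst.
  by apply/funext => w; rewrite expr0.
rewrite (_ : (fun w => f w ^+ m.+1) = fun w => f w * f w ^+ m); first exact: LallM.
by apply/funext => w; rewrite exprS.
Qed.

Lemma Lall_norm f : Lall f -> Lall (fun w => `|f w|).
Proof.
move=> hf; apply: (Lall_le _ hf); last by move=> w; rewrite normr_id.
by apply: measurableT_comp => //; case: hf.
Qed.

Lemma Lall_sum (I : Type) (s : seq I) (F : I -> T -> R) :
  (forall i, Lall (F i)) -> Lall (fun w => \sum_(i <- s) F i w).
Proof.
move=> hF; elim: s => [|i s IH].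
  rewrite (_ : (fun w => _) = fun=> 0); first exact: Lall_cst.
  by apply/funext => w; rewrite big_nil.
rewrite (_ : (fun w => _) = fun w => F i w + \sum_(i <- s) F i w); first exact: LallD.
by apply/funext => w; rewrite big_cons.
Qed.

Lemma Lall_integrable f : Lall f -> P.-integrable setT (EFin \o f).
Proof.
move=> hf; have [mf _] := hf; apply/integrableP; split; first exact/measurable_EFinP.
apply: le_lt_trans (Lall_lty_sum 1 ler01 hf (Lall_cst 1)).
apply: ge0_le_integral => //.
- by apply: measurableT_comp => //; exact/measurable_EFinP.
- apply/measurable_EFinP; apply: measurable_funM => //.
  by apply: measurable_funD; exact: measurable_funX.
- move=> x _ /=; rewrite lee_fin expr1n mul1r doubleS double0.
  have := sqr_ge0 (`|f x| - 1); have := real_normK (num_real (f x)).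
  move: `|f x| => a; nra.
Qed.

Lemma Ex_EFin f : Lall f -> (\int[P]_w (f w)%:E = (Ex f)%:E)%E.
Proof.
by move=> hf; rewrite /Ex /Rintegral fineK//; apply: integrable_fin_num => //; exact: Lall_integrable.
Qed.

Lemma ExD f g : Lall f -> Lall g -> Ex (fun w => f w + g w) = Ex f + Ex g.
Proof. by move=> hf hg; rewrite /Ex RintegralD //; exact: Lall_integrable. Qed.

Lemma ExB f g : Lall f -> Lall g -> Ex (fun w => f w - g w) = Ex f - Ex g.
Proof. by move=> hf hg; rewrite /Ex RintegralB //; exact: Lall_integrable. Qed.

Lemma ExZ (c : R) f : Lall f -> Ex (fun w => c * f w) = c * Ex f.
Proof. by move=> hf; rewrite /Ex RintegralZl //; exact: Lall_integrable. Qed.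

Lemma Ex_cst (c : R) : Ex (fun=> c) = c.
Proof. by rewrite /Ex Rintegral_cst //= probability_setT mulr1. Qed.

Lemma Ex_ge0 f : (forall w, 0 <= f w) -> 0 <= Ex f.
Proof. by move=> f0; apply: Rintegral_ge0 => x _; exact: f0. Qed.

Lemma Ex_le f g : Lall f -> Lall g -> (forall w, f w <= g w) -> Ex f <= Ex g.
Proof.
by move=> hf hg fg; apply: le_Rintegral => //; exact: Lall_integrable.
Qed.

Lemma Ex_sum (I : Type) (s : seq I) (F : I -> T -> R) :
  (forall i, Lall (F i)) ->
  Ex (fun w => \sum_(i <- s) F i w) = \sum_(i <- s) Ex (F i).
Proof.
move=> hF; elim: s => [|i s IH].
  rewrite big_nil (_ : (fun w => _) = fun=> 0) ?Ex_cst//.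
  by apply/funext => w; rewrite big_nil.
rewrite (_ : (fun w => _) = fun w => F i w + \sum_(i <- s) F i w); last first.
  by apply/funext => w; rewrite big_cons.
by rewrite ExD // ?IH ?big_cons //; exact: Lall_sum.
Qed.

Lemma eq_Ex f g : f =1 g -> Ex f = Ex g.
Proof. by move=> /funext ->. Qed.

End moments.

(** * Independence: from generators to sigma-algebras, and expectations of products *)

Section independence.
Context {d : measure_display} {T : measurableType d} {R : realType}.
Variable P : probability T R.

(** Both sides are finite measures in [E1]: the restriction of [P] to [E2], and a multiple of [P].
    Finite measures that agree on a pi-system containing the whole space agree on the sigma-algebra
    it generates. *)
Lemma indep_generated (G : set (set T)) (E2 : set T) :
  G `<=` measurable -> setI_closed G -> G setT -> measurable E2 ->
  (forall E1, G E1 -> P (E1 `&` E2) = (P E1 * P E2)%E) ->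
  forall E1, <<s G >> E1 -> P (E1 `&` E2) = (P E1 * P E2)%E.
Proof.
move=> Gm GI GT mE2 h E1 sE1.
have fE2 : (P E2 \is a fin_num) by rewrite fin_num_measure.
have c0 : 0 <= fine (P E2) by rewrite fine_ge0.
have h2 E : mscale (NngNum c0) P E = (P E * P E2)%E.
  by rewrite /mscale/= fineK// muleC.
rewrite -h2.
have /= := @g_sigma_algebra_measure_unique _ _ _ G Gm (fun=> setT) (fun=> GT)
  _ (mrestr P mE2) (mscale (NngNum c0) P) GI.
apply => //.
- by rewrite bigcup_const//; exists 0%N.
- by move=> A GA; rewrite -[LHS]/(P (A `&` E2)) -[RHS]/(mscale (NngNum c0) P A) h2 h.
- by move=> k; rewrite -[X in (X < _)%E]/(P (setT `&` E2)) setTI -ge0_fin_numE.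
Qed.

(** Independence makes the joint law of the pair the product of the two laws, since they agree on
    rectangles; Fubini in the plane then separates the integral of xy. *)
Lemma Ex_indep (G1 G2 : set (set T)) (f g : T -> R) :
  indep_sigma P G1 G2 -> measurable_wrt G1 f -> measurable_wrt G2 g ->
  Lall P f -> Lall P g -> Ex P (fun w => f w * g w) = Ex P f * Ex P g.
Proof.
move=> ind mf mg hf hg.
have [mf' _] := hf; have [mg' _] := hg.
pose F : {RV P >-> R} := mfun_Sub (mem_set mf').
pose H : {RV P >-> R} := mfun_Sub (mem_set mg').
have mFH : measurable_fun setT (fun w => (f w, g w)).
  exact: measurable_fun_pair.
pose FH : {RV P >-> _} := mfun_Sub (mem_set mFH).
have prodE : forall A : set (R * R), measurable A ->
    (distribution P F \x distribution P H)%E A = distribution P FH A.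
  apply: product_measure_unique => A B mA mB.
  rewrite /distribution/pushforward/=.
  by rewrite -(ind _ _ (mf A mA) (mg B mB)).
have mxy : measurable_fun setT (fun p : R * R => (p.1 * p.2)%:E).
  by apply/measurable_EFinP; apply: measurable_funM.
have mE : measurable_fun setT (@EFin R) by exact: (measurable_EFinP setT (@id R)).2.
apply: EFin_inj; rewrite EFinM -Ex_EFin; last exact: LallM.
have -> : (\int[P]_w (f w * g w)%:E = \int[distribution P FH]_p (p.1 * p.2)%:E)%E.
  rewrite (@integral_distribution _ _ _ _ _ P FH)//.
  exact: Lall_integrable (LallM hf hg).
have ixy : (distribution P F \x distribution P H)%E.-integrable setT
    (fun p : R * R => (p.1 * p.2)%:E).
  apply/integrable12ltyP => //=.
  under eq_integral => x _.
    rewrite (_ : (\int[distribution P H]_y `|(x * y)%:E| = `|x%:E| * \int[distribution P H]_y `|y%:E|)%E); last first.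
      rewrite -ge0_integralZl//; first by apply: eq_integral => y _; rewrite EFinM abseM.
      by apply: measurableT_comp => //; exact/measurable_EFinP.
    over.
  have m1 : measurable_fun [set: R] (fun x : R => `|x%:E|%E).
    by apply: measurableT_comp => //; exact/measurable_EFinP.
  have hI (V : {RV P >-> R}) : Lall P V ->
      (\int[distribution P V]_x `|x%:E| < +oo)%E.
    move=> hV; rewrite ge0_integral_distribution//.
    by have /integrableP[_ /=] := Lall_integrable hV.
  rewrite /= ge0_integralZr//; last exact: integral_ge0.
  rewrite lte_mul_pinfty// ?ge0_fin_numE ?integral_ge0//; exact: hI.
rewrite (eq_measure_integral (distribution P F \x distribution P H)%E); last first.
  by move=> A mA _; exact/esym/prodE.
rewrite -integral12_prod_meas1//.
have distE (V : {RV P >-> R}) : Lall P V ->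
    (\int[distribution P V]_y y%:E)%E = (Ex P V)%:E.
  move=> hV; rewrite -Ex_EFin// (@integral_distribution _ _ _ _ _ P V EFin)//.
  exact: Lall_integrable.
have -> : Ex P f = Ex P F by [].
have -> : Ex P g = Ex P H by [].
rewrite -!distE//.
have iV (V : {RV P >-> R}) : Lall P V -> (distribution P V).-integrable setT EFin.
  move=> hV; apply/integrableP; split; first exact: mE.
  rewrite ge0_integral_distribution//; last by apply: measurableT_comp => //; exact: mE.
  by have /integrableP[_ /=] := Lall_integrable hV.
have fH : (\int[distribution P H]_y y%:E)%E \is a fin_num.
  by apply: integrable_fin_num => //; exact: iV.
rewrite -[X in (_ * X)%E](fineK fH) -integralZr//; last exact: iV.
rewrite fineK//; apply: eq_integral => x _.
rewrite /fubini_F /= -integralZl//; last exact: iV.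
Qed.

End independence.

(** * Measurability with respect to a sub-sigma-algebra *)

Section measurable_wrt_theory.
Context {d : measure_display} {T : measurableType d} {R : realType}.
Implicit Types (G : set (set T)) (f g : T -> R).

Lemma measurable_wrtP G f : measurable_wrt <<s G >> f <->
  measurable_fun setT (f : g_sigma_algebraType G -> R).
Proof.
split=> [hf _ V mV|hf V mV]; first by rewrite setTI; exact: hf.
by rewrite -[_ @^-1` _]setTI; exact: hf.
Qed.

Lemma measurable_wrt_cst G (c : R) : measurable_wrt <<s G >> (fun=> c).
Proof. by apply/measurable_wrtP; exact: measurable_cst. Qed.

Lemma measurable_wrtD G f g : measurable_wrt <<s G >> f ->
  measurable_wrt <<s G >> g -> measurable_wrt <<s G >> (fun w => f w + g w).
Proof.
move=> /measurable_wrtP hf /measurable_wrtP hg; apply/measurable_wrtP.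
exact: measurable_funD.
Qed.

Lemma measurable_wrtB G f g : measurable_wrt <<s G >> f ->
  measurable_wrt <<s G >> g -> measurable_wrt <<s G >> (fun w => f w - g w).
Proof.
move=> /measurable_wrtP hf /measurable_wrtP hg; apply/measurable_wrtP.
exact: measurable_funB.
Qed.

Lemma measurable_wrtM G f g : measurable_wrt <<s G >> f ->
  measurable_wrt <<s G >> g -> measurable_wrt <<s G >> (fun w => f w * g w).
Proof.
move=> /measurable_wrtP hf /measurable_wrtP hg; apply/measurable_wrtP.
exact: measurable_funM.
Qed.

Lemma measurable_wrt_comp G (phi : R -> R) f : measurable_fun setT phi ->
  measurable_wrt <<s G >> f -> measurable_wrt <<s G >> (fun w => phi (f w)).
Proof.
move=> hp /measurable_wrtP hf; apply/measurable_wrtP.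
exact: measurableT_comp hp hf.
Qed.

Lemma measurable_wrt_sum G (I : Type) (s : seq I) (F : I -> T -> R) :
  (forall i, measurable_wrt <<s G >> (F i)) ->
  measurable_wrt <<s G >> (fun w => \sum_(i <- s) F i w).
Proof.
move=> hF; elim: s => [|i s IH].
  rewrite (_ : (fun w => _) = fun=> 0); first exact: measurable_wrt_cst.
  by apply/funext => w; rewrite big_nil.
rewrite (_ : (fun w => _) = fun w => F i w + \sum_(i <- s) F i w).
  exact: measurable_wrtD.
by apply/funext => w; rewrite big_cons.
Qed.

Lemma measurable_wrt_sub (G1 G2 : set (set T)) f :
  G1 `<=` G2 -> measurable_wrt G1 f -> measurable_wrt G2 f.
Proof. by move=> G12 hf V mV; exact/G12/hf. Qed.

Lemma measurable_wrt_fun G f : G `<=` measurable -> measurable_wrt G f ->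
  measurable_fun setT f.
Proof. by move=> Gm hf _ V mV; rewrite setTI; exact/Gm/hf. Qed.

Lemma sigma_process_sub (B : R -> T -> R) (D : set R) (H : set (set T)) :
  sigma_algebra setT H -> (forall t, D t -> measurable_wrt H (B t)) ->
  sigma_process B D `<=` H.
Proof.
move=> sH hB; apply: smallest_sub => // E [t Dt [V mV ->]]; exact: hB.
Qed.

Lemma sigma_process_wrt (B : R -> T -> R) (D : set R) t : D t ->
  measurable_wrt (sigma_process B D) (B t).
Proof. by move=> Dt V mV; apply: sub_sigma_algebra; exists t => //; exists V. Qed.

Lemma g_sigma_mono (G1 G2 : set (set T)) : G1 `<=` <<s G2 >> -> <<s G1 >> `<=` <<s G2 >>.
Proof. by move=> h; apply: smallest_sub => //; exact: smallest_sigma_algebra. Qed.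

End measurable_wrt_theory.

(** * Pi-systems that generate the join of finitely many sigma-algebras *)

Section finite_intersections.
Context {d : measure_display} {T : measurableType d} {n : nat}.
Implicit Types G : 'I_n -> set (set T).

(** These intersections form a pi-system as soon as each [G i] is one, and mutual independence can
    be read off on them factor by factor. *)
Definition finite_inter G : set (set T) :=
  [set E | exists2 F : 'I_n -> set T, forall i, G i (F i) & E = \bigcap_i F i].

Lemma finite_interI G : (forall i, setI_closed (G i)) -> setI_closed (finite_inter G).
Proof.
move=> hG _ _ [F1 h1 ->] [F2 h2 ->]; exists (fun i => F1 i `&` F2 i).
  by move=> i; exact: hG.
by rewrite bigcapI.
Qed.

Lemma finite_interT G : (forall i, G i setT) -> finite_inter G setT.
Proof. by move=> hG; exists (fun=> setT) => //; rewrite bigcapT. Qed.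

Lemma finite_inter_sub G i : (forall i, G i setT) -> G i `<=` finite_inter G.
Proof.
move=> hG E GE; exists (fun k => if k == i then E else setT).
  by move=> k; case: eqP => [->|].
apply/seteqP; split => [w Ew k _|w /(_ i I)]; last by rewrite eqxx.
by case: eqP.
Qed.

Lemma finite_inter_measurable G : (forall i, G i `<=` measurable) ->
  finite_inter G `<=` measurable.
Proof.
move=> hG _ [F hF ->]; apply: fin_bigcap_measurable => // i _.
exact: hG.
Qed.

End finite_intersections.

(** * The augmented Brownian filtration and its independence of later increments *)

Section brownian.
Context {d : measure_display} {T : measurableType d} {R : realType}.
Variables (P : probability T R) (n : nat) (W : R -> T -> 'cV[R]_n).
Hypothesis hW : standard_brownian_motion P W.

Definition increment (s t : R) (i : 'I_n) (w : T) : R := W t w i 0 - W s w i 0.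

(** The process passed to [sigma_process] is constant in time: this encodes the sigma-algebra of a
    single variable, as in the definition of Brownian motion. *)
Definition sigma_increments (s t : R) : set (set T) :=
  <<s \bigcup_i sigma_process (fun _ : R => increment s t i) setT >>.

Lemma bm_measurable i t : 0 <= t -> measurable_fun setT (fun w => W t w i 0).
Proof. by have [h _] := hW; have [+ _ _ _ _] := h i; apply. Qed.

Lemma increment_measurable i s t : 0 <= s -> 0 <= t ->
  measurable_fun setT (increment s t i).
Proof. by move=> s0 t0; apply: measurable_funB; exact: bm_measurable. Qed.

Lemma filtration_sub s t : s <= t ->
  brownian_filtration P W s `<=` brownian_filtration P W t.
Proof.
move=> st; apply: g_sigma_mono => E [[i _ Ei]|En]; last first.
  by apply: sub_sigma_algebra; right.
apply: (@sub_sigma_algebra _ _ _); left; exists i => //.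
move: E Ei; apply: g_sigma_mono => E [r /= rs hE].
apply: sub_sigma_algebra; exists r => //=.
by move: rs; rewrite !in_itv/= => /andP[-> /le_trans]; apply.
Qed.

Lemma sigma_process_measurable i (D : set R) : D `<=` [set t | 0 <= t] ->
  sigma_process (fun t w => W t w i 0) D `<=` measurable.
Proof.
move=> hD; apply: sigma_process_sub; first exact: sigma_algebra_measurable.
by move=> t /hD/= t0 V mV; rewrite -[_ @^-1` _]setTI; exact: (bm_measurable i t0).
Qed.

Lemma filtration_measurable t : brownian_filtration P W t `<=` measurable.
Proof.
apply: smallest_sub; first exact: sigma_algebra_measurable.
move=> E [[i _]|[]//]; apply: sigma_process_measurable => r /=.
by rewrite in_itv/= => /andP[].
Qed.

Lemma bm_adapted i s t : 0 <= s -> s <= t ->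
  measurable_wrt (brownian_filtration P W t) (fun w => W s w i 0).
Proof.
move=> s0 st V mV; apply: sub_sigma_algebra; left; exists i => //.
apply: sub_sigma_algebra; exists s => /=; first by rewrite in_itv/= s0.
by exists V.
Qed.

Lemma increment_wrt i s t : measurable_wrt (sigma_increments s t) (increment s t i).
Proof.
move=> V mV; apply: sub_sigma_algebra; exists i => //.
by apply: sub_sigma_algebra; exists 0 => //; exists V.
Qed.

Lemma sigma_process_closed (B : R -> T -> R) D :
  sigma_algebra setT (sigma_process B D).
Proof. exact: smallest_sigma_algebra. Qed.

Lemma sigma_algebra_setI_closed (G : set (set T)) : setI_closed <<s G >>.
Proof. exact: (@measurableI _ (g_sigma_algebraType G)). Qed.

Lemma sigma_algebra_setT (G : set (set T)) : <<s G >> setT.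
Proof. exact: (@measurableT _ (g_sigma_algebraType G)). Qed.

(** On intersections of one event per component, two facts combine: the components are mutually
    independent, and inside each component the increment is independent of the past. Null events are
    added to the past, and [indep_generated], used on each side in turn, passes to the generated
    sigma-algebras. *)
Lemma brownian_indep s t : 0 <= s -> s < t ->
  indep_sigma P (brownian_filtration P W s) (sigma_increments s t).
Proof.
move=> s0 st; have t0 : 0 <= t by rewrite (le_trans s0) ?ltW.
have [hB hmut] := hW.
pose past i := sigma_process (fun r w => W r w i 0) `[0, s].
pose inc i := sigma_process (fun _ : R => increment s t i) setT.
have pastm i : past i `<=` measurable.
  by apply: sigma_process_measurable => r /=; rewrite in_itv/= => /andP[].
have incP i : inc i `<=` sigma_process (fun r w => W r w i 0) `[0, +oo[.
  apply: sigma_process_sub; first exact: smallest_sigma_algebra.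
  move=> _ _; apply: measurable_wrtB; apply: (sigma_process_wrt (B := fun r w => W r w i 0)).
    by rewrite /= in_itv/= t0.
  by rewrite /= in_itv/= s0.
have pastP i : past i `<=` sigma_process (fun r w => W r w i 0) `[0, +oo[.
  apply: sigma_process_sub; first exact: smallest_sigma_algebra.
  move=> r /=; rewrite in_itv/= => /andP[r0 _]; apply: (sigma_process_wrt (B := fun r w => W r w i 0)).
  by rewrite /= in_itv/= r0.
have incm i : inc i `<=` measurable.
  move=> E /incP; apply: sigma_process_measurable => r /=.
  by rewrite in_itv/= andbT.
have step1 E1 E2 : finite_inter past E1 -> finite_inter inc E2 ->
    P (E1 `&` E2) = (P E1 * P E2)%E.
  move=> [F1 h1 ->] [F2 h2 ->]; rewrite -bigcapI.
  rewrite hmut; last first.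
    move=> i; apply: sigma_algebra_setI_closed; first exact: (pastP i _ (h1 i)).
    exact: (incP i _ (h2 i)).
  rewrite hmut; last by move=> i; exact: (pastP i _ (h1 i)).
  rewrite hmut; last by move=> i; exact: (incP i _ (h2 i)).
  rewrite -big_split/=; apply: eq_bigr => i _.
  by have [_ _ _ _ ind] := hB i; exact: (ind _ _ s0 st _ _ (h1 i) (h2 i)).
(* Adding the null events keeps a pi-system, because an intersection with a null event is null. *)
pose G1 := finite_inter past `|` [set N | measurable N /\ P N = 0%E].
have nullI N (B : set T) : measurable N -> P N = 0%E -> measurable B -> P (N `&` B) = 0%E.
  move=> mN N0 mB; apply/eqP; rewrite -measure_le0 -N0.
  by apply: le_measure; rewrite ?inE//; exact: measurableI.
have fpm : finite_inter past `<=` measurable by exact: finite_inter_measurable.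
have G1m : G1 `<=` measurable by move=> E [/fpm//|[]].
have fim : finite_inter inc `<=` measurable by exact: finite_inter_measurable.
have G1I : setI_closed G1.
  move=> A B GA GB; have mA := G1m _ GA; have mB := G1m _ GB.
  case: GA => [GA|[_ A0]]; last by right; split; [exact: measurableI|exact: nullI].
  case: GB => [GB|[_ B0]]; last first.
    by right; split; [exact: measurableI|rewrite setIC; exact: nullI].
  left; apply: finite_interI => // i; exact: sigma_algebra_setI_closed.
have G1T : G1 setT by left; apply: finite_interT => i; exact: sigma_algebra_setT.
have step2 E1 E2 : brownian_filtration P W s E1 -> finite_inter inc E2 ->
    P (E1 `&` E2) = (P E1 * P E2)%E.
  move=> h1 h2; apply: (@indep_generated _ _ _ P G1) => //; first exact: fim.
    move=> E [hE|[mE E0]]; first exact: step1.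
    by rewrite E0 mul0e nullI//; exact: fim.
  move: E1 h1; apply: g_sigma_mono => E [[i _ hE]|hE]; apply: sub_sigma_algebra.
    left; apply: finite_inter_sub hE => k; exact: sigma_algebra_setT.
  by right.
(* The past event is now arbitrary; the same extension is made on the side of the increments. *)
move=> E1 E2 h1 h2; rewrite setIC muleC.
apply: (@indep_generated _ _ _ P (finite_inter inc)) => //.
- by apply: finite_interI => i; exact: sigma_algebra_setI_closed.
- by apply: finite_interT => i; exact: sigma_algebra_setT.
- exact: filtration_measurable h1.
- by move=> E hE; rewrite setIC muleC; exact: step2.
move: E2 h2; apply: g_sigma_mono => E [i _ hE]; apply: sub_sigma_algebra.
by apply: finite_inter_sub hE => k; exact: sigma_algebra_setT.
Qed.

(** Mutual independence is applied to a family whose members other than those of [i] and [j] are the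
    whole space. *)
Lemma increments_indep i j s t : i != j -> 0 <= s -> 0 <= t ->
  indep_sigma P (sigma_process (fun _ : R => increment s t i) setT)
    (sigma_process (fun _ : R => increment s t j) setT).
Proof.
move=> ij s0 t0; have [_ hmut] := hW.
have incP k : sigma_process (fun _ : R => increment s t k) setT `<=` sigma_process (fun r w => W r w k 0) `[0, +oo[.
  apply: sigma_process_sub; first exact: smallest_sigma_algebra.
  move=> _ _; apply: measurable_wrtB; apply: (sigma_process_wrt (B := fun r w => W r w k 0)).
    by rewrite /= in_itv/= t0.
  by rewrite /= in_itv/= s0.
move=> E1 E2 /incP h1 /incP h2.
pose F k := if k == i then E1 else if k == j then E2 else setT.
have := hmut F; rewrite (_ : \bigcap_i F i = E1 `&` E2); last first.
  apply/seteqP; split => [w h|w [w1 w2] k _]; last first.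
    by rewrite /F; case: eqP => // _; case: eqP.
  split; first by have := h i I; rewrite /F eqxx.
  by have := h j I; rewrite /F eqxx eq_sym (negbTE ij).
move=> ->; last first.
  move=> k; rewrite /F; case: eqP => [->//|_]; case: eqP => [->//|_].
  exact: sigma_algebra_setT.
rewrite (bigD1 i)//= (bigD1 j)/=; last by rewrite eq_sym.
rewrite big1 ?mule1; last first.
  by move=> k /andP[/negbTE ki /negbTE kj]; rewrite /F ki kj probability_setT.
by rewrite /F !eqxx eq_sym (negbTE ij).
Qed.

End brownian.

(** * Moments of centred normal laws *)

Section normal_moments.
Context {R : realType}.
Implicit Types (m s v : R).
Local Notation mu := (@lebesgue_measure R).

Import HBNNSimple.

Let mpdf m s : measurable_fun setT (fun x => (normal_pdf m s x)%:E).
Proof. by apply/measurable_EFinP; exact: measurable_normal_pdf. Qed.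

Let integral_normal_prob_nnsfun m s (f : {nnsfun R >-> R}) :
  (\int[normal_prob m s]_x (f x)%:E = \int[mu]_x ((f x)%:E * (normal_pdf m s x)%:E))%E.
Proof.
have ind_ge0 r x : 0 <= r * \1_(f @^-1` [set r]) x :> R.
  by rewrite -lee_fin EFinM nnfun_muleindic_ge0.
have mind r : measurable_fun setT (fun x : R => (r * \1_(f @^-1` [set r]) x)%:E).
  apply/measurable_EFinP; apply: measurable_funM => //; exact: measurable_indic.
under [LHS]eq_integral do rewrite fimfunE -fsumEFin//.
rewrite [LHS]ge0_integral_fsum//; last by move=> n x _; rewrite lee_fin.
under [RHS]eq_integral.
  move=> x xD; rewrite fimfunE -fsumEFin// muleC ge0_mule_fsumr; last first.
    by move=> r; rewrite lee_fin.
  over.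
rewrite [RHS]ge0_integral_fsum//; last 2 first.
  - by move=> r; apply: emeasurable_funM; [exact: mpdf|exact: mind].
  - by move=> n x _; rewrite mule_ge0// lee_fin ?normal_pdf_ge0.
apply: eq_fsbigr => r _.
have [r0|r0] := leP 0 r; last first.
  by rewrite !integral0_eq// => x _; rewrite preimage_nnfun0// indic0 mulr0 ?mule0.
have mA : measurable (f @^-1` [set r] : set R) by [].
under [LHS]eq_integral do rewrite EFinM.
rewrite ge0_integralZl//; last by apply/measurable_EFinP; exact: measurable_indic.
rewrite integral_indic//= setIT /normal_prob integral_mkcond/= -ge0_integralZl//; last first.
- by move=> x _; apply: erestrict_ge0 => y _; rewrite lee_fin normal_pdf_ge0.
- have h : measurable_fun (f @^-1` [set r]) (fun x => (normal_pdf m s x)%:E) by exact: (measurable_funTS (mpdf m s)).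
  by have := (measurable_restrictT _ mA).1 h; apply.
apply: eq_integral => x _; rewrite patchE indicE.
by case: ifPn => _ /=; rewrite ?mulr1 ?mulr0 ?mule0// muleC.
Qed.

(** [normal_prob] is given on sets as the integral of its density; simple functions and monotone
    convergence carry the density formula over to integrals. *)
Lemma ge0_integral_normal_prob m s (f : R -> \bar R) :
  measurable_fun setT f -> (forall x, 0 <= f x)%E ->
  (\int[normal_prob m s]_x f x = \int[mu]_x (f x * (normal_pdf m s x)%:E))%E.
Proof.
move=> mf f0; pose f_ := nnsfun_approx measurableT mf.
have nd x a b : (a <= b)%N -> f_ a x <= f_ b x.
  by move=> ab; have /lefP := nd_nnsfun_approx measurableT mf ab; apply.
have mfn n : measurable_fun [set: R] (fun x => (f_ n x)%:E) by apply/measurable_EFinP.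
transitivity (lim (\int[normal_prob m s]_x (f_ n x)%:E @[n --> \oo])%E).
  rewrite -monotone_convergence//=.
  - apply: eq_integral => ? /[!inE] xD; apply/esym/cvg_lim => //=.
    exact: cvg_nnsfun_approx.
  - by move=> n ? _; rewrite lee_fin.
  - by move=> x _ a b ab; rewrite lee_fin; exact: nd.
have p0 x : (0 <= (normal_pdf m s x)%:E)%E by rewrite lee_fin normal_pdf_ge0.
transitivity (lim (\int[mu]_x ((f_ n x)%:E * (normal_pdf m s x)%:E) @[n --> \oo])%E).
  by apply: congr_lim; apply/funext => n /=; exact: integral_normal_prob_nnsfun.
rewrite -monotone_convergence//=.
- apply: eq_integral => x _; apply/cvg_lim => //.
  by apply: cvgeZr => //; exact: cvg_nnsfun_approx.
- by move=> n; have := emeasurable_funM (mfn n) (mpdf m s); apply.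
- by move=> n x _; rewrite mule_ge0 ?lee_fin ?normal_pdf_ge0.
- move=> x _ a b ab; rewrite lee_wpmul2r// lee_fin; exact: nd.
Qed.

Lemma expR_pow_le (u : R) k : 0 <= u -> u ^+ k <= k`!%:R * expR u.
Proof.
move=> u0; case: k => [|k]; first by rewrite expr0 fact0 mul1r -[leLHS]expR0 ler_expR.
have := expR_ge1Dxn k u0; have : 0 < (k.+1)`!%:R :> R by rewrite ltr0n fact_gt0.
move=> f0 h; rewrite mulrC -ler_pdivrMr//; apply: le_trans h.
by rewrite lerDr.
Qed.

Let integral_normal_pdfZ m s c : 0 <= c ->
  (\int[mu]_x (c%:E * (normal_pdf m s x)%:E) = c%:E)%E.
Proof.
move=> c0; rewrite ge0_integralZl ?integral_normal_pdf ?mule1//.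
  by have := mpdf m s; apply.
by move=> x _; rewrite lee_fin normal_pdf_ge0.
Qed.

Definition normal_moment_cst k : R := 2 * 4 ^+ k * k`!%:R.

Lemma normal_peak_scale s v : 0 < s -> 0 < v ->
  normal_peak s = v * normal_peak (s * v).
Proof.
move=> s0 v0; rewrite /normal_peak.
have -> : (s * v) ^+ 2 * pi *+ 2 = v ^+ 2 * (s ^+ 2 * pi *+ 2) by ring.
by rewrite sqrtrM ?sqr_ge0// sqrtr_sqr gtr0_norm// invfM mulrA divff ?gt_eqF// mul1r.
Qed.

(** Half of the Gaussian exponent absorbs the power: with u = x^2 / (4 s^2) one has u^k exp(-u) <=
    k!, and what remains is, up to the factor sqrt 2 <= 2, the normal density of variance 2 s^2, of
    mass 1. *)
Lemma normal_even_moment_le s k : 0 < s ->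
  (\int[normal_prob 0 s]_x (x ^+ k.*2)%:E <= (normal_moment_cst k * s ^+ k.*2)%:E)%E.
Proof.
move=> s0; rewrite ge0_integral_normal_prob//; first last.
- by move=> x; rewrite lee_fin even_pow_ge0.
- by apply/measurable_EFinP; exact: measurable_funX.
pose r : R := Num.sqrt 2.
have r2 : r ^+ 2 = 2 by rewrite sqr_sqrtr.
have r0 : 0 < r by rewrite sqrtr_gt0.
have C0 : 0 <= normal_moment_cst k * s ^+ k.*2.
  by rewrite /normal_moment_cst !mulr_ge0 ?even_pow_ge0.
rewrite -(integral_normal_pdfZ 0 (s * r) C0).
apply: ge0_le_integral => //.
- by move=> x _; rewrite mule_ge0 ?lee_fin ?even_pow_ge0 ?normal_pdf_ge0.
- have h : measurable_fun setT (fun x : R => (x ^+ k.*2)%:E).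
    by apply/measurable_EFinP; exact: measurable_funX.
  by have := emeasurable_funM h (mpdf 0 s); apply.
- by have := measurable_funeM (normal_moment_cst k * s ^+ k.*2)%:E (mpdf 0 (s * r)); apply.
move=> x _; rewrite -!EFinM lee_fin !normal_pdfE ?mulf_neq0 ?gt_eqF//.
rewrite (@normal_peak_scale s r)// /normal_fun !subr0.
pose u := x ^+ 2 / (s ^+ 2 * 4).
have u0 : 0 <= u by rewrite divr_ge0 ?sqr_ge0// mulr_ge0 ?sqr_ge0.
have -> : - x ^+ 2 / (s ^+ 2 *+ 2) = - u - u.
  by rewrite /u; field; rewrite gt_eqF.
have -> : - x ^+ 2 / ((s * r) ^+ 2 *+ 2) = - u.
  rewrite /u exprMn r2; by field; rewrite gt_eqF.
have -> : x ^+ k.*2 = s ^+ k.*2 * 4 ^+ k * u ^+ k.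
  rewrite -muln2 mulnC !exprM -!exprMn; congr (_ ^+ _).
  by rewrite /u; field; rewrite gt_eqF.
have hu := expR_pow_le k u0.
have e1 : expR u * expR (- u) = 1 by rewrite expRxMexpNx_1.
have rle : r <= 2 by rewrite -(ler_pXn2r (n:=2)) ?nnegrE// ?r2 ?expr2 ?ltW//; lra.
rewrite expRD /normal_moment_cst.
have -> : s ^+ k.*2 * 4 ^+ k * u ^+ k * (r * normal_peak (s * r) * (expR (- u) * expR (- u))) =
  (s ^+ k.*2 * 4 ^+ k * normal_peak (s * r) * expR (- u)) * (r * (u ^+ k * expR (- u))) by ring.
have -> : 2 * 4 ^+ k * k`!%:R * s ^+ k.*2 * (normal_peak (s * r) * expR (- u)) =
  (s ^+ k.*2 * 4 ^+ k * normal_peak (s * r) * expR (- u)) * (2 * k`!%:R) by ring.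
apply: ler_wpM2l.
  by rewrite !mulr_ge0 ?even_pow_ge0 ?expR_ge0 ?normal_peak_ge0// exprn_ge0.
apply: ler_pM => //; first exact: ltW.
  by rewrite mulr_ge0 ?exprn_ge0 ?expR_ge0.
rewrite (le_trans (ler_wpM2r (expR_ge0 _) hu))// -mulrA e1 mulr1//.
Qed.

Let nu s : probability (measurableTypeR R) R := normal_prob 0 s.

Lemma Lall_normal s : 0 < s -> Lall (nu s) (fun x => x).
Proof.
move=> s0; split => // k.
exact: le_lt_trans (normal_even_moment_le k s0) (ltry _).
Qed.

(* Convexity replaces integration by parts: the density of another normal law
   with respect to [normal_prob 0 s] dominates its first-order expansion in the
   perturbed parameter, and both sides have known mass. *)
Lemma normal_mean_tangent s m : 0 < s ->
  m / s ^+ 2 * Ex (nu s) (fun x => x) <= m ^+ 2 / (s ^+ 2 *+ 2).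
Proof.
move=> s0; have hx := Lall_normal s0.
pose rho x := expR (m / s ^+ 2 * x - m ^+ 2 / (s ^+ 2 *+ 2)).
have mrho : measurable_fun setT rho.
  apply: measurableT_comp => //; apply: measurable_funB => //.
have irho : (\int[nu s]_x (rho x)%:E = 1)%E.
  rewrite ge0_integral_normal_prob//; last 2 first.
  - exact/measurable_EFinP.
  - by move=> x; rewrite lee_fin expR_ge0.
  rewrite -[RHS](@integral_normal_pdf R m s); apply: eq_integral => x _.
  rewrite -EFinM !normal_pdfE ?gt_eqF// /normal_fun /rho mulrCA -expRD.
  by congr (_ * expR _)%:E; field; rewrite gt_eqF.
have h1 : Lall (nu s) (fun x => m / s ^+ 2 * x).
  exact: LallZ.
have h2 := LallD h1 (Lall_cst (nu s) (1 - m ^+ 2 / (s ^+ 2 *+ 2))).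
have : ((Ex (nu s) (fun x => m / s ^+ 2 * x + (1 - m ^+ 2 / (s ^+ 2 *+ 2))))%:E <= 1%:E)%E.
  rewrite -Ex_EFin// -irho; apply: le_integral => //.
  - exact: Lall_integrable h2.
  - apply/integrableP; split; first exact/measurable_EFinP.
    rewrite (_ : (\int[nu s]_x _ = 1)%E) ?ltry// -irho.
    by apply: eq_integral => x _; rewrite gee0_abs// lee_fin expR_ge0.
  - move=> x _; rewrite lee_fin /rho.
    apply: le_trans (expR_ge1Dx _); rewrite le_eqVlt; apply/orP; left; apply/eqP; ring.
rewrite lee_fin ExD//; last exact: Lall_cst.
rewrite Ex_cst ExZ//; lra.
Qed.

(** The tangent inequality holds for every shift m and reads 2 m e <= m^2, with e the mean; the
    choice m = e forces e = 0. *)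
Lemma normal_mean s : 0 < s -> Ex (nu s) (fun x => x) = 0.
Proof.
move=> s0; have s20 : 0 < s ^+ 2 by rewrite exprn_gt0.
set e := Ex _ _.
have h m : 2 * m * e <= m ^+ 2.
  have := @normal_mean_tangent s m s0; rewrite -/e.
  rewrite -[_ *+ 2]mulr_natr => /(ler_wpM2r (ltW (mulr_gt0 s20 (ltr0n _ 2)))).
  rewrite divfK ?mulf_neq0 ?gt_eqF//.
  suff -> : m / s ^+ 2 * e * (s ^+ 2 * 2) = 2 * m * e by [].
  by field; rewrite gt_eqF.
have := h e; have := sqr_ge0 e; rewrite expr2 => e0 e1.
have /eqP : e * e = 0 by lra.
by rewrite mulf_eq0 orbb => /eqP.
Qed.

(** Here the perturbed parameter is the scale: exp(-a x^2) times the density of deviation s is v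
    times the density of deviation s v, and exp(y) >= 1 + y is integrated. *)
Lemma normal_variance_tangent s v : 0 < s -> 0 < v ->
  1 - (1 / v ^+ 2 - 1) / (s ^+ 2 *+ 2) * Ex (nu s) (fun x => x ^+ 2) <= v.
Proof.
move=> s0 v0; have hx := Lall_normal s0.
set a := (1 / v ^+ 2 - 1) / (s ^+ 2 *+ 2).
pose rho x := expR (- a * x ^+ 2).
have mrho : measurable_fun setT rho.
  apply: measurableT_comp => //; apply: measurable_funM => //.
have irho : (\int[nu s]_x (rho x)%:E = v%:E)%E.
  rewrite ge0_integral_normal_prob//; last 2 first.
  - exact/measurable_EFinP.
  - by move=> x; rewrite lee_fin expR_ge0.
  rewrite -[RHS](integral_normal_pdfZ 0 (s * v) (ltW v0)).
  apply: eq_integral => x _.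
  rewrite -!EFinM !normal_pdfE ?mulf_neq0 ?gt_eqF// /normal_fun /rho.
  rewrite (@normal_peak_scale s v)// mulrCA -expRD -!mulrA.
  by congr (_ * (_ * expR _))%:E; rewrite /a; field; rewrite ?gt_eqF.
have h1 : Lall (nu s) (fun x => - a * x ^+ 2) by exact/LallZ/LallX.
have h2 := LallD h1 (Lall_cst (nu s) 1).
have : ((Ex (nu s) (fun x => - a * x ^+ 2 + 1))%:E <= v%:E)%E.
  rewrite -Ex_EFin// -irho; apply: le_integral => //.
  - exact: Lall_integrable h2.
  - apply/integrableP; split; first exact/measurable_EFinP.
    rewrite (_ : (\int[nu s]_x _ = v%:E)%E) ?ltry// -irho.
    by apply: eq_integral => x _; rewrite gee0_abs// lee_fin expR_ge0.
  - by move=> x _; rewrite lee_fin /rho addrC; exact: expR_ge1Dx.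
rewrite lee_fin ExD//; last exact: Lall_cst.
rewrite Ex_cst ExZ//; last exact: LallX.
by rewrite mulNr addrC.
Qed.

(** Multiplied by 2 v^2, the tangent inequality becomes (v - 1) (2 v^2 - c (1 + v)) >= 0, where c is
    the variance divided by s^2. Letting v tend to 1 from above gives c <= 1, and from below c >=
    1. *)
Lemma normal_variance s : 0 < s -> Ex (nu s) (fun x => x ^+ 2) = s ^+ 2.
Proof.
move=> s0; have s20 : 0 < s ^+ 2 by rewrite exprn_gt0.
set e := Ex _ _; pose c := e / s ^+ 2.
suff : c = 1 by move=> /divr1_eq.
have h v : 0 < v -> 0 <= (v - 1) * (2 * v ^+ 2 - c * (1 + v)).
  move=> v0; have := @normal_variance_tangent s v s0 v0; rewrite -/e.
  have v20 : 0 < v ^+ 2 by rewrite exprn_gt0.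
  rewrite -subr_ge0 => /(mulr_ge0 (ltW (mulr_gt0 v20 (ltr0n R 2)))).
  congr (_ <= _); rewrite /c; field; rewrite ?gt_eqF//.
apply/eqP; rewrite eq_le; apply/andP; split; apply/ler_addgt0Pr => e' e'0.
- have := h (1 + e' / 2) ltac:(lra).
  rewrite addrAC subrr add0r pmulr_rge0 ?divr_gt0// => h1.
  rewrite leNgt; apply/negP => h2.
  have : 0 < (c - (1 + e')) * (2 + e' / 2) by rewrite mulr_gt0; lra.
  nra.
- have [e1|e1] := leP e' 1; last by have := h (1/2) ltac:(lra); nra.
  have := h (1 - e' / 2) ltac:(lra).
  rewrite addrAC subrr add0r mulNr oppr_ge0 pmulr_rle0 ?divr_gt0// => h1.
  rewrite leNgt; apply/negP => h2.
  have : 0 < (1 - e' - c) * (2 - e' / 2) by rewrite mulr_gt0; lra.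
  nra.
Qed.

End normal_moments.

(** * Moments of Brownian increments *)

Section increment_moments.
Context {d : measure_display} {T : measurableType d} {R : realType}.
Variables (P : probability T R) (n : nat) (W : R -> T -> 'cV[R]_n).
Hypothesis hW : standard_brownian_motion P W.

(** Brownian motion prescribes the law of an increment on events; integrals are moved to the normal
    law by a change of variables. The case s = t, where the increment is 0, is treated apart
    below. *)
Lemma integral_increment i (s t : R) (g : R -> \bar R) : 0 <= s -> s < t ->
  measurable_fun setT g -> (forall x, 0 <= g x)%E ->
  (\int[P]_w g (increment W s t i w) = \int[normal_prob 0 (Num.sqrt (t - s))]_x g x)%E.
Proof.
move=> s0 st mg g0; have t0 : 0 <= t by rewrite (le_trans s0) ?ltW.
have mi : @measurable_fun _ _ T (measurableTypeR R) setT (increment W s t i).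
  by have := increment_measurable hW i s0 t0; apply.
pose F : {RV P >-> measurableTypeR R} :=
  @mfun_Sub _ _ T (measurableTypeR R) (increment W s t i) (mem_set mi).
rewrite -[LHS]/(\int[P]_w (g \o F) w)%E -ge0_integral_distribution//.
apply: eq_measure_integral => A mA _.
by have [hB _] := hW; have [_ _ _ h _] := hB i; exact: h.
Qed.

Lemma Lall_increment i (s t : R) : 0 <= s -> s <= t -> Lall P (increment W s t i).
Proof.
move=> s0; rewrite le_eqVlt => /predU1P[<-|st].
  rewrite (_ : increment W s s i = fun=> 0); first exact: Lall_cst.
  by apply/funext => w; rewrite /increment subrr.
have t0 : 0 <= t by rewrite (le_trans s0) ?ltW.
split=> [|m]; first exact: (increment_measurable hW).
have sq0 : 0 < Num.sqrt (t - s) by rewrite sqrtr_gt0 subr_gt0.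
rewrite (integral_increment i (g := fun x => (x ^+ m.*2)%:E) s0 st).
2: by apply/measurable_EFinP; exact: measurable_funX.
2: by move=> x; rewrite lee_fin even_pow_ge0.
by have [_] := Lall_normal sq0; apply.
Qed.

Lemma increment_even_moment i (s t : R) k : 0 <= s -> s <= t ->
  Ex P (fun w => increment W s t i w ^+ k.*2) <= normal_moment_cst k * (t - s) ^+ k.
Proof.
move=> s0 st; have hL := Lall_increment i s0 st.
move: st; rewrite le_eqVlt => /predU1P[E|st].
  rewrite -E (_ : (fun w => _) = fun=> 0 ^+ k.*2); last first.
    by apply/funext => w; rewrite /increment subrr.
  rewrite Ex_cst subrr -muln2 exprM; case: k => [|k]; last first.
    by rewrite !expr0n/= mulr0.
  by rewrite !expr0 mulr1 /normal_moment_cst expr0 fact0 !mulr1; lra.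
have sq0 : 0 < Num.sqrt (t - s) by rewrite sqrtr_gt0 subr_gt0.
rewrite -lee_fin -Ex_EFin; last exact: LallX.
rewrite (integral_increment i (g := fun x => (x ^+ k.*2)%:E) s0 st).
2: by apply/measurable_EFinP; exact: measurable_funX.
2: by move=> x; rewrite lee_fin even_pow_ge0.
apply: le_trans (normal_even_moment_le k sq0) _.
by rewrite lee_fin -muln2 mulnC exprM sqr_sqrtr// subr_ge0 ltW.
Qed.

Lemma Ex_increment_law i (s t : R) (g : R -> R) : 0 <= s -> s < t ->
  measurable_fun setT g -> Lall P (fun w => g (increment W s t i w)) ->
  Ex P (fun w => g (increment W s t i w)) =
  Ex (normal_prob 0 (Num.sqrt (t - s)) : probability (measurableTypeR R) R) g.
Proof.
move=> s0 st mg hg; have t0 : 0 <= t by rewrite (le_trans s0) ?ltW.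
have mi : @measurable_fun _ _ T (measurableTypeR R) setT (increment W s t i).
  by have := increment_measurable hW i s0 t0; apply.
pose F : {RV P >-> measurableTypeR R} :=
  @mfun_Sub _ _ T (measurableTypeR R) (increment W s t i) (mem_set mi).
have mEg : @measurable_fun _ _ (measurableTypeR R) _ setT (EFin \o g).
  by have /measurable_EFinP := mg; apply.
congr fine; have hd := integral_distribution (P := P) (X := F) mEg (Lall_integrable hg).
transitivity (\int[distribution P F]_y (EFin \o g) y)%E; first exact: esym hd.
apply: eq_measure_integral => A mA _.
by have [hB _] := hW; have [_ _ _ h _] := hB i; exact: h.
Qed.

Lemma Ex_increment i (s t : R) : 0 <= s -> s <= t -> Ex P (increment W s t i) = 0.
Proof.
move=> s0 st; have hL := Lall_increment i s0 st.
move: st; rewrite le_eqVlt => /predU1P[E|st].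
  rewrite -E (_ : increment W s s i = fun=> 0) ?Ex_cst//.
  by apply/funext => w; rewrite /increment subrr.
rewrite (@Ex_increment_law i s t id)//.
by rewrite normal_mean// sqrtr_gt0 subr_gt0.
Qed.

Lemma Ex_increment_sq i (s t : R) : 0 <= s -> s <= t ->
  Ex P (fun w => increment W s t i w ^+ 2) = t - s.
Proof.
move=> s0 st; have hL := LallX 2 (Lall_increment i s0 st).
move: st; rewrite le_eqVlt => /predU1P[E|st].
  rewrite -E (_ : (fun w => _) = fun=> 0) ?Ex_cst ?subrr//.
  by apply/funext => w; rewrite /increment subrr expr0n.
rewrite (@Ex_increment_law i s t (fun x => x ^+ 2))//.
by rewrite normal_variance ?sqr_sqrtr ?sqrtr_gt0 ?subr_gt0// subr_ge0 ltW.
Qed.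

Lemma Ex_increment_prod i j (s t : R) : i != j -> 0 <= s -> s <= t ->
  Ex P (fun w => increment W s t i w * increment W s t j w) = 0.
Proof.
move=> ij s0 st; have t0 : 0 <= t := le_trans s0 st.
have Li k := Lall_increment k s0 st.
have wi k : measurable_wrt (sigma_process (fun _ : R => increment W s t k) setT)
    (increment W s t k).
  by move=> V mV; apply: sub_sigma_algebra; exists 0 => //; exists V.
rewrite (Ex_indep (increments_indep hW ij s0 t0) (wi i) (wi j) (Li i) (Li j)).
by rewrite Ex_increment// mul0r.
Qed.

Lemma Ex_filtration_indep (xi eta : T -> R) (s t : R) : 0 <= s -> s < t ->
  measurable_wrt (brownian_filtration P W s) xi ->
  measurable_wrt (sigma_increments W s t) eta ->
  Lall P xi -> Lall P eta -> Ex P (fun w => xi w * eta w) = Ex P xi * Ex P eta.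
Proof. by move=> s0 st; exact: Ex_indep (brownian_indep hW s0 st). Qed.

End increment_moments.

(** The length of the intersection of []a, b]] and []a', b']]. *)
Definition overlap {R : realType} (a b a' b' : R) : R :=
  Num.max 0 (Num.min b b' - Num.max a a').

(** * The integral of the square of a step function of time *)

Section step_functions.
Context {R : realType}.
Local Notation mu := (@lebesgue_measure R).

Lemma integral_indic_overlap (a b a' b' t : R) : 0 <= a -> b <= t ->
  (\int[mu]_(r in `[0%R, t]) (\1_(`]a, b]) r * \1_(`]a', b']) r)%:E)%E =
  (overlap a b a' b')%:E.
Proof.
move=> a0 bt.
have E : `]a, b]%classic `&` `]a', b'] = `]Num.max a a', Num.min b b']%classic.
  apply/seteqP; split => [r /=|r /=]; rewrite !in_itv/= gt_max le_min.
    by move=> [/andP[-> ->] /andP[-> ->]].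
  by move=> /andP[/andP[-> ->] /andP[-> ->]].
under eq_integral => r _.
  rewrite (_ : \1_(`]a, b]) r * \1_(`]a', b']) r = \1_(`]Num.max a a', Num.min b b']) r); last first.
    by rewrite -E indicI.
  over.
rewrite integral_indic//= setIidl; last first.
  move=> r /=; rewrite !in_itv/= gt_max le_min => /andP[/andP[h1 h2] /andP[h3 h4]].
  by rewrite (le_trans a0 (ltW h1)) (le_trans h3 bt).
rewrite lebesgue_measure_itv/= lte_fin /overlap.
move: (Num.max a a') (Num.min b b') => u v.
case: ifPn => [h|]; first by rewrite -EFinD max_r// subr_ge0 ltW.
by rewrite -leNgt => h; rewrite max_l// subr_le0.
Qed.

Lemma integral_step_sqr (I : finType) (a b c : I -> R) (t : R) :
  (forall k, 0 <= a k) -> (forall k, b k <= t) ->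
  (\int[mu]_(r in `[0%R, t]) ((\sum_k c k * \1_(`]a k, b k]) r) ^+ 2)%:E)%E =
  (\sum_k \sum_l c k * c l * overlap (a k) (b k) (a l) (b l))%:E.
Proof.
move=> a0 bt.
pose f k l (r : R) : R := c k * c l * (\1_(`]a k, b k]) r * \1_(`]a l, b l]) r).
have sqE r : (\sum_k c k * \1_(`]a k, b k]) r) ^+ 2 = \sum_(p : I * I) f p.1 p.2 r.
  rewrite expr2 big_distrl/= -(pair_bigA _ (fun k l => f k l r))/=.
  apply: eq_bigr => k _; rewrite big_distrr/=; apply: eq_bigr => l _.
  by rewrite /f mulrACA.
under eq_integral do rewrite sqE -sumEFin.
have if_ k l : mu.-integrable `[0, t] (fun r => (\1_(`]a k, b k]) r * \1_(`]a l, b l]) r)%:E).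
  apply: measurable_bounded_integrable => //.
  - by rewrite /= lebesgue_measure_itv/=; case: ifP => _; rewrite ?ltry// -EFinB ltry.
  - by apply: measurable_funM; apply: measurable_indic.
  - exists 1; split => // M M1 r _ /=.
    rewrite (le_trans _ (ltW M1))// !indicE -natrM normr_nat.
    by case: (_ \in _); case: (_ \in _).
rewrite integral_sum//=; last first.
  move=> [k l]; apply: eq_integrable (integrableZl _ (c k * c l) (if_ k l)) => //.
rewrite pair_bigA/= -sumEFin; apply: eq_bigr => -[k l] _ /=.
rewrite /f; under eq_integral do rewrite EFinM.
by rewrite integralZl//; rewrite integral_indic_overlap// EFinM.
Qed.

End step_functions.

(** * The Ito isometry for step processes *)

Section isometry.
Context {d : measure_display} {T : measurableType d} {R : realType}.
Variables (P : probability T R) (n : nat) (W : R -> T -> 'cV[R]_n).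
Hypothesis hW : standard_brownian_motion P W.
Local Notation F := (brownian_filtration P W).
Local Notation inc := (increment W).
Implicit Types (s t u v a b : R) (xi : T -> R) (i j : 'I_n).

Lemma increment_split i s t u w : inc s u i w = inc s t i w + inc t u i w.
Proof. by rewrite /increment; ring. Qed.

Lemma increment_adapted i s t : 0 <= s -> s <= t -> measurable_wrt (F t) (inc s t i).
Proof.
move=> s0 st; apply: measurable_wrtB; apply: bm_adapted => //.
exact: le_trans st.
Qed.

Lemma Ex_mul_increment i xi s t : 0 <= s -> s <= t ->
  measurable_wrt (F s) xi -> Lall P xi -> Ex P (fun w => xi w * inc s t i w) = 0.
Proof.
move=> s0 st mxi hxi; have hi := Lall_increment hW i s0 st.
move: st; rewrite le_eqVlt => /predU1P[<-|st].
  rewrite (_ : (fun w => _) = fun=> 0) ?Ex_cst//.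
  by apply/funext => w; rewrite /increment subrr mulr0.
rewrite (Ex_filtration_indep hW s0 st mxi (@increment_wrt _ _ _ _ W i s t))//.
by rewrite (Ex_increment hW)// ?mulr0// ltW.
Qed.

Lemma Ex_mul_increment_sqr i xi s t : 0 <= s -> s <= t ->
  measurable_wrt (F s) xi -> Lall P xi ->
  Ex P (fun w => xi w * inc s t i w ^+ 2) = Ex P xi * (t - s).
Proof.
move=> s0 st mxi hxi; have hi := Lall_increment hW i s0 st.
rewrite -(Ex_increment_sq hW i s0 st).
move: st; rewrite le_eqVlt => /predU1P[<-|st].
  have zE : inc s s i = fun=> 0 by apply/funext => w; rewrite /increment subrr.
  rewrite zE expr0n/= Ex_cst mulr0 (_ : (fun w => _) = fun=> 0) ?Ex_cst//.
  by apply/funext => w; rewrite mulr0.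
rewrite (Ex_filtration_indep hW s0 st mxi)//; last exact: LallX.
apply: (measurable_wrt_comp (phi := fun x => x ^+ 2)) => //.
exact: increment_wrt.
Qed.

(** For u <= v the longer increment is the shorter one plus an increment over [u, v], which is
    centred given the past of u; only the square of the common part survives. *)
Lemma Ex_mul_increment2 i xi s u v : 0 <= s -> s <= u -> s <= v ->
  measurable_wrt (F s) xi -> Lall P xi ->
  Ex P (fun w => xi w * (inc s u i w * inc s v i w)) = Ex P xi * (Num.min u v - s).
Proof.
move=> s0; wlog uv : u v / u <= v.
  move=> h su sv mxi hxi; have [uv|/ltW vu] := leP u v; first by rewrite h// min_l.
  rewrite (eq_Ex P (g := fun w => xi w * (inc s v i w * inc s u i w))).
    by rewrite h// min_l.
  by move=> w; rewrite [inc s u i w * _]mulrC.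
move=> su sv mxi hxi; rewrite min_l//.
have u0 : 0 <= u := le_trans s0 su.
have h1 := Lall_increment hW i s0 su; have h2 := Lall_increment hW i u0 uv.
rewrite (eq_Ex P (g := fun w => xi w * inc s u i w ^+ 2 + (xi w * inc s u i w) * inc u v i w)); last first.
  by move=> w; rewrite (increment_split i s u v); ring.
rewrite ExD ?Ex_mul_increment_sqr ?Ex_mul_increment ?addr0//.
- apply: measurable_wrtM; last exact: increment_adapted.
  exact: measurable_wrt_sub (filtration_sub su) mxi.
- exact: LallM.
- by apply: LallM => //; exact: LallX.
- by apply: LallM => //; exact: LallM.
Qed.

(** Take a <= a'. If b <= a', the second increment is centred given all the rest. Otherwise the
    first is cut at a': the part before a' belongs to the past of the second increment, and the part
    after it starts at the same time as the second. *)
Lemma Ex_increment_overlap i (c c' : T -> R) a b a' b' :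
  0 <= a -> a <= b -> 0 <= a' -> a' <= b' ->
  measurable_wrt (F a) c -> Lall P c -> measurable_wrt (F a') c' -> Lall P c' ->
  Ex P (fun w => (c w * inc a b i w) * (c' w * inc a' b' i w)) =
  Ex P (fun w => c w * c' w) * overlap a b a' b'.
Proof.
wlog aa' : a b a' b' c c' / a <= a'.
  move=> h a0 ab a'0 a'b' mc hc mc' hc'; have [aa|/ltW aa] := leP a a'; first exact: h.
  rewrite (eq_Ex P (g := fun w => (c' w * inc a' b' i w) * (c w * inc a b i w))); last first.
    by move=> w; rewrite mulrC.
  rewrite h// /overlap [Num.min b' b]minC [Num.max a' a]maxC; congr (_ * _).
  by apply: eq_Ex => w; rewrite mulrC.
move=> a0 ab a'0 a'b' mc hc mc' hc'.
have mc1 : measurable_wrt (F a') c by exact: measurable_wrt_sub (filtration_sub aa') mc.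
have i1 := Lall_increment hW i a0 ab; have i2 := Lall_increment hW i a'0 a'b'.
rewrite /overlap [Num.max a a']max_r//.
have [ba|ab'] := leP b a'.
  rewrite max_l ?mulr0; last by rewrite subr_le0 ge_min ba.
  rewrite (eq_Ex P (g := fun w => (c w * inc a b i w * c' w) * inc a' b' i w)); last first.
    by move=> w; rewrite mulrA.
  rewrite Ex_mul_increment//; last by apply: LallM => //; exact: LallM.
  apply: measurable_wrtM => //; apply: measurable_wrtM => //.
  exact: measurable_wrt_sub (filtration_sub ba) (increment_adapted i a0 ab).
have i3 := Lall_increment hW i a0 aa'; have i4 := Lall_increment hW i a'0 (ltW ab').
have hcc := LallM hc hc'.
rewrite max_r; last by rewrite subr_ge0 le_min (ltW ab').
rewrite (eq_Ex P (g := fun w => (c w * inc a a' i w * c' w) * inc a' b' i w +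
   (c w * c' w) * (inc a' b i w * inc a' b' i w))); last first.
  by move=> w; rewrite (increment_split i a a' b); ring.
have mcc : measurable_wrt (F a') (fun w => c w * c' w) by exact: measurable_wrtM.
have i5 : Lall P (fun w => c w * inc a a' i w * c' w) by apply: LallM => //; exact: LallM.
rewrite ExD ?Ex_mul_increment2 ?Ex_mul_increment ?add0r//.
- apply: measurable_wrtM => //; apply: measurable_wrtM => //; exact: increment_adapted.
- exact: ltW.
- exact: LallM.
- by apply: LallM => //; exact: LallM.
Qed.

(** The intervals may overlap, so that the isometry applies to the difference of step processes on
    two unrelated partitions. *)
Lemma ito_isometry_step (I : finType) (j : 'I_n) (a b : I -> R) (c : I -> T -> R) t :
  (forall k, 0 <= a k) -> (forall k, a k <= b k) -> (forall k, b k <= t) ->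
  (forall k, measurable_wrt (F (a k)) (c k)) -> (forall k, Lall P (c k)) ->
  (\int[P]_w ((\sum_k c k w * inc (a k) (b k) j w) ^+ 2)%:E =
   \int[P]_w \int[lebesgue_measure]_(r in `[0%R, t])
     ((\sum_k c k w * \1_(`]a k, b k]) r) ^+ 2)%:E)%E.
Proof.
move=> a0 ab bt mc hc.
under [RHS]eq_integral do rewrite integral_step_sqr//.
have hi k : Lall P (fun w => c k w * inc (a k) (b k) j w).
  by apply: LallM => //; exact: Lall_increment.
rewrite Ex_EFin; last by apply: LallX; exact: Lall_sum.
rewrite Ex_EFin; last first.
  apply: Lall_sum => k; apply: Lall_sum => l; apply: LallM; last exact: Lall_cst.
  exact: LallM.
congr (_%:E).
rewrite (eq_Ex P (g := fun w => \sum_k \sum_l (c k w * inc (a k) (b k) j w) * (c l w * inc (a l) (b l) j w))); last first.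
  move=> w; rewrite expr2 big_distrl/=; apply: eq_bigr => k _.
  by rewrite big_distrr.
rewrite Ex_sum; last by move=> k; apply: Lall_sum => l; exact: LallM.
rewrite Ex_sum; last first.
  by move=> k; apply: Lall_sum => l; apply: LallM; [exact: LallM|exact: Lall_cst].
apply: eq_bigr => k _; rewrite Ex_sum; last by move=> l; exact: LallM.
rewrite Ex_sum; last by move=> l; apply: LallM; [exact: LallM|exact: Lall_cst].
apply: eq_bigr => l _; rewrite Ex_increment_overlap//.
rewrite mulrC -ExZ; last exact: LallM.
by apply: eq_Ex => w; rewrite mulrC.
Qed.

End isometry.

(** * Mean square distance of processes on a time interval *)

Section ito_approximation.
Context {d : measure_display} {T : measurableType d} {R : realType}.
Variables (P : probability T R) (n : nat) (W : R -> T -> 'cV[R]_n).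
Hypothesis hW : standard_brownian_motion P W.
Local Notation F := (brownian_filtration P W).
Local Notation inc := (increment W).
Local Notation mu := (@lebesgue_measure R).
Local Notation nonneg_times := [set p : R * T | 0 <= p.1].

Lemma measurable_nonneg_times : measurable nonneg_times.
Proof.
rewrite (_ : nonneg_times = setT `&` fst @^-1` `[0, +oo[); last first.
  by apply/seteqP; split => [p /=|p /= []]; rewrite in_itv/= andbT.
have m1 := @measurable_fst _ _ (measurableTypeR R) T.
by have := m1 measurableT `[0, +oo[%classic (measurable_itv _); apply.
Qed.

(** The integrand is known to be measurable at nonnegative times only; multiplied by the indicator
    of [[0, t]] it is measurable on the whole product, where Tonelli applies. *)
Lemma measurable_time_integral (G : R -> T -> R) (t : R) :
  measurable_fun nonneg_times (fun p => G p.1 p.2) ->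
  (forall r w, 0 <= G r w) ->
  measurable_fun setT (fun w => \int[mu]_(r in `[0%R, t]) (G r w)%:E)%E.
Proof.
move=> mG G0.
have mD := measurable_nonneg_times.
have mG' : measurable_fun setT (fun p : R * T => (G p.1 p.2)%:E * (\1_(`[0%R, t]) p.1)%:E)%E.
  rewrite (_ : (fun p => _) = (fun p => ((fun p => (G p.1 p.2)%:E) \_ nonneg_times) p * (\1_(`[0%R, t]) p.1)%:E)%E); last first.
    apply/funext => p; rewrite patchE; case: ifPn => // /negP h.
    rewrite indicE memNset ?mule0// => /=; rewrite in_itv/= => /andP[h0 _].
    by apply: h; rewrite inE.
  apply: emeasurable_funM.
    by have := (measurable_restrictT _ mD).1 ((measurable_EFinP _ _).2 mG); apply.
  apply/measurable_EFinP.
  have mi : measurable_fun setT (\1_(`[0, t]%classic) : R -> R) by exact: measurable_indic.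
  by have := measurableT_comp mi (@measurable_fst _ _ R T); apply.
have h := @measurable_fun_fubini_tonelli_G _ _ (measurableTypeR R) T R mu
  (fun p : R * T => (G p.1 p.2)%:E * (\1_(`[0%R, t]) p.1)%:E)%E.
rewrite (_ : (fun w => _) = fubini_G mu (fun p : R * T => (G p.1 p.2)%:E * (\1_(`[0%R, t]) p.1)%:E)%E).
  apply: h; last by move=> x; rewrite mule_ge0// lee_fin.
  by have := mG'; apply.
apply/funext => w; rewrite /fubini_G/= integral_mkcond/=.
apply: eq_integral => r _; rewrite patchE indicE.
by case: ifPn => _ /=; rewrite ?mule1 ?mule0.
Qed.

Lemma measurable_step (J : finType) (a b : J -> R) (c : J -> T -> R) :
  (forall k, measurable_fun setT (c k)) ->
  measurable_fun setT (fun p : R * T => \sum_k c k p.2 * \1_(`]a k, b k]) p.1).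
Proof.
move=> mc; apply: measurable_sum => k; apply: measurable_funM.
  by have := measurableT_comp (mc k) (@measurable_snd _ _ R T); apply.
have mi : measurable_fun setT (\1_(`]a k, b k]%classic) : R -> R) by exact: measurable_indic.
by have := measurableT_comp mi (@measurable_fst _ _ R T); apply.
Qed.

Lemma sqr_add_le (x y : R) : (x + y) ^+ 2 <= 2 * x ^+ 2 + 2 * y ^+ 2.
Proof. by have := sqr_ge0 (x - y); rewrite !expr2; lra. Qed.

(** The pointwise bound (x + y)^2 <= 2 x^2 + 2 y^2 plays the part of Minkowski's inequality and
    avoids square roots of extended reals. *)
Lemma integral_sqr_triangle d' (T' : measurableType d') (m : {measure set T' -> \bar R})
    (D : set T') (f g h : T' -> R) : measurable D ->
  measurable_fun D (fun x => f x - g x) -> measurable_fun D (fun x => g x - h x) ->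
  (\int[m]_(x in D) ((f x - h x) ^+ 2)%:E <=
   2%:E * \int[m]_(x in D) ((f x - g x) ^+ 2)%:E +
   2%:E * \int[m]_(x in D) ((g x - h x) ^+ 2)%:E)%E.
Proof.
move=> mD m1 m2.
have mm1 : measurable_fun D (fun x => ((f x - g x) ^+ 2)%:E).
  by apply/measurable_EFinP; exact: measurable_funX.
have mm2 : measurable_fun D (fun x => ((g x - h x) ^+ 2)%:E).
  by apply/measurable_EFinP; exact: measurable_funX.
have s0 (x : R) : (0 <= (x ^+ 2)%:E)%E by rewrite lee_fin sqr_ge0.
rewrite -!ge0_integralZl// -ge0_integralD//; last 4 first.
- by move=> x _; rewrite mule_ge0.
- exact: measurable_funeM.
- by move=> x _; rewrite mule_ge0.
- exact: measurable_funeM.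
apply: ge0_le_integral => //.
- apply/measurable_EFinP; apply: measurable_funX.
  rewrite (_ : (fun x => _) = (fun x => (f x - g x) + (g x - h x))); first exact: measurable_funD.
  by apply/funext => x; ring.
- by apply: emeasurable_funD; exact: measurable_funeM.
move=> x _; rewrite -!EFinM -EFinD lee_fin.
apply: le_trans (sqr_add_le _ _); rewrite le_eqVlt; apply/orP; left; apply/eqP.
by congr (_ ^+ 2); ring.
Qed.

Definition sqdist2 (t : R) (f g : R -> T -> R) : \bar R :=
  (\int[P]_w \int[mu]_(r in `[0%R, t]) ((f r w - g r w) ^+ 2)%:E)%E.

Definition jointly_measurable (f : R -> T -> R) :=
  measurable_fun nonneg_times (fun p => f p.1 p.2).

Lemma jointly_measurable_section (f : R -> T -> R) w (t : R) :
  jointly_measurable f -> measurable_fun (`[0, t]%classic : set R) (f^~ w).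
Proof.
move=> mf; have mp : measurable_fun (`[0, t]%classic : set R) (fun r => (r, w) : R * T).
  by apply: measurable_funTS; apply: measurable_fun_pair.
have mD := measurable_nonneg_times.
have := @measurable_comp _ _ _ R (R * T)%type R nonneg_times (fun p => f p.1 p.2)
  `[0, t]%classic (fun r => (r, w)) mD _ mf mp; apply.
by move=> _ [r /= + <-]; rewrite in_itv/= => /andP[].
Qed.

Lemma jointly_measurableB (f g : R -> T -> R) : jointly_measurable f -> jointly_measurable g ->
  jointly_measurable (fun r w => f r w - g r w).
Proof. by move=> mf mg; exact: measurable_funB. Qed.

Lemma measurable_sqdist (f g : R -> T -> R) (t : R) : jointly_measurable f -> jointly_measurable g ->
  measurable_fun setT (fun w =>
    \int[mu]_(r in `[0%R, t]) ((f r w - g r w) ^+ 2)%:E)%E.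
Proof.
move=> mf mg; apply: (measurable_time_integral (G := fun r w => (f r w - g r w) ^+ 2)).
  by apply: measurable_funX; exact: jointly_measurableB.
by move=> r w; exact: sqr_ge0.
Qed.

Lemma sqdist2_triangle (t : R) (f g h : R -> T -> R) : jointly_measurable f -> jointly_measurable g ->
  jointly_measurable h ->
  (sqdist2 t f h <= 2%:E * sqdist2 t f g + 2%:E * sqdist2 t g h)%E.
Proof.
move=> mf mg mh; rewrite /sqdist2.
have s0 (f1 g1 : R -> T -> R) w : (0 <= \int[mu]_(r in `[0%R, t]) ((f1 r w - g1 r w) ^+ 2)%:E)%E.
  by apply: integral_ge0 => r _; rewrite lee_fin sqr_ge0.
have m1 := measurable_sqdist t mf mg; have m2 := measurable_sqdist t mg mh.
rewrite -!ge0_integralZl// -ge0_integralD//; last 4 first.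
- by move=> x _; rewrite mule_ge0.
- exact: measurable_funeM.
- by move=> x _; rewrite mule_ge0.
- exact: measurable_funeM.
apply: ge0_le_integral => //.
- exact: measurable_sqdist.
- by apply: emeasurable_funD; exact: measurable_funeM.
move=> w _; apply: integral_sqr_triangle => //.
  by have := measurable_funB (jointly_measurable_section w mf) (jointly_measurable_section w mg); apply.
by have := measurable_funB (jointly_measurable_section w mg) (jointly_measurable_section w mh); apply.
Qed.

Lemma jointly_measurable_step (J : finType) (a b : J -> R) (c : J -> T -> R) :
  (forall k, measurable_fun setT (c k)) ->
  jointly_measurable (fun r w => \sum_k c k w * \1_(`]a k, b k]) r).
Proof. by move=> mc; apply: measurable_funTS; exact: measurable_step. Qed.

End ito_approximation.

(** * Comparison of an Ito integral with a finite Ito sum *)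

Section ito_integral_dist.
Context {d : measure_display} {T : measurableType d} {R : realType}.
Variables (P : probability T R) (n : nat) (W : R -> T -> 'cV[R]_n).
Hypothesis hW : standard_brownian_motion P W.
Local Notation F := (brownian_filtration P W).
Local Notation inc := (increment W).

Section stopped.
Variables (S : simple_process T R) (j : 'I_n) (t : R).
Hypotheses (hS : simple_predictable F S) (t0 : 0 <= t).

Definition stopped_left (k : 'I_(sp_size S)) : R := Num.min (sp_time S k) t.
Definition stopped_right (k : 'I_(sp_size S)) : R := Num.min (sp_time S k.+1) t.
(** An interval that starts at or after [t] is cut to the point [t]. Its coefficient need not be
    measurable at time [t] and is replaced by 0. *)
Definition stopped_coef (k : 'I_(sp_size S)) : T -> R :=
  if sp_time S k < t then sp_coef S k else fun=> 0.

Lemma sp_time_ge0 k : 0 <= sp_time S k.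
Proof. by have [h0 h _] := hS; apply: le_trans h0 (h _ _ _). Qed.

Lemma stopped_left_ge0 k : 0 <= stopped_left k.
Proof. by rewrite le_min t0 sp_time_ge0. Qed.

Lemma stopped_left_right k : stopped_left k <= stopped_right k.
Proof.
have [_ h _] := hS; rewrite /stopped_left /stopped_right le_min !ge_min lexx.
by rewrite orbT h.
Qed.

Lemma stopped_right_le k : stopped_right k <= t.
Proof. by rewrite ge_min lexx orbT. Qed.

Lemma stopped_coef_wrt k : measurable_wrt (F (stopped_left k)) (stopped_coef k).
Proof.
rewrite /stopped_coef /stopped_left; case: ifPn => [kt|_].
  by rewrite min_l ?ltW//; have [_ _ /(_ k (ltn_ord k)) []] := hS.
exact: measurable_wrt_cst.
Qed.

Lemma Lall_stopped_coef k : Lall P (stopped_coef k).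
Proof.
rewrite /stopped_coef; case: ifPn => _; last exact: Lall_cst.
have [_ _ /(_ k (ltn_ord k)) [mc [M hM]]] := hS.
have mc' := measurable_wrt_fun (filtration_measurable hW (t := sp_time S k)) mc.
exact: Lall_bounded mc' hM.
Qed.

Lemma stopped_integral w : sp_integral S (fun t w => W t w j 0) t w =
  \sum_k stopped_coef k w * inc (stopped_left k) (stopped_right k) j w.
Proof.
apply: eq_bigr => k _; rewrite /stopped_coef; case: ifPn => //; rewrite -leNgt => tk.
have [_ h _] := hS.
rewrite mul0r !min_r ?subrr ?mulr0//; exact: le_trans tk (h _ _ _).
Qed.

Lemma stopped_val w r : r <= t -> sp_val S r w =
  \sum_k stopped_coef k w * \1_(`]stopped_left k, stopped_right k]) r.
Proof.
move=> rt; apply: eq_bigr => k _; rewrite /stopped_coef /stopped_left /stopped_right.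
case: ifPn => kt; last first.
  rewrite -leNgt in kt.
  rewrite mul0r indicE memNset ?mulr0// => /=; rewrite in_itv/= => /andP[h _].
  by have := lt_le_trans h (le_trans rt kt); rewrite ltxx.
congr (_ * _); rewrite !indicE; congr (_%:R); congr nat_of_bool.
by rewrite (min_l (ltW kt)) !mem_setE/= !in_itv/= le_min rt andbT.
Qed.

End stopped.

Lemma jointly_measurable_sp (S : simple_process T R) :
  simple_predictable F S -> jointly_measurable (fun r w => sp_val S r w).
Proof.
move=> hS; have := @jointly_measurable_step _ T R 'I_(sp_size S)
  (fun k => sp_time S k) (fun k => sp_time S k.+1) (fun k => sp_coef S k); apply.
move=> k; have [_ _ /(_ k (ltn_ord k)) [mc _]] := hS.
exact: measurable_wrt_fun (filtration_measurable hW (t := sp_time S k)) mc.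
Qed.

(** The triangle inequality passes through the simple processes of the definition; the isometry
    turns the distance of the two finite sums into a distance of integrands; a second triangle
    inequality returns to [H], whence 4 = 2 * 2. The terms that depend on the approximating sequence
    tend to 0. *)
Lemma ito_integral_dist (j : 'I_n) (H I : R -> T -> R) (J : finType)
    (a b : J -> R) (c : J -> T -> R) (t : R) : 0 <= t ->
  ito_integral P F (fun t w => W t w j 0) H I ->
  (forall k, 0 <= a k) -> (forall k, a k <= b k) -> (forall k, b k <= t) ->
  (forall k, measurable_wrt (F (a k)) (c k)) -> (forall k, Lall P (c k)) ->
  (\int[P]_w ((I t w - \sum_k c k w * inc (a k) (b k) j w) ^+ 2)%:E <=
   4%:E * sqdist2 P t H (fun r w => \sum_k c k w * \1_(`]a k, b k]) r)%R)%E.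
Proof.
move=> t0 [mH _ _ _ /(_ t t0) [mI [S [hS Sv SI]]]] a0 ab bt mc hc.
have mc' k : measurable_fun setT (c k) by case: (hc k).
set E := fun w => \sum_k c k w * inc (a k) (b k) j w.
set V := fun r w => \sum_k c k w * \1_(`]a k, b k]) r.
have mV : jointly_measurable V by exact: jointly_measurable_step.
have mE : measurable_fun setT E.
  apply: measurable_sum => k; apply: measurable_funM => //.
  by apply: (increment_measurable hW) => //; exact: le_trans (a0 k) (ab k).
pose SE m w := sp_integral (S m) (fun t w => W t w j 0) t w.
have mSE m : measurable_fun setT (SE m).
  rewrite (_ : SE m = fun w => \sum_(k < sp_size (S m)) stopped_coef t k w * inc (stopped_left t k) (stopped_right t k) j w); last first.
    by apply/funext => w; exact: stopped_integral.
  apply: measurable_sum => k; apply: measurable_funM.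
    by case: (Lall_stopped_coef t (hS m) k).
  apply: (increment_measurable hW); first exact: stopped_left_ge0.
  exact: le_trans (stopped_left_ge0 (hS m) t0 k) (stopped_left_right t (hS m) k).
pose Sv_ m : \bar R := sqdist2 P t H (fun r w => sp_val (S m) r w).
pose SI_ m : \bar R := (\int[P]_w ((I t w - SE m w) ^+ 2)%:E)%E.
have iso m : (\int[P]_w ((SE m w - E w) ^+ 2)%:E = sqdist2 P t (fun r w => sp_val (S m) r w) V)%E.
  (* The difference of the two sums is one sum over the disjoint union of the partitions, with
     opposite coefficients on the right. *)
  pose Jm := ('I_(sp_size (S m)) + J)%type.
  pose aa (k : Jm) := match k with inl k => stopped_left t k | inr k => a k end.
  pose bb (k : Jm) := match k with inl k => stopped_right t k | inr k => b k end.
  pose cc (k : Jm) : T -> R := match k with inl k => stopped_coef t k | inr k => fun w => - c k w end.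
  have := @ito_isometry_step _ T R P n W hW Jm j aa bb cc t.
  rewrite /sqdist2 => h.
  transitivity (\int[P]_w ((\sum_k cc k w * inc (aa k) (bb k) j w) ^+ 2)%:E)%E.
    apply: eq_integral => w _; congr ((_ ^+ 2)%:E).
    rewrite big_sumType/= /SE (stopped_integral j t (hS m)); congr (_ + _).
    by rewrite /E -sumrN; apply: eq_bigr => k _; rewrite mulNr.
  rewrite h.
  - apply: eq_integral => w _; apply: eq_integral => r.
    rewrite inE/= in_itv/= => /andP[r0 rt]; congr ((_ ^+ 2)%:E).
    rewrite big_sumType/= (stopped_val (S m) w rt); congr (_ + _).
    by rewrite /V -sumrN; apply: eq_bigr => k _; rewrite mulNr.
  - by move=> [k|k] //=; exact: stopped_left_ge0.
  - by move=> [k|k] //=; exact: stopped_left_right.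
  - by move=> [k|k] //=; exact: stopped_right_le.
  - move=> [k|k] /=; first exact: stopped_coef_wrt.
    have mN : measurable_fun setT (fun x : R => - x) by exact: oppr_measurable.
    by have := measurable_wrt_comp mN (mc k); apply.
  - by move=> [k|k] /=; [exact: Lall_stopped_coef|exact: LallN].
have bound m : (\int[P]_w ((I t w - E w) ^+ 2)%:E <=
    2%:E * SI_ m + 4%:E * Sv_ m + 4%:E * sqdist2 P t H V)%E.
  apply: le_trans (@integral_sqr_triangle R _ T P setT (I t) (SE m) E _ _ _) _ => //.
  - exact: measurable_funB.
  - exact: measurable_funB.
  rewrite iso -addeA leeD2l//.
  have mS := jointly_measurable_sp (hS m).
  have := @sqdist2_triangle _ T R P t (fun r w => sp_val (S m) r w) H V mS mH mV.
  have -> : sqdist2 P t (fun r w => sp_val (S m) r w) H = Sv_ m.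
    rewrite /Sv_ /sqdist2; apply: eq_integral => w _; apply: eq_integral => r _.
    by rewrite -sqrrN opprB.
  have p1 : (0 <= Sv_ m)%E.
    by apply: integral_ge0 => w _; apply: integral_ge0 => r _; rewrite lee_fin sqr_ge0.
  have p2 : (0 <= sqdist2 P t H V)%E.
    by apply: integral_ge0 => w _; apply: integral_ge0 => r _; rewrite lee_fin sqr_ge0.
  move: (Sv_ m) (sqdist2 P t H V) (sqdist2 P t _ V) p1 p2 => u v z p1 p2 h.
  apply: le_trans (lee_wpmul2l _ h) _; first by rewrite lee_fin.
  rewrite ge0_muleDr ?mule_ge0 ?lee_fin//.
  by rewrite !muleA -!EFinM -natrM.
have lim : (fun m => 2%:E * SI_ m + 4%:E * Sv_ m + 4%:E * sqdist2 P t H V)%E @ \oo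
    --> (4%:E * sqdist2 P t H V)%E.
  have c1 : (fun m => 2%:E * SI_ m)%E @ \oo --> 0%E.
    by rewrite -(mule0 2%:E); apply: cvgeZl.
  have c2 : (fun m => 4%:E * Sv_ m)%E @ \oo --> 0%E.
    by rewrite -(mule0 4%:E); apply: cvgeZl.
  rewrite -[X in _ --> X]add0e; apply: cvgeD; last exact: cvg_cst.
    exact: fin_num_adde_defr.
  by rewrite -[X in _ --> X]adde0; apply: cvgeD.
apply: (cvge_to_ge lim); apply: nearW => m; exact: bound.
Qed.

End ito_integral_dist.

(** * Step approximation of a continuous path on a uniform grid *)

Section grid_approximation.
Context {R : realType}.
Local Notation mu := (@lebesgue_measure R).
Implicit Types (t : R) (N k l : nat) (f : R -> R).

Definition mesh t N : R := t / N.+1%:R.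
Definition grid t N k : R := k%:R * mesh t N.
(** Left endpoint values on left-open cells: each coefficient is known when its cell begins, as an
    Ito sum requires. *)
Definition grid_step t N f (r : R) : R :=
  \sum_(l < N.+1) f (grid t N l) * \1_(`]grid t N l, grid t N l.+1]) r.

Lemma mesh_gt0 t N : 0 < t -> 0 < mesh t N.
Proof. by move=> t0; rewrite divr_gt0. Qed.

Lemma grid_ge0 t N k : 0 <= t -> 0 <= grid t N k.
Proof. by move=> t0; rewrite mulr_ge0 ?divr_ge0. Qed.

Lemma gridS t N k : grid t N k.+1 = grid t N k + mesh t N.
Proof. by rewrite /grid -natr1 mulrDl mul1r. Qed.

Lemma grid0 t N : grid t N 0 = 0.
Proof. by rewrite /grid mul0r. Qed.

Lemma grid_last t N : grid t N N.+1 = t.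
Proof. by rewrite /grid /mesh mulrCA divff ?mulr1. Qed.

Lemma grid_mono t N k l : 0 <= t -> (k <= l)%N -> grid t N k <= grid t N l.
Proof. by move=> t0 kl; rewrite ler_wpM2r ?divr_ge0 ?ler_nat. Qed.

Lemma grid_cell t N (r : R) : 0 < t -> 0 < r -> r <= t ->
  exists2 l : 'I_N.+1, grid t N l < r & r <= grid t N l.+1.
Proof.
move=> t0 r0 rt.
have ex : exists k, r <= grid t N k by exists N.+1; rewrite grid_last.
case: (ex_minnP ex) => -[|k] hk kmin.
  by move: hk; rewrite grid0 leNgt r0.
have kN : (k < N.+1)%N by apply: kmin; rewrite grid_last.
exists (Ordinal kN) => //=; rewrite ltNge; apply/negP => h.
by have := kmin _ h; rewrite ltnn.
Qed.

Lemma grid_step_cell t N f (r : R) (l : 'I_N.+1) : 0 < t ->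
  grid t N l < r -> r <= grid t N l.+1 -> grid_step t N f r = f (grid t N l).
Proof.
move=> t0 lr rl; rewrite /grid_step (bigD1 l)//= indicE mem_set ?mulr1/=; last by rewrite in_itv/= lr.
rewrite big1 ?addr0// => k kl; rewrite indicE memNset ?mulr0//= in_itv/=.
move=> /andP[h1 h2]; case: (ltngtP k l) => h.
- by have := lt_le_trans lr (le_trans h2 (grid_mono N (ltW t0) h)); rewrite ltxx.
- by have := le_lt_trans (le_trans rl (grid_mono N (ltW t0) h)) h1; rewrite ltxx.
- by move/eqP: kl; apply; exact: val_inj.
Qed.

Lemma grid_step_bound t N f (M : R) (r : R) : 0 < t -> 0 <= M ->
  (forall s, 0 <= s -> `|f s| <= M) -> r <= t -> `|grid_step t N f r| <= M.
Proof.
move=> t0 M0 fM rt; have [r0|r0] := ltP 0 r.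
  have [l lr rl] := grid_cell N t0 r0 rt.
  by rewrite (grid_step_cell _ t0 lr rl) fM// grid_ge0// ltW.
rewrite /grid_step big1 ?normr0// => l _; rewrite indicE memNset ?mulr0//= in_itv/=.
move=> /andP[h _]; have := le_lt_trans (grid_ge0 N l (ltW t0)) (lt_le_trans h r0).
by rewrite ltxx.
Qed.

Lemma grid_step_cvg t f (r : R) : 0 < t -> 0 < r -> r <= t ->
  {within `[0, +oo[, continuous f} ->
  (fun N => grid_step t N f r) @ \oo --> f r.
Proof.
move=> t0 r0 rt /continuous_within_itvcyP[cf _].
have /cvgrPdist_lt fr : {for r, continuous f} by apply: cf; rewrite in_itv/= r0.
apply/cvgrPdist_lt => e e0; have /nbhs_ballP[del /= del0 hdel] := fr e e0.
have dt0 : 0 < del / t by rewrite divr_gt0.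
have := near_infty_natSinv_lt (PosNum dt0); apply: filterS => N /= hN.
have [l lr rl] := grid_cell N t0 r0 rt.
rewrite (grid_step_cell _ t0 lr rl); apply: hdel; rewrite /ball/=.
rewrite gtr0_norm ?subr_gt0// ltrBlDl (le_lt_trans rl)// gridS ltrD2l.
by rewrite /mesh mulrC -ltr_pdivlMr.
Qed.

Lemma grid_measurable f t : {within `[0, +oo[, continuous f} ->
  measurable_fun (`[0, t]%classic : set R) f.
Proof.
move=> cf; apply: subspace_continuous_measurable_fun => //.
by apply: continuous_subspaceW cf => r /=; rewrite !in_itv/= andbT => /andP[].
Qed.

Lemma measurable_grid_step t N f : measurable_fun setT (grid_step t N f).
Proof.
by apply: measurable_sum => l; apply: measurable_funM => //; exact: measurable_indic.
Qed.

Lemma bounded_itv_integrable t f (M : R) :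
  measurable_fun (`[0, t]%classic : set R) f ->
  (forall r, 0 <= r <= t -> `|f r| <= M) ->
  mu.-integrable `[0, t] (EFin \o f).
Proof.
move=> mf fM; apply: measurable_bounded_integrable => //.
  by rewrite /= lebesgue_measure_itv/=; case: ifP => _; rewrite ?ltry// -EFinB ltry.
exists M; split => [|K MK r]; first exact: num_real.
move=> /=; rewrite in_itv/= => rt.
exact: le_trans (fM _ rt) (ltW MK).
Qed.

Lemma grid_L1_cvg t f (M : R) : 0 < t -> {within `[0, +oo[, continuous f} ->
  (forall s, 0 <= s -> `|f s| <= M) ->
  (fun N => \int[mu]_(r in `[0, t]) `|f r - grid_step t N f r|) @ \oo --> 0.
Proof.
move=> t0 cf fM.
have M0 : 0 <= M by apply: le_trans (fM 0 (lexx _)).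
have mf := @grid_measurable f t cf.
have [] := @dominated_convergence _ _ _ mu `[0, t]%classic (measurable_itv _)
  (fun N r => `|f r - grid_step t N f r|%:E) (cst 0%E) (fun r => (2 * M)%:E).
- move=> N; apply/measurable_EFinP; apply: measurableT_comp => //.
  by have := measurable_funB mf (measurable_funTS (measurable_grid_step t N f)); apply.
- exact: measurable_cst.
(* At time 0, which lies in no left-open cell, the step function vanishes whatever [f] is; this
   single point is discarded. *)
- exists [set 0]; split; [exact: measurable_set1|exact: lebesgue_measure_set1|].
  move=> r /= h; apply: contrapT => r0; apply: h; rewrite in_itv/= => /andP[r1 r2].
  have {}r0 : 0 < r by rewrite lt_neqAle r1 andbT eq_sym; apply/eqP.
  apply: cvg_EFin; [exact: nearW|rewrite /comp/=].
  rewrite -(normr0 R) -(subrr (f r)).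
  apply: cvg_norm; apply: cvgB; first exact: cvg_cst.
  exact: grid_step_cvg.
- apply: (bounded_itv_integrable (f := fun=> 2 * M) (M := `|2 * M|)) => //.
- apply: aeW => r N; rewrite /= in_itv/= => /andP[r0 rt].
  rewrite normr_id lee_fin (le_trans (ler_normB _ _))// mulrDl mul1r lerD ?fM//.
  exact: grid_step_bound.
move=> _ _ h.
have -> : (0 : R) = fine (0%:E) by [].
apply: fine_cvg.
by move: h; rewrite integral0.
Qed.

Section error_bounds.
Variables (t M : R) (f : R -> R) (N : nat).
Hypotheses (t0 : 0 < t) (cf : {within `[0, +oo[, continuous f}).
Hypothesis fM : forall s, 0 <= s -> `|f s| <= M.

Let M0 : 0 <= M. Proof. exact: le_trans (fM (lexx 0)). Qed.

Definition grid_L1 : R := \int[mu]_(r in `[0, t]) `|f r - grid_step t N f r|.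

Let mdiff s : measurable_fun (`[0, s]%classic : set R)
  (fun r => f r - grid_step t N f r).
Proof.
have mf := @grid_measurable f s cf.
by have := measurable_funB mf (measurable_funTS (measurable_grid_step t N f)); apply.
Qed.

Let diff_bound r : 0 <= r -> r <= t -> `|f r - grid_step t N f r| <= 2 * M.
Proof.
move=> r0 rt; rewrite (le_trans (ler_normB _ _))// mulrDl mul1r lerD ?fM//.
exact: grid_step_bound.
Qed.

(** The difference is at most 2 M in absolute value, so its square is at most 2 M times its absolute
    value. *)
Lemma grid_L2_le :
  (\int[mu]_(r in `[0%R, t]) ((f r - grid_step t N f r) ^+ 2)%:E <=
   (2 * M * grid_L1)%:E)%E.
Proof.
have mn : measurable_fun (`[0, t]%classic : set R) (fun r => `|f r - grid_step t N f r|).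
  by apply: measurableT_comp => //; exact: mdiff.
have ib : mu.-integrable `[0, t] (EFin \o (fun r => `|f r - grid_step t N f r|)).
  apply: (bounded_itv_integrable (M := 2 * M)) => // r /andP[r0 rt].
  by rewrite normr_id diff_bound.
rewrite EFinM /grid_L1 /Rintegral fineK; last exact: integrable_fin_num ib.
rewrite -ge0_integralZl//; last 2 first.
- by have := (measurable_EFinP _ _).2 mn; apply.
- by rewrite lee_fin mulr_ge0.
apply: ge0_le_integral => //.
- by move=> r _; rewrite lee_fin sqr_ge0.
- by have := (measurable_EFinP _ _).2 (measurable_funX 2 (@mdiff t)); apply.
- by have := measurable_funeM (2 * M)%:E ((measurable_EFinP _ _).2 mn); apply.
move=> r /=; rewrite in_itv/= => /andP[r0 rt].
rewrite -EFinM lee_fin -real_normK ?num_real// expr2.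
by rewrite ler_wpM2r// diff_bound.
Qed.

Lemma integral_grid_step k : (k <= N.+1)%N ->
  \int[mu]_(r in `[0, grid t N k]) grid_step t N f r =
  \sum_(l < k) f (grid t N l) * mesh t N.
Proof.
move=> kN; have g0 l : 0 <= grid t N l by rewrite grid_ge0 ?ltW.
have mind l : measurable_fun (`[0, grid t N k]%classic : set R) (fun r => \1_(`]grid t N l, grid t N l.+1]) r : R).
  by apply: measurable_funTS; exact: measurable_indic.
have ii l : mu.-integrable `[0, grid t N k] (fun r => (\1_(`]grid t N l, grid t N l.+1]) r)%:E).
  apply: (bounded_itv_integrable (M := 1)) => // r _.
  by rewrite indicE normr_nat; case: (_ \in _).
rewrite /Rintegral /grid_step; under eq_integral do rewrite -sumEFin.
rewrite integral_sum//; last by move=> l; exact: (integrableZl _ _ (ii l)).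
under eq_bigr => l _.
  rewrite (_ : integral _ _ _ = (f (grid t N l) * (if (l < k)%N then mesh t N else 0))%:E); last first.
    under eq_integral do rewrite EFinM.
    rewrite integralZl// EFinM integral_indic//=.
    congr (_ * _)%E; case: ifPn => lk.
      rewrite setIidl; last first.
        move=> r /=; rewrite !in_itv/= => /andP[/ltW h1 h2].
        by rewrite (le_trans (g0 l) h1) (le_trans h2)// grid_mono// ltW.
      rewrite lebesgue_measure_itv/= lte_fin gridS ltrDl mesh_gt0// -EFinB.
      by congr (_%:E); rewrite addrC addKr.
    rewrite (_ : _ `&` _ = set0) ?measure0//; apply/seteqP; split => // r /=.
    rewrite !in_itv/= => -[/andP[h1 _] /andP[_ h2]].
    rewrite -leqNgt in lk.
    have := lt_le_trans h1 (le_trans h2 (grid_mono N (ltW t0) lk)).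
    by rewrite ltxx.
  over.
rewrite sumEFin/= (big_ord_widen _ (fun l => f (grid t N l) * mesh t N) kN).
rewrite [RHS]big_mkcond/=; apply: eq_bigr => l _.
by case: ifP => _; rewrite ?mulr0.
Qed.

(** A left Riemann sum is the integral of the step function, hence the error up to any grid time is
    at most the L^1 distance over all of [0, t]. The bound is uniform in [k]. *)
Lemma riemann_error k : (k <= N.+1)%N ->
  `|\sum_(l < k) f (grid t N l) * mesh t N - \int[mu]_(r in `[0, grid t N k]) f r|
  <= grid_L1.
Proof.
move=> kN; have gt : grid t N k <= t by rewrite -[leRHS](grid_last t N) grid_mono// ltW.
have i1 : mu.-integrable `[0, grid t N k] (EFin \o f).
  by apply: (bounded_itv_integrable (M := M)); [exact: grid_measurable|move=> r /andP[r0 _]; exact: fM].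
have i2 : mu.-integrable `[0, grid t N k] (EFin \o grid_step t N f).
  apply: (bounded_itv_integrable (M := M)).
    exact: measurable_funTS (measurable_grid_step t N f).
  by move=> r /andP[r0 rg]; apply: grid_step_bound => //; exact: le_trans gt.
rewrite -integral_grid_step// distrC -RintegralB//.
apply: le_trans; first apply: le_normr_Rintegral => //.
  by have := integrableB _ i1 i2; apply.
rewrite /grid_L1 /Rintegral fine_le//.
- apply: integrable_fin_num => //; apply: (bounded_itv_integrable (M := 2 * M)).
    by apply: measurableT_comp => //; exact: mdiff.
  by move=> r /andP[r0 rg]; rewrite normr_id diff_bound// (le_trans rg).
- apply: integrable_fin_num => //; apply: (bounded_itv_integrable (M := 2 * M)).
    by apply: measurableT_comp => //; exact: mdiff.
  by move=> r /andP[r0 rg]; rewrite normr_id diff_bound.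
apply: ge0_subset_integral => //.
  apply/measurable_EFinP; apply: measurableT_comp => //; exact: mdiff.
by move=> r /=; rewrite !in_itv/= => /andP[-> /le_trans]; apply.
Qed.

End error_bounds.

End grid_approximation.

(** * The grid approximation of processes in mean square *)

Section grid_processes.
Context {d : measure_display} {T : measurableType d} {R : realType}.
Variable P : probability T R.
Local Notation mu := (@lebesgue_measure R).

Lemma grid_L1_le (t M : R) (f : R -> R) N : 0 < t ->
  {within `[0, +oo[, continuous f} -> (forall s, 0 <= s -> `|f s| <= M) ->
  grid_L1 t f N <= 2 * M * t.
Proof.
move=> t0 cf fM; have M0 : 0 <= M by exact: le_trans (fM 0 (lexx 0)).
have mdiff : measurable_fun (`[0, t]%classic : set R) (fun r => `|f r - grid_step t N f r|).
  have mf := @grid_measurable R f t cf; apply: measurableT_comp => //.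
  by have := measurable_funB mf (measurable_funTS (measurable_grid_step t N f)); apply.
have diff_bound r : 0 <= r -> r <= t -> `|f r - grid_step t N f r| <= 2 * M.
  move=> r0 rt; rewrite (le_trans (ler_normB _ _))// mulrDl mul1r lerD ?fM//.
  exact: grid_step_bound.
have -> : 2 * M * t = \int[mu]_(r in `[0, t]) (2 * M).
  rewrite Rintegral_cst//= lebesgue_measure_itv/= lte_fin t0 -EFinB/= subr0//.
apply: le_Rintegral => //.
- apply: (bounded_itv_integrable (M := 2 * M)) => // r /andP[r0 rt].
  by rewrite normr_id diff_bound.
- apply: (bounded_itv_integrable (f := fun=> 2 * M) (M := 2 * M)) => // r _.
  by rewrite ger0_norm ?mulr_ge0.
- by move=> r /=; rewrite in_itv/= => /andP[r0 rt]; exact: diff_bound.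
Qed.

(** For almost every outcome the time integral is at most 2 M times the L^1 error, which tends to 0
    and stays below 2 M t; dominated convergence in the outcome concludes. [Hc] agrees with [H]
    almost surely and is measurable at each nonnegative time. *)
Lemma grid_sqdist2_cvg (H Hc : R -> T -> R) (t M : R) : 0 < t ->
  jointly_measurable H -> (forall r, 0 <= r -> measurable_fun setT (Hc r)) ->
  {ae P, forall w, [/\ forall r, 0 <= r -> Hc r w = H r w,
     {within `[0, +oo[, continuous (fun r => H r w)} &
     forall r, 0 <= r -> `|H r w| <= M]} ->
  (fun N => sqdist2 P t H (fun r w => \sum_(l < N.+1) Hc (grid t N l) w *
     \1_(`]grid t N l, grid t N l.+1]) r)) @ \oo --> 0%E.
Proof.
move=> t0 mH mHc hae.
pose V N r w : R := \sum_(l < N.+1) Hc (grid t N l) w * \1_(`]grid t N l, grid t N l.+1]) r.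
have mV N : jointly_measurable (V N).
  by apply: jointly_measurable_step => l; apply: mHc; exact: grid_ge0 (ltW t0).
have inner_ae : {ae P, forall w, forall N,
    [/\ (\int[mu]_(r in `[0%R, t]) ((H r w - V N r w) ^+ 2)%:E <=
        (2 * M * grid_L1 t (fun r => H r w) N)%:E)%E,
      2 * M * grid_L1 t (fun r => H r w) N <= 2 * M * (2 * M * t) &
      (fun N => 2 * M * grid_L1 t (fun r => H r w) N) @ \oo --> 0]}.
  apply: filterS hae => w [HcE cH HM] N; split.
  - rewrite (_ : integral _ _ _ =
      (\int[mu]_(r in `[0%R, t]) ((H r w - grid_step t N (fun r => H r w) r) ^+ 2)%:E)%E).
      exact: grid_L2_le.
    apply: eq_integral => r _; rewrite /V /grid_step.
    by under eq_bigr do rewrite HcE ?grid_ge0// ?ltW//.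
  - rewrite ler_wpM2l//; first by rewrite mulr_ge0// (le_trans _ (HM 0 (lexx 0))).
    exact: grid_L1_le.
  - rewrite -[X in _ --> X](mulr0 (2 * M)); apply: cvgM; first exact: cvg_cst.
    exact: (grid_L1_cvg t0 cH HM).
have [] := @dominated_convergence _ _ _ P setT measurableT
  (fun N w => \int[mu]_(r in `[0%R, t]) ((H r w - V N r w) ^+ 2)%:E)%E (cst 0%E)
  (fun w => (2 * M * (2 * M * t))%:E).
- by move=> N; exact: measurable_sqdist.
- exact: measurable_cst.
- apply: filterS inner_ae => w h _.
  apply: (@squeeze_cvge _ _ _ _ (cst 0%E) _ (fun N => (2 * M * grid_L1 t (fun r => H r w) N)%:E)).
  + apply: nearW => N; have [-> _ _] := h N; rewrite andbT.
    by apply: integral_ge0 => r _; rewrite lee_fin sqr_ge0.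
  + exact: cvg_cst.
  + by apply: cvg_EFin; [exact: nearW|have [_ _] := h 0%N].
- exact: finite_measure_integrable_cst.
- apply: filterS inner_ae => w h N _; have [h1 h2 _] := h N.
  rewrite gee0_abs; last by apply: integral_ge0 => r _; rewrite lee_fin sqr_ge0.
  by apply: le_trans h1 _; rewrite lee_fin.
by move=> _ _; rewrite integral0.
Qed.

(** Before the k-th grid time the later cells contribute nothing, so the shorter sum may be
    completed, and then the time interval enlarged. This makes the Ito error uniform over the grid
    times. *)
Lemma grid_sqdist2_mono (H Hc : R -> T -> R) (t : R) N k : 0 < t -> (k <= N.+1)%N ->
  jointly_measurable H -> (forall r, 0 <= r -> measurable_fun setT (Hc r)) ->
  (sqdist2 P (grid t N k) H (fun r w => \sum_(l < k) Hc (grid t N l) w *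
     \1_(`]grid t N l, grid t N l.+1]) r)%R <=
   sqdist2 P t H (fun r w => \sum_(l < N.+1) Hc (grid t N l) w *
     \1_(`]grid t N l, grid t N l.+1]) r)%R)%E.
Proof.
move=> t0 kN mH mHc.
have mV m : jointly_measurable (fun r w => \sum_(l < m) Hc (grid t N l) w *
     \1_(`]grid t N l, grid t N l.+1]) r).
  by apply: jointly_measurable_step => l; apply: mHc; exact: grid_ge0 (ltW t0).
have gt : grid t N k <= t by rewrite -[leRHS](grid_last t N) grid_mono// ltW.
apply: ge0_le_integral => //.
- by move=> w _; apply: integral_ge0 => r _; rewrite lee_fin sqr_ge0.
- exact: measurable_sqdist.
- exact: measurable_sqdist.
move=> w _; apply: (@le_trans _ _ (\int[mu]_(r in `[0%R, grid t N k]) ((H r w -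
     \sum_(l < N.+1) Hc (grid t N l) w * \1_(`]grid t N l, grid t N l.+1]) r) ^+ 2)%:E)%E).
  rewrite le_eqVlt; apply/orP; left; apply/eqP/eq_integral => r; rewrite inE/= in_itv/= => /andP[r0 rk]; congr ((_ - _) ^+ 2)%:E.
  rewrite (big_ord_widen _ (fun l => Hc (grid t N l) w * \1_(`]grid t N l, grid t N l.+1]) r) kN).
  rewrite big_mkcond/=; apply: eq_bigr => l _; case: ifPn => // lk; symmetry.
  rewrite indicE memNset ?mulr0//= in_itv/= => /andP[h _].
  rewrite -leqNgt in lk.
  have := lt_le_trans h (le_trans rk (grid_mono N (ltW t0) lk)).
  by rewrite ltxx.
apply: ge0_subset_integral => //.
- have mf := measurable_funB (jointly_measurable_section w mH) (jointly_measurable_section w (mV N.+1)).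
  by have := (measurable_EFinP _ _).2 (measurable_funX 2 (mf t)); apply.
- by move=> r _; rewrite lee_fin sqr_ge0.
by move=> r /=; rewrite !in_itv/= => /andP[-> /le_trans]; apply.
Qed.

End grid_processes.

(** * The logistic function and its Taylor bound *)

Section logistic.
Context {R : realType}.
Implicit Types (x L : R) (f df g : R -> R).

(** Absolute values free the later uses from the order of [a] and [b]. *)
Lemma mvt_abs f df (a b : R) : (forall x, is_derive x 1 f (df x)) ->
  exists2 c, `|c - a| <= `|b - a| & f b - f a = df c * (b - a).
Proof.
move=> hf; have cf (u v : R) : {within `[u, v], continuous f}.
  apply: continuous_subspaceT => x.
  by apply: differentiable_continuous; apply/derivable1_diffP.
have [ab|/ltW ba] := leP a b.
  have [c + ->] := MVT_segment ab (fun x _ => hf x) (cf a b).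
  rewrite in_itv/= => /andP[ac cb]; exists c => //.
  by rewrite !ger0_norm ?subr_ge0// lerD2r.
have [c + h] := MVT_segment ba (fun x _ => hf x) (cf b a).
rewrite in_itv/= => /andP[bc ca]; exists c.
  by rewrite !ler0_norm ?subr_le0// lerN2 lerD2r.
by rewrite -[LHS]opprB h -mulrN opprB.
Qed.

(** Three applications of the mean value theorem: to the second derivative, then to the first
    derivative and to [f] with their Taylor polynomials subtracted. The factor 1/6 is given away. *)
Lemma taylor2_bound (f df ddf dddf : R -> R) (K : R) :
  (forall x, is_derive x 1 f (df x)) -> (forall x, is_derive x 1 df (ddf x)) ->
  (forall x, is_derive x 1 ddf (dddf x)) -> (forall x, `|dddf x| <= K) ->
  forall x y, `|f (x + y) - f x - df x * y - ddf x * y ^+ 2 / 2| <= K * `|y| ^+ 3.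
Proof.
move=> f1 f2 f3 hK x y.
have K0 : 0 <= K by exact: le_trans (hK 0).
have h2 z : `|ddf (x + z) - ddf x| <= K * `|z|.
  have [c _ ->] := mvt_abs x (x + z) f3.
  by rewrite addrAC subrr add0r normrM ler_wpM2r.
have h1 z : `|df (x + z) - df x - ddf x * z| <= K * `|z| ^+ 2.
  pose g (u : R) := df u - ddf x *: u.
  have g' (u : R) : is_derive u 1 g (ddf u - ddf x).
    have h : is_derive u 1 (ddf x *: (id : R -> R)) (ddf x).
      by rewrite -[X in is_derive _ _ _ X]mulr1; apply: is_deriveZ.
    exact: is_deriveB (f2 u) h.
  have [c hc] := mvt_abs x (x + z) g'.
  rewrite /g /GRing.scale/= => E.
  have -> : df (x + z) - df x - ddf x * z = df (x + z) - ddf x * (x + z) - (df x - ddf x * x) by ring.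
  rewrite E addrAC subrr add0r normrM expr2 mulrA ler_wpM2r//.
  have := h2 (c - x); rewrite (_ : x + (c - x) = c); last by ring.
  move=> /le_trans; apply.
  by rewrite ler_wpM2l// (le_trans hc)// addrAC subrr add0r.
pose g (u : R) := f u - df x *: u - (ddf x / 2) *: (u - x) ^+ 2.
have g' (u : R) : is_derive u 1 g (df u - df x - ddf x * (u - x)).
  have h : is_derive u 1 (df x *: (id : R -> R)) (df x).
    by rewrite -[X in is_derive _ _ _ X]mulr1; apply: is_deriveZ.
  have hc : is_derive u 1 ((id : R -> R) - cst x) 1.
    by rewrite -[X in is_derive _ _ _ X]subr0; apply: is_deriveB.
  have h2' := is_deriveB (is_deriveB (f1 u) h) (is_deriveZ (ddf x / 2) (is_deriveX 2 hc)).
  have -> : g = f - df x *: (id : R -> R) - (ddf x / 2) *: ((id : R -> R) - cst x) ^+ 2.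
    by apply/funext => z; rewrite /g !fctE /GRing.scale/= !expr2.
  by apply: is_derive_eq h2' _; rewrite /GRing.scale/= !fctE; field.
have [c hc] := mvt_abs x (x + y) g'.
rewrite /g /GRing.scale/= => E.
have -> : f (x + y) - f x - df x * y - ddf x * y ^+ 2 / 2 = f (x + y) - df x * (x + y) - ddf x / 2 * (x + y - x) ^+ 2 - (f x - df x * x - ddf x / 2 * (x - x) ^+ 2) by field.
rewrite E (_ : x + y - x = y); last by ring.
rewrite normrM exprSr mulrA ler_wpM2r//.
have := h1 (c - x); rewrite (_ : x + (c - x) = c); last by ring.
move=> /le_trans; apply.
rewrite ler_wpM2l// lerXn2r ?nnegrE// (le_trans hc)// addrAC subrr add0r//.
Qed.

(** With p the logistic of L, the relation x = y exp L becomes x (1 - p) = y p: linear in x and y,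
    with bounded smooth coefficients, and without division by a component that may approach 0. *)
Definition logistic L : R := expR L / (1 + expR L).

Lemma logistic_den_gt0 L : 0 < 1 + expR L.
Proof. by rewrite addr_gt0 ?expR_gt0. Qed.

Lemma logistic_ge0 L : 0 <= logistic L.
Proof. by rewrite divr_ge0 ?expR_ge0 ?ltW ?logistic_den_gt0. Qed.

Lemma logistic_le1 L : logistic L <= 1.
Proof. by rewrite ler_pdivrMr ?logistic_den_gt0// mul1r lerDr. Qed.

Lemma is_derive_logistic L :
  is_derive L 1 logistic (logistic L * (1 - logistic L)).
Proof.
have d0 : 1 + expR L != 0 by rewrite gt_eqF ?logistic_den_gt0.
pose G : R -> R := cst 1 + expR.
have h : is_derive L 1 G (expR L).
  by rewrite -[X in is_derive _ _ _ X]add0r; apply: is_deriveD.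
have hV : is_derive L 1 (fun y => (G y)^-1) (- (1 + expR L) ^- 2 *: expR L).
  have h1 : derivable G L 1 by case: h.
  have h2 := derivableV (f := G) d0 h1.
  by apply: (DeriveDef h2); rewrite (deriveV (f := G) d0 h1) derive_val.
have hM := is_deriveM (is_derive_expR L) hV.
have E : logistic = expR * (fun y => (G y)^-1) by apply/funext.
rewrite [X in is_derive _ _ X _]E; apply: is_derive_eq hM _.
by rewrite /logistic /GRing.scale/= /G !fctE; field; exact: d0.
Qed.

Let dl := fun x => logistic x * (1 - logistic x).
Let ddl := fun x => logistic x * (1 - logistic x) * (1 - 2 * logistic x).
Let dddl := fun x => logistic x * (1 - logistic x) * (1 - 6 * logistic x + 6 * logistic x ^+ 2).

Let is_derive_1p L : is_derive L 1 (cst 1 - logistic) (- dl L).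
Proof.
rewrite -[X in is_derive _ _ _ X]add0r; apply: is_deriveB; exact: is_derive_logistic.
Qed.

Let is_derive_dl L : is_derive L 1 dl (ddl L).
Proof.
have hM := is_deriveM (is_derive_logistic L) (is_derive_1p L).
have -> : dl = logistic * (cst 1 - logistic) by apply/funext.
apply: is_derive_eq hM _; rewrite /dl /ddl /GRing.scale/= !fctE.
have E (p : R) : p * - (p * (1 - p)) + (1 - p) * (p * (1 - p)) = p * (1 - p) * (1 - 2 * p).
  by ring.
exact: E.
Qed.

Let is_derive_ddl L : is_derive L 1 ddl (dddl L).
Proof.
have h : is_derive L 1 (cst 1 - 2 *: logistic) (- (2 * dl L)).
  rewrite -[X in is_derive _ _ _ X]add0r; apply: is_deriveB.
  exact: is_deriveZ (is_derive_logistic L).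
have hM := is_deriveM (is_derive_dl L) h.
have E : ddl = dl * (cst 1 - 2 *: logistic) by apply/funext.
rewrite E; apply: is_derive_eq hM _.
rewrite /dl /ddl /dddl /GRing.scale/= !fctE.
have E' (p : R) : p * (1 - p) * - (2 * (p * (1 - p))) +
    (1 - 2 * p) * (p * (1 - p) * (1 - 2 * p)) =
  p * (1 - p) * (1 - 6 * p + 6 * p ^+ 2) by ring.
exact: E'.
Qed.

(** The third derivative is a (1 - 6 a) with a = p (1 - p) between 0 and 1/4, hence at most 1 in
    absolute value. *)
Lemma logistic_taylor L y :
  `|logistic (L + y) - logistic L - logistic L * (1 - logistic L) * y -
    logistic L * (1 - logistic L) * (1 - 2 * logistic L) * y ^+ 2 / 2| <= `|y| ^+ 3.
Proof.
rewrite -[leRHS]mul1r.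
apply: (taylor2_bound is_derive_logistic is_derive_dl is_derive_ddl) => x.
have := logistic_ge0 x; have := logistic_le1 x; rewrite /dddl.
move: (logistic x) => p p1 p0.
have -> : p * (1 - p) * (1 - 6 * p + 6 * p ^+ 2) = p * (1 - p) * (1 - 6 * (p * (1 - p))) by ring.
have a0 : 0 <= p * (1 - p) by rewrite mulr_ge0 ?subr_ge0.
have a1 : p * (1 - p) <= 1 / 4 by have := sqr_ge0 (p - 1 / 2); rewrite expr2; lra.
move: (p * (1 - p)) a0 a1 => a a0 a1.
rewrite ler_norml; apply/andP; split; nra.
Qed.

Lemma logistic_ratio (x y L : R) : x * (1 - logistic L) - y * logistic L = 0 -> x = y * expR L.
Proof.
have d0 : 1 + expR L != 0 by rewrite gt_eqF ?logistic_den_gt0.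
rewrite /logistic => /eqP; rewrite subr_eq0 => /eqP h.
have {}h : x / (1 + expR L) = y * expR L / (1 + expR L).
  rewrite -mulrA -h; field; exact: d0.
by move/(mulIf (invr_neq0 d0)) : h.
Qed.

Lemma measurable_logistic : measurable_fun setT logistic.
Proof.
apply: continuous_measurable_fun => x.
by apply: differentiable_continuous; apply/derivable1_diffP; have := is_derive_logistic x => -[].
Qed.

End logistic.

(** * Pathwise algebra of one step of the gap *)

Section one_step.
Context {R : realFieldType}.
Variables (h xi xj p di dj mi mj nu bi bj ai aj f tau K : R).

(** One step of length [h]: [xi], [xj] are the sampled components, [di], [dj] the Euler errors,
    [mi], [mj] the noises and [nu] the mean noise, [bi], [bj] the growth rates, [ai], [aj] the log
    rates, [p] the logistic of the log ratio and [f] its Taylor remainder. The increment of the gap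
    [step_Z] is sorted by its order in the noise. *)
Definition step_mu := mi - mj.
Definition step_del := h * (ai - aj) + step_mu.
Definition step_dp := p * (1 - p) * step_del + p * (1 - p) * (1 - 2 * p) * step_del ^+ 2 / 2 + f.
Definition step_gap := xi * (1 - p) - xj * p.
Definition step_Z := (xi + di) * (1 - p) - (xj + dj) * p.
Definition step_Z' := (xi + di + xi * (h * bi + mi - nu)) * (1 - (p + step_dp)) -
  (xj + dj + xj * (h * bj + mj - nu)) * (p + step_dp).
(** The part linear in the noise is a multiple of [step_gap], up to the Euler errors: along an exact
    solution the gap and its noise coefficient vanish together. *)
Definition step_lin := step_gap * ((1 - p) * mi + p * mj - nu) - p * (1 - p) * (di + dj) * step_mu.
Definition step_drift := (1 - p) * (xi * bi) - p * (xj * bj) -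
  p * (1 - p) * (xi + xj + (di + dj)) * (ai - aj).
Definition step_quad :=
  - (p * (1 - p) * (1 - 2 * p) / 2 * (xi + xj + (di + dj))) * step_mu ^+ 2 -
  p * (1 - p) * ((xi * (mi - nu) + xj * (mj - nu)) * step_mu).
Definition step_rem := step_Z' - step_Z - step_lin - h * step_drift - step_quad.

Hypotheses (h0 : 0 <= h) (ht : h <= tau) (K1 : 1 <= K).
Hypotheses (xi0 : 0 <= xi) (xi1 : xi <= 1) (xj0 : 0 <= xj) (xj1 : xj <= 1).
Hypotheses (p0 : 0 <= p) (p1 : p <= 1).
Hypotheses (hbi : `|bi| <= K) (hbj : `|bj| <= K) (hai : `|ai| <= K) (haj : `|aj| <= K).
Hypotheses (tmi : `|mi| <= tau) (tmj : `|mj| <= tau) (tnu : `|nu| <= tau).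
Hypotheses (tmij : `|mi - mj| <= tau) (tmin : `|mi - nu| <= tau) (tmjn : `|mj - nu| <= tau).
Hypothesis hf : `|f| <= `|step_del| ^+ 3.

Let normM_le (x y a b : R) : `|x| <= a -> `|y| <= b -> `|x * y| <= a * b.
Proof. by move=> xa yb; rewrite normrM ler_pM. Qed.

Let normD_le (x y a b : R) : `|x| <= a -> `|y| <= b -> `|x + y| <= a + b.
Proof. by move=> xa yb; rewrite (le_trans (ler_normD _ _))// lerD. Qed.

Let normB_le (x y a b : R) : `|x| <= a -> `|y| <= b -> `|x - y| <= a + b.
Proof. by move=> xa yb; rewrite (le_trans (ler_normB _ _))// lerD. Qed.

Let tau0 : 0 <= tau. Proof. exact: le_trans ht. Qed.
Let K0 : 0 <= K. Proof. exact: le_trans K1. Qed.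

Let pq : `|p * (1 - p)| <= 1.
Proof. by rewrite -[leRHS]mulr1; apply: normM_le; rewrite ger0_norm ?subr_ge0// gerBl. Qed.

Let p2 : `|1 - 2 * p| <= 1.
Proof. by have := p0; have := p1 => h1 h2; rewrite ler_norml; apply/andP; split; lra. Qed.

Let pq2 : `|p * (1 - p) * (1 - 2 * p) / 2| <= 1.
Proof.
rewrite -[leRHS]mulr1; apply: normM_le; first by rewrite -[leRHS]mulr1; exact: normM_le.
by rewrite ger0_norm ?invr_ge0// invf_le1// ler1n.
Qed.

Let nxi : `|xi| <= 1. Proof. by rewrite ger0_norm. Qed.
Let nxj : `|xj| <= 1. Proof. by rewrite ger0_norm. Qed.
Let nh : `|h| <= h. Proof. by rewrite ger0_norm. Qed.
Let naa : `|ai - aj| <= 2 * K.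
Proof. by rewrite mulrDl mul1r; exact: normB_le. Qed.

Let ndel : `|step_del| <= 3 * K * tau.
Proof.
apply: le_trans (normD_le (normM_le nh naa) tmij) _.
have : h * K <= tau * K by rewrite ler_wpM2r.
have : tau <= K * tau by rewrite ler_peMl.
lra.
Qed.

Let G := xi * (mi - nu) + xj * (mj - nu).
Let b := xi * bi + xj * bj.
Let nG : `|G| <= 2 * tau.
Proof.
have -> : 2 * tau = 1 * tau + 1 * tau by ring.
by apply: normD_le; exact: normM_le.
Qed.
Let nb : `|b| <= 2 * K.
Proof.
have -> : 2 * K = 1 * K + 1 * K by ring.
by apply: normD_le; exact: normM_le.
Qed.
Let nS : `|h * b + G| <= 4 * K * tau.
Proof.
apply: le_trans (normD_le (normM_le nh nb) nG) _.
have : h * K <= tau * K by rewrite ler_wpM2r.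
have : tau <= K * tau by rewrite ler_peMl.
lra.
Qed.
Let nsh : `|xi + xj + (di + dj)| <= 2 * (1 + `|di + dj|).
Proof.
apply: le_trans (normD_le (normD_le nxi nxj) (lexx `|di + dj|)) _.
by have := normr_ge0 (di + dj); lra.
Qed.
Let ntau : `|tau| <= tau. Proof. by rewrite ger0_norm. Qed.
Let nf : `|f| <= (3 * K * tau) ^+ 3.
Proof. by apply: le_trans hf _; rewrite lerXn2r ?nnegrE// ?mulr_ge0. Qed.

(** Once the main parts are removed, each term of the identity [E] carries either h times the noise
    size or at least three factors of order [tau]; [tau] dominates the step length and all the
    noises. The constant 300 is generous. *)
Lemma step_rem_bound :
  `|step_rem| <= 300 * K ^+ 4 * ((1 + `|di + dj|) * (h * tau + tau ^+ 3 + tau ^+ 4)).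
Proof.
set c := p * (1 - p) * (1 - 2 * p) / 2; set sh := xi + xj + (di + dj).
have E : step_rem = - (c * sh * (h * (ai - aj) * (h * (ai - aj) + 2 * step_mu)))
   - p * (1 - p) * (h * (b * step_del + G * (ai - aj)))
   - c * (h * b + G) * step_del ^+ 2 - (h * b + G) * f - sh * f.
  rewrite /step_rem /step_Z' /step_Z /step_lin /step_drift /step_quad /step_dp /step_gap /step_del /sh /c /b /G /step_mu.
  by field.
rewrite E.
set D := 1 + `|di + dj|; have D1 : 1 <= D by rewrite lerDl.
have D0 : 0 <= D by lra.
have e1 : `|c * sh * (h * (ai - aj) * (h * (ai - aj) + 2 * step_mu))| <=
    1 * (2 * D) * (h * (2 * K) * (h * (2 * K) + 2 * tau)).
  apply: normM_le; first exact: normM_le.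
  apply: normM_le; first exact: normM_le.
  apply: normD_le; first exact: normM_le.
  by apply: normM_le => //; rewrite ger0_norm.
have e2 : `|p * (1 - p) * (h * (b * step_del + G * (ai - aj)))| <=
    1 * (h * (2 * K * (3 * K * tau) + 2 * tau * (2 * K))).
  apply: normM_le => //; apply: normM_le => //.
  by apply: normD_le; exact: normM_le.
have e3 : `|c * (h * b + G) * step_del ^+ 2| <= 1 * (4 * K * tau) * (3 * K * tau) ^+ 2.
  by apply: normM_le; [exact: normM_le|rewrite !expr2; exact: normM_le].
have e4 : `|(h * b + G) * f| <= 4 * K * tau * (3 * K * tau) ^+ 3 by exact: normM_le.
have e5 : `|sh * f| <= 2 * D * (3 * K * tau) ^+ 3 by exact: normM_le.
have nN (x a : R) : `|x| <= a -> `|- x| <= a by rewrite normrN.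
apply: le_trans (normB_le (normB_le (normB_le (normB_le (nN _ _ e1) e2) e3) e4) e5) _.
have hK : h * K <= tau * K by rewrite ler_wpM2r.
pose k2 := K ^+ 2; have k21 : 1 <= k2 by rewrite exprn_ege1.
have kK2 : K <= k2 by rewrite /k2 expr2 ler_peMl.
have k23 : k2 <= K ^+ 3 by rewrite exprSr ler_peMr ?exprn_ge0.
have k34 : K ^+ 3 <= K ^+ 4 by rewrite [leRHS]exprSr ler_peMr ?exprn_ge0.
have htt : h * (2 * K) * (h * (2 * K) + 2 * tau) <= 8 * K ^+ 4 * (h * tau).
  have -> : 8 * K ^+ 4 * (h * tau) = h * (8 * K ^+ 4 * tau) by ring.
  rewrite -mulrA ler_wpM2l//.
  have : K * (h * K) <= K * (tau * K) by rewrite ler_wpM2l.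
  have : K * tau <= k2 * tau by rewrite ler_wpM2r.
  have : k2 * tau <= K ^+ 4 * tau by rewrite ler_wpM2r// (le_trans k23).
  have -> : K * (tau * K) = k2 * tau by rewrite /k2; ring.
  lra.
have t3 : 0 <= tau ^+ 3 by rewrite exprn_ge0.
have t4 : 0 <= tau ^+ 4 by rewrite exprn_ge0.
have hT : 0 <= h * tau by rewrite mulr_ge0.
have K40 : 0 <= K ^+ 4 by rewrite exprn_ge0.
have a1 : 1 * (2 * D) * (h * (2 * K) * (h * (2 * K) + 2 * tau)) <= 16 * K ^+ 4 * (D * (h * tau)).
  have -> : 16 * K ^+ 4 * (D * (h * tau)) = 1 * (2 * D) * (8 * K ^+ 4 * (h * tau)) by ring.
  by rewrite ler_wpM2l// mul1r mulr_ge0.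
have up (x : R) : 0 <= x -> x <= D * x by move=> x0; rewrite ler_peMl.
have a2 : 1 * (h * (2 * K * (3 * K * tau) + 2 * tau * (2 * K))) <= 10 * K ^+ 4 * (D * (h * tau)).
  have -> : 1 * (h * (2 * K * (3 * K * tau) + 2 * tau * (2 * K))) = 6 * (k2 * (h * tau)) + 4 * (K * (h * tau)).
    by rewrite /k2; ring.
  have : K * (h * tau) <= K ^+ 4 * (h * tau) by rewrite ler_wpM2r// (le_trans kK2)// (le_trans k23).
  have : k2 * (h * tau) <= K ^+ 4 * (h * tau) by rewrite ler_wpM2r// (le_trans k23).
  have : K ^+ 4 * (h * tau) <= K ^+ 4 * (D * (h * tau)) by rewrite ler_wpM2l// up.
  lra.
have a3 : 1 * (4 * K * tau) * (3 * K * tau) ^+ 2 <= 36 * K ^+ 4 * (D * tau ^+ 3).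
  have -> : 1 * (4 * K * tau) * (3 * K * tau) ^+ 2 = 36 * (K ^+ 3 * tau ^+ 3) by ring.
  rewrite -[leRHS]mulrA ler_wpM2l//.
  by apply: ler_pM => //; [rewrite exprn_ge0|exact: up].
have a4 : 4 * K * tau * (3 * K * tau) ^+ 3 <= 108 * K ^+ 4 * (D * tau ^+ 4).
  have -> : 4 * K * tau * (3 * K * tau) ^+ 3 = 108 * (K ^+ 4 * tau ^+ 4) by ring.
  by rewrite -[leRHS]mulrA ler_wpM2l// ler_wpM2l// up.
have a5 : 2 * D * (3 * K * tau) ^+ 3 <= 54 * K ^+ 4 * (D * tau ^+ 3).
  have -> : 2 * D * (3 * K * tau) ^+ 3 = 54 * (K ^+ 3 * (D * tau ^+ 3)) by ring.
  rewrite -[leRHS]mulrA ler_wpM2l// ler_wpM2r// mulr_ge0//.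
have P1 : 0 <= K ^+ 4 * (D * (h * tau)) by rewrite !mulr_ge0.
have P3 : 0 <= K ^+ 4 * (D * tau ^+ 3) by rewrite !mulr_ge0.
have P4 : 0 <= K ^+ 4 * (D * tau ^+ 4) by rewrite !mulr_ge0.
have -> : 300 * K ^+ 4 * (D * (h * tau + tau ^+ 3 + tau ^+ 4)) =
  300 * (K ^+ 4 * (D * (h * tau))) + 300 * (K ^+ 4 * (D * tau ^+ 3)) + 300 * (K ^+ 4 * (D * tau ^+ 4)) by ring.
lra.
Qed.

(** Squaring the linear part costs tau^2 only in proportion to the squared gap and Euler errors; all
    other parts are of second order, and their squares have expectation of order h^2. A bare
    multiple of tau^2, of order h, would ruin the Gronwall argument. *)
Lemma step_sqr_bound : (step_Z' - step_Z) ^+ 2 <=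
  36 * ((step_gap ^+ 2 + (di + dj) ^+ 2) * tau ^+ 2) +
  4 * 610 ^+ 2 * K ^+ 8 * ((1 + (di + dj) ^+ 2) * (h + tau ^+ 2 + tau ^+ 4) ^+ 2).
Proof.
have -> : step_Z' - step_Z = step_lin + (h * step_drift + step_quad + step_rem).
  by rewrite /step_rem; ring.
have sq_le (x y : R) : (x + y) ^+ 2 <= 2 * x ^+ 2 + 2 * y ^+ 2.
  by have := sqr_ge0 (x - y); rewrite !expr2; lra.
have norm_sq (x a : R) : `|x| <= a -> x ^+ 2 <= a ^+ 2.
  by move=> xa; rewrite -real_normK ?num_real// lerXn2r ?nnegrE// (le_trans _ xa).
apply: le_trans (sq_le _ _) _; apply: lerD.
  rewrite /step_lin; apply: le_trans (ler_wpM2l _ (sq_le _ _)) _ => //.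
  have nL : `|(1 - p) * mi + p * mj - nu| <= 3 * tau.
    have -> : 3 * tau = 1 * tau + 1 * tau + tau by ring.
    apply: normB_le => //; apply: normD_le; apply: normM_le => //.
      by rewrite ger0_norm ?subr_ge0// gerBl.
    by rewrite ger0_norm.
  have := ler_wpM2l (sqr_ge0 step_gap) (norm_sq _ _ nL).
  have nM : `|p * (1 - p) * (di + dj) * step_mu| <= 1 * `|di + dj| * tau.
    by apply: normM_le => //; exact: normM_le.
  have := norm_sq _ _ nM.
  have -> : (1 * `|di + dj| * tau) ^+ 2 = (di + dj) ^+ 2 * tau ^+ 2.
    by rewrite mul1r exprMn real_normK ?num_real.
  set lam := (1 - p) * mi + p * mj - nu; set v := p * (1 - p) * (di + dj) * step_mu.
  rewrite sqrrN [(step_gap * lam) ^+ 2]exprMn [(3 * tau) ^+ 2]exprMn.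
  rewrite mulrDl; set u := step_gap ^+ 2; set w := (di + dj) ^+ 2.
  have : 0 <= w * tau ^+ 2 by rewrite mulr_ge0 ?sqr_ge0.
  have : 0 <= u * tau ^+ 2 by rewrite mulr_ge0 ?sqr_ge0.
  have -> : u * (3 ^+ 2 * tau ^+ 2) = 9 * (u * tau ^+ 2) by ring.
  lra.
set D := 1 + `|di + dj|.
have D1 : 1 <= D by rewrite lerDl.
have D0 : 0 <= D by lra.
have k4 : K <= K ^+ 4 by rewrite exprS ler_peMr// exprn_ege1.
have k41 : 1 <= K ^+ 4 by rewrite exprn_ege1.
have nDr : `|step_drift| <= 6 * K * D.
  have q1 : `|1 - p| <= 1 by rewrite ger0_norm ?subr_ge0// gerBl.
  have pp1 : `|p| <= 1 by rewrite ger0_norm.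
  have n1 := normM_le q1 (normM_le nxi hbi); have n2 := normM_le pp1 (normM_le nxj hbj).
  have n3 := normM_le (normM_le pq nsh) naa.
  apply: le_trans (normB_le (normB_le n1 n2) n3) _; rewrite -/D.
  have : K <= K * D by rewrite ler_peMr.
  lra.
have nQ : `|step_quad| <= 4 * D * tau ^+ 2.
  have nm2 : `|step_mu ^+ 2| <= tau * tau by rewrite expr2; exact: normM_le.
  have nc : `|- (p * (1 - p) * (1 - 2 * p) / 2 * (xi + xj + (di + dj)))| <= 1 * (2 * D).
    by rewrite normrN; exact: normM_le.
  apply: le_trans (normB_le (normM_le nc nm2) (normM_le pq (normM_le nG tmij))) _.
  have : 0 <= tau * tau by rewrite mulr_ge0.
  have -> : 1 * (2 * D) * (tau * tau) + 1 * (2 * tau * tau) =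
    2 * (D * (tau * tau)) + 2 * (tau * tau) by ring.
  have -> : 4 * D * tau ^+ 2 = 4 * (D * (tau * tau)) by ring.
  move: (tau * tau) => v v0.
  have : v <= D * v by rewrite ler_peMl.
  lra.
(* The remainder gives 600, twice 300, since tau^3 <= tau^2 + tau^4; the drift adds 6 and the
   quadratic part 4. *)
have nB : `|h * step_drift + step_quad + step_rem| <= 610 * K ^+ 4 * D * (h + tau ^+ 2 + tau ^+ 4).
  apply: le_trans (normD_le (normD_le (normM_le nh nDr) nQ) step_rem_bound) _.
  rewrite -/D.
  have t2 : 0 <= tau ^+ 2 by rewrite exprn_ge0.
  have t4 : 0 <= tau ^+ 4 by rewrite exprn_ge0.
  have r1 : h * tau <= tau ^+ 2 by rewrite expr2 ler_wpM2r.
  have r2 : tau ^+ 3 <= tau ^+ 2 + tau ^+ 4.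
    have := mulr_ge0 t2 (sqr_ge0 (tau - 1)).
    have -> : tau ^+ 2 * (tau - 1) ^+ 2 = tau ^+ 2 - 2 * tau ^+ 3 + tau ^+ 4 by ring.
    have : 0 <= tau ^+ 3 by rewrite exprn_ge0.
    lra.
  have KD : 0 <= K ^+ 4 * D by rewrite mulr_ge0// exprn_ge0.
  have r3 : 300 * K ^+ 4 * (D * (h * tau + tau ^+ 3 + tau ^+ 4)) <=
      600 * (K ^+ 4 * D * (tau ^+ 2 + tau ^+ 4)).
    have -> : 600 * (K ^+ 4 * D * (tau ^+ 2 + tau ^+ 4)) =
      300 * K ^+ 4 * (D * (2 * (tau ^+ 2 + tau ^+ 4))) by ring.
    apply: ler_wpM2l; first by apply: mulr_ge0; [exact: ler0n|exact: exprn_ge0].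
    apply: ler_wpM2l => //; lra.
  have r4 : h * (6 * K * D) <= 6 * (K ^+ 4 * D * h).
    have -> : h * (6 * K * D) = 6 * (K * D * h) by ring.
    by rewrite ler_wpM2l// ler_wpM2r// ler_wpM2r.
  have r5 : 4 * D * tau ^+ 2 <= 4 * (K ^+ 4 * D * tau ^+ 2).
    rewrite -mulrA ler_wpM2l// ler_wpM2r// ler_peMl//.
  have r6 : 0 <= K ^+ 4 * D * h by rewrite mulr_ge0.
  have r7 : 0 <= K ^+ 4 * D * tau ^+ 2 by rewrite mulr_ge0.
  have r8 : 0 <= K ^+ 4 * D * tau ^+ 4 by rewrite mulr_ge0.
  have -> : 610 * K ^+ 4 * D * (h + tau ^+ 2 + tau ^+ 4) =
    610 * (K ^+ 4 * D * h) + 610 * (K ^+ 4 * D * tau ^+ 2) + 610 * (K ^+ 4 * D * tau ^+ 4) by ring.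
  rewrite mulrDr in r3; lra.
have := norm_sq _ _ nB; set rho := h + tau ^+ 2 + tau ^+ 4.
have D2 : D ^+ 2 <= 2 * (1 + (di + dj) ^+ 2).
  apply: le_trans (sq_le _ _) _.
  by rewrite expr1n real_normK ?num_real//; lra.
have -> : (610 * K ^+ 4 * D * rho) ^+ 2 = 610 ^+ 2 * K ^+ 8 * (D ^+ 2 * rho ^+ 2).
  by move: (610 : R) => c; ring.
move=> h2; have h1 := ler_wpM2r (sqr_ge0 rho) D2.
have c0 : 0 <= 610 ^+ 2 * K ^+ 8 by apply: mulr_ge0; [exact: sqr_ge0|exact: exprn_ge0].
have h3 := le_trans h2 (ler_wpM2l c0 h1).
apply: le_trans (ler_wpM2l _ h3) _ => //.
move: (610 : R) => c; rewrite le_eqVlt; apply/orP; left; apply/eqP; ring.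
Qed.

End one_step.

(** * Expectations of polynomials in the increments *)

Section increment_polynomials.
Context {d : measure_display} {T : measurableType d} {R : realType}.
Variables (P : probability T R) (n : nat) (W : R -> T -> 'cV[R]_n).
Hypothesis hW : standard_brownian_motion P W.
Local Notation F := (brownian_filtration P W).
Local Notation inc := (increment W).
Implicit Types (s t h c : R) (f g : R -> R -> T -> R).

Lemma Ex_linear_increments (c : 'I_n -> T -> R) s t : 0 <= s -> s <= t ->
  (forall l, measurable_wrt (F s) (c l)) -> (forall l, Lall P (c l)) ->
  Ex P (fun w => \sum_l c l w * inc s t l w) = 0.
Proof.
move=> s0 st mc hc; rewrite Ex_sum; last first.
  by move=> l; apply: LallM => //; exact: Lall_increment.
by rewrite big1// => l _; exact: (Ex_mul_increment hW).
Qed.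

(** The coefficients factor out by independence of the past; products of distinct components are
    centred, and each square has expectation t - s. *)
Lemma Ex_quadratic_increments (c : 'I_n -> 'I_n -> T -> R) s t : 0 <= s -> s < t ->
  (forall l r, measurable_wrt (F s) (c l r)) -> (forall l r, Lall P (c l r)) ->
  Ex P (fun w => \sum_l \sum_r c l r w * (inc s t l w * inc s t r w)) =
  (t - s) * Ex P (fun w => \sum_l c l l w).
Proof.
move=> s0 st mc hc.
have hi l := Lall_increment hW l s0 (ltW st).
have hii l r : Lall P (fun w => inc s t l w * inc s t r w) by exact: LallM.
rewrite [LHS]Ex_sum; last by move=> l; apply: Lall_sum => r; exact: LallM.
rewrite [in RHS]Ex_sum// mulr_sumr; apply: eq_bigr => l _.
rewrite [LHS]Ex_sum; last by move=> r; exact: LallM.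
rewrite (bigD1 l)//= big1 ?addr0.
  rewrite (eq_Ex P (g := fun w => c l l w * inc s t l w ^+ 2)); last by move=> w; rewrite expr2.
  by rewrite (Ex_mul_increment_sqr hW)// 1?mulrC// ltW.
move=> r rl; rewrite (Ex_filtration_indep hW s0 st (mc l r))//.
  by rewrite (Ex_increment_prod hW)// ?mulr0 1?eq_sym// ltW.
by apply: measurable_wrtM; exact: increment_wrt.
Qed.

(* [f s t] has size at most [sqrt (t - s)] in every L^p. *)
Definition half_order f := forall m, exists2 c, 0 <= c & forall s t, 0 <= s -> s <= t ->
  t - s <= 1 -> Lall P (f s t) /\ Ex P (fun w => f s t w ^+ m.*2) <= c * (t - s) ^+ m.

Lemma half_orderD f g : half_order f -> half_order g ->
  half_order (fun s t w => f s t w + g s t w).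
Proof.
move=> hf hg m; have [c c0 hc] := hf m; have [c' c'0 hc'] := hg m.
exists (2 ^+ m.*2 * (c + c')); first by rewrite mulr_ge0 ?exprn_ge0// addr_ge0.
move=> s t s0 st ts1; have [Lf Ef] := hc s t s0 st ts1; have [Lg Eg] := hc' s t s0 st ts1.
split; first exact: LallD.
apply: (@le_trans _ _ (Ex P (fun w => 2 ^+ m.*2 * (f s t w ^+ m.*2 + g s t w ^+ m.*2)))).
  apply: Ex_le => [||w]; last exact: sum_even_pow_le.
    by apply: LallX; exact: LallD.
  by apply: LallZ; apply: LallD; exact: LallX.
rewrite ExZ ?ExD; [|exact: LallX|exact: LallX|by apply: LallD; exact: LallX].
by rewrite -mulrA ler_wpM2l ?exprn_ge0// mulrDl lerD.
Qed.

Lemma half_orderZ c f : half_order f -> half_order (fun s t w => c * f s t w).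
Proof.
move=> hf m; have [c' c'0 hc] := hf m.
exists (c ^+ m.*2 * c'); first by rewrite mulr_ge0// even_pow_ge0.
move=> s t s0 st ts1; have [Lf Ef] := hc s t s0 st ts1; split; first exact: LallZ.
rewrite (eq_Ex P (g := fun w => c ^+ m.*2 * f s t w ^+ m.*2)); last by move=> w; rewrite exprMn.
by rewrite ExZ; [rewrite -mulrA ler_wpM2l// even_pow_ge0|exact: LallX].
Qed.

Lemma half_order_increment l : half_order (fun s t w => `|inc s t l w|).
Proof.
move=> m; exists (normal_moment_cst m); first by rewrite /normal_moment_cst !mulr_ge0 ?exprn_ge0.
move=> s t s0 st _; have hL := Lall_increment hW l s0 st; split; first exact: Lall_norm.
rewrite (eq_Ex P (g := fun w => inc s t l w ^+ m.*2)); last first.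
  by move=> w; rewrite -normrX ger0_norm// even_pow_ge0.
exact: increment_even_moment.
Qed.

Lemma half_order_time : half_order (fun s t _ => t - s).
Proof.
move=> m; exists 1 => // s t s0 st ts1; split; first exact: Lall_cst.
rewrite Ex_cst mul1r -muln2 mulnC exprM; apply: lerXn2r; rewrite ?nnegrE ?sqr_ge0 ?subr_ge0//.
by rewrite expr2 ler_piMl// subr_ge0.
Qed.

Lemma half_order_sum (I : Type) (r : seq I) (G : I -> R -> R -> T -> R) :
  (forall i, half_order (G i)) -> half_order (fun s t w => \sum_(i <- r) G i s t w).
Proof.
move=> hG; elim: r => [|i r IH].
  rewrite (_ : (fun s t w => _) = (fun s t w => 0 * (t - s))).
    exact: half_orderZ half_order_time.
  by do 3 apply/funext => ?; rewrite big_nil mul0r.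
rewrite (_ : (fun s t w => _) = (fun s t w => G i s t w + \sum_(i <- r) G i s t w)).
  exact: half_orderD.
by do 3 apply/funext => ?; rewrite big_cons.
Qed.

Variable sigma : 'I_n -> R.

(** Dominates at once the step length, each noise, their mean under a point of the simplex, and the
    differences of these; the factor 2 pays for the differences. *)
Definition noise_size s t w : R := (t - s) + 2 * \sum_l `|sigma l| * `|inc s t l w|.

Lemma half_order_noise_size : half_order noise_size.
Proof.
apply: half_orderD; first exact: half_order_time.
apply: half_orderZ; apply: half_order_sum => l; apply: half_orderZ.
exact: half_order_increment.
Qed.

Lemma noise_size_ge0 s t w : s <= t -> 0 <= noise_size s t w.
Proof.
move=> st; rewrite addr_ge0 ?subr_ge0// mulr_ge0// sumr_ge0//.
Qed.

Lemma noise_size_wrt s t : measurable_wrt (sigma_increments W s t) (noise_size s t).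
Proof.
apply: measurable_wrtD; first exact: measurable_wrt_cst.
apply: measurable_wrtM; first exact: measurable_wrt_cst.
apply: measurable_wrt_sum => l; apply: measurable_wrtM; first exact: measurable_wrt_cst.
apply: (measurable_wrt_comp (phi := Num.norm)); last exact: increment_wrt.
exact: normr_measurable.
Qed.

(** Even moments come from [half_order]. The odd powers are split with weight sqrt h: 2 h tau <=
    sqrt h tau^2 + h sqrt h and 2 tau^3 <= sqrt h tau^2 + tau^4 / sqrt h. The exponent 3/2 exceeds
    1, so the remainders of t / h steps add up to order sqrt h. *)
Lemma noise_moments : exists2 C : R, 0 <= C & forall s t, 0 <= s -> s < t -> t - s <= 1 ->
  let h := t - s in let tau := noise_size s t in
  [/\ Ex P (fun w => tau w ^+ 2) <= C * h,
      Ex P (fun w => h * tau w + tau w ^+ 3 + tau w ^+ 4) <= C * (h * Num.sqrt h) &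
      Ex P (fun w => (h + tau w ^+ 2 + tau w ^+ 4) ^+ 2) <= C * h ^+ 2].
Proof.
have [c1 c10 h1] := half_order_noise_size 1; have [c2 c20 h2] := half_order_noise_size 2.
have [c4 c40 h4] := half_order_noise_size 4.
exists (3 * (1 + c1 + c2 + c4)); first by rewrite mulr_ge0// !addr_ge0.
move=> s t s0 st ts1 h tau.
have h0 : 0 < h by rewrite subr_gt0.
have [L1 E1] := h1 s t s0 (ltW st) ts1; have [_ E2] := h2 s t s0 (ltW st) ts1.
have [_ E4] := h4 s t s0 (ltW st) ts1.
rewrite -/h -/tau expr1 in E1; rewrite -/h -/tau in E2; rewrite -/h -/tau in E4.
have {}E1 : Ex P (fun w => tau w ^+ 2) <= c1 * h by [].
have {}E2 : Ex P (fun w => tau w ^+ 4) <= c2 * h ^+ 2 by [].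
have {}E4 : Ex P (fun w => tau w ^+ 8) <= c4 * h ^+ 4 by [].
set r := Num.sqrt h; have r0 : 0 < r by rewrite sqrtr_gt0.
have r2 : r ^+ 2 = h by rewrite sqr_sqrtr// ltW.
have r1 : r <= 1 by rewrite -sqrtr1 ler_sqrt.
have L2 := LallX 2 L1; have L4 := LallX 4 L1; have L8 := LallX 8 L1.
have c1h : 0 <= c1 * h by rewrite mulr_ge0// ltW.
have h20 : 0 <= h ^+ 2 by rewrite exprn_ge0// ltW.
have hr0 : 0 <= h * r by rewrite mulr_ge0// ltW.
have hr : h <= r by rewrite -{1}r2 expr2 ler_piMl// ltW.
have h2r : h ^+ 2 <= h * r by rewrite expr2; apply: ler_wpM2l => //; exact: ltW.
split.
- apply: le_trans E1 _; rewrite ler_wpM2r ?ltW//; lra.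
- apply: (@le_trans _ _ (Ex P (fun w => (1 / 2 * r + 1 / 2 * r) * tau w ^+ 2 + (1 / (2 * r) + 1) * tau w ^+ 4 + 1 / 2 * (h * r)))).
    apply: Ex_le => [||w].
    + apply: LallD; last exact: LallX.
      by apply: LallD; [exact: LallZ|exact: LallX].
    + apply: LallD; last exact: Lall_cst.
      by apply: LallD; exact: LallZ.
    + have a1 : h * tau w <= 1 / 2 * r * tau w ^+ 2 + 1 / 2 * (h * r).
        rewrite -r2; have := mulr_ge0 (ltW r0) (sqr_ge0 (r - tau w)).
        have -> : r * (r - tau w) ^+ 2 = r ^+ 3 - 2 * (r ^+ 2 * tau w) + r * tau w ^+ 2 by ring.
        have -> : r ^+ 2 * r = r ^+ 3 by ring.
        lra.
      have a2 : tau w ^+ 3 <= 1 / 2 * r * tau w ^+ 2 + 1 / (2 * r) * tau w ^+ 4.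
        have : 0 <= (2 * r)^-1 * (tau w ^+ 2 * (r - tau w) ^+ 2).
          apply: mulr_ge0; first by rewrite invr_ge0 mulr_ge0// ltW.
          by rewrite mulr_ge0 ?sqr_ge0.
        have -> : (2 * r)^-1 * (tau w ^+ 2 * (r - tau w) ^+ 2) =
          1 / 2 * r * tau w ^+ 2 - tau w ^+ 3 + 1 / (2 * r) * tau w ^+ 4.
          by field; rewrite gt_eqF.
        lra.
      have -> : (1 / 2 * r + 1 / 2 * r) * tau w ^+ 2 + (1 / (2 * r) + 1) * tau w ^+ 4 + 1 / 2 * (h * r) =
        1 / 2 * r * tau w ^+ 2 + 1 / 2 * (h * r) + (1 / 2 * r * tau w ^+ 2 + 1 / (2 * r) * tau w ^+ 4) + tau w ^+ 4.
        by ring.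
      by rewrite lerD2r lerD.
  have LA := LallZ (1 / 2 * r + 1 / 2 * r) L2; have LB := LallZ (1 / (2 * r) + 1) L4.
  rewrite (ExD (LallD LA LB) (Lall_cst P _)) (ExD LA LB) (ExZ _ L2) (ExZ _ L4) Ex_cst.
  have b1 : (1 / 2 * r + 1 / 2 * r) * Ex P (fun w => tau w ^+ 2) <= c1 * (h * r).
    have -> : c1 * (h * r) = (1 / 2 * r + 1 / 2 * r) * (c1 * h) by field.
    by rewrite ler_wpM2l// addr_ge0// mulr_ge0 ?ltW.
  have b2 : (1 / (2 * r) + 1) * Ex P (fun w => tau w ^+ 4) <= 3 / 2 * c2 * (h * r).
    have k0 : 0 <= 1 / (2 * r) + 1 by rewrite addr_ge0// divr_ge0// mulr_ge0 ?ltW.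
    apply: le_trans (ler_wpM2l k0 E2) _.
    have -> : (1 / (2 * r) + 1) * (c2 * h ^+ 2) = 1 / 2 * c2 * (h * r) + c2 * h ^+ 2.
      by rewrite -r2; field; rewrite gt_eqF.
    have := ler_wpM2l c20 h2r; lra.
  apply: le_trans (lerD (lerD b1 b2) (lexx _)) _.
  have -> : 3 * (1 + c1 + c2 + c4) * (h * r) = 3 * (h * r) + 3 * (c1 * (h * r)) +
    3 * (c2 * (h * r)) + 3 * (c4 * (h * r)) by ring.
  have := mulr_ge0 c10 hr0; have := mulr_ge0 c20 hr0; have := mulr_ge0 c40 hr0.
  rewrite -!mulrA; lra.
- apply: (@le_trans _ _ (Ex P (fun w => 3 * (h ^+ 2 + tau w ^+ 4 + tau w ^+ 8)))).
    have LS : Lall P (fun w => h + tau w ^+ 2 + tau w ^+ 4).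
      by apply: LallD => //; apply: LallD => //; exact: Lall_cst.
    apply: Ex_le => [||w].
    + exact: LallX.
    + by apply: LallZ; apply: LallD => //; apply: LallD => //; exact: Lall_cst.
    + have gen (a b : R) : (h + a + b) ^+ 2 <= 3 * (h ^+ 2 + a ^+ 2 + b ^+ 2).
        have := sqr_ge0 (h - a); have := sqr_ge0 (h - b); have := sqr_ge0 (a - b).
        rewrite !expr2; lra.
      by have := gen (tau w ^+ 2) (tau w ^+ 4); rewrite -!exprM.
  rewrite ExZ; last by apply: LallD => //; apply: LallD => //; exact: Lall_cst.
  rewrite ExD//; last by apply: LallD => //; exact: Lall_cst.
  rewrite ExD//; last exact: Lall_cst.
  rewrite Ex_cst -mulrA ler_wpM2l//.
  have h42 : h ^+ 4 <= h ^+ 2.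
    have -> : h ^+ 4 = h ^+ 2 * h ^+ 2 by ring.
    by rewrite ler_piMl// exprn_ile1// ltW.
  have := ler_wpM2l c40 h42; have := mulr_ge0 c10 h20.
  rewrite !mulrDl mul1r; lra.
Qed.

End increment_polynomials.

(** * The rates of the replicator equation and their bounds *)

Section coefficients.
Context {R : realType} {n : nat}.
Variables (A : 'M[R]_n) (sigma : 'I_n -> R).
Implicit Types (y : 'I_n -> R) (i j : 'I_n).

Definition payoff y i : R := \sum_k A i k * y k.
Definition mean_rate y : R := \sum_k y k * (payoff y k - sigma k ^+ 2 * y k).
(** The i-th drift coefficient of the equation is y_i times this rate. *)
Definition growth_rate y i : R := payoff y i - sigma i ^+ 2 * y i - mean_rate y.
(** Up to a term common to all components, the drift of ln X_i; on the simplex it is the i-th payoff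
    of the modified matrix. *)
Definition log_rate y i : R := payoff y i - sigma i ^+ 2 / 2.

Definition rate_bound : R :=
  1 + n.+2%:R * (\sum_i \sum_k `|A i k| + \sum_i sigma i ^+ 2).

Let S : R := \sum_i \sum_k `|A i k|.
Let Q : R := \sum_i sigma i ^+ 2.

Let S0 : 0 <= S. Proof. by apply: sumr_ge0 => i _; apply: sumr_ge0. Qed.
Let Q0 : 0 <= Q. Proof. by apply: sumr_ge0 => i _; exact: sqr_ge0. Qed.

Lemma rate_bound_ge1 : 1 <= rate_bound.
Proof. by rewrite /rate_bound lerDl mulr_ge0// addr_ge0. Qed.

Lemma sigma_sqr_le i : sigma i ^+ 2 <= Q.
Proof.
rewrite /Q (bigD1 i)//= lerDl; apply: sumr_ge0 => k _; exact: sqr_ge0.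
Qed.

Section bounds.
Variable y : 'I_n -> R.
Hypothesis y01 : forall k, 0 <= y k <= 1.

Let ny k : `|y k| <= 1. Proof. by have /andP[y0 y1] := y01 k; rewrite ger0_norm. Qed.

Let pay_le i : `|payoff y i| <= S.
Proof.
apply: (@le_trans _ _ (\sum_k `|A i k|)).
  apply: le_trans (ler_norm_sum _ _ _) _; apply: ler_sum => k _.
  by rewrite normrM ler_piMr.
by rewrite /S [leRHS](bigD1 i)//= lerDl; apply: sumr_ge0 => k _; exact: sumr_ge0.
Qed.

Let sy_le i : `|sigma i ^+ 2 * y i| <= Q.
Proof.
rewrite normrM (ger0_norm (sqr_ge0 _)).
by apply: le_trans (sigma_sqr_le i); rewrite ler_piMr ?sqr_ge0.
Qed.

Let mean_le : `|mean_rate y| <= n%:R * (S + Q).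
Proof.
apply: le_trans (ler_norm_sum _ _ _) _.
rewrite -[X in X%:R * _]card_ord mulr_natl -sumr_const; apply: ler_sum => k _.
rewrite normrM -[leRHS]mul1r ler_pM//.
by rewrite (le_trans (ler_normB _ _))// lerD.
Qed.

Let SQ0 : 0 <= S + Q. Proof. exact: addr_ge0. Qed.
Let nSQ0 : 0 <= n%:R * (S + Q). Proof. exact: mulr_ge0. Qed.
Let KE : rate_bound = 1 + n%:R * (S + Q) + 2 * (S + Q).
Proof. by rewrite /rate_bound -/S -/Q -[n.+2]addn2 natrD; ring. Qed.

Lemma payoff_bound i : `|payoff y i| <= rate_bound.
Proof. by apply: le_trans (pay_le i) _; rewrite KE; have := S0; have := Q0; have := nSQ0; lra. Qed.

Lemma mean_rate_bound : `|mean_rate y| <= rate_bound.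
Proof. by apply: le_trans mean_le _; rewrite KE; have := S0; have := Q0; lra. Qed.

Lemma growth_rate_bound i : `|growth_rate y i| <= rate_bound.
Proof.
rewrite /growth_rate; apply: le_trans (ler_normB _ _) _.
have := mean_le; have := le_trans (ler_normB (payoff y i) _) (lerD (pay_le i) (sy_le i)).
rewrite KE; have := S0; have := Q0; lra.
Qed.

Lemma log_rate_bound i : `|log_rate y i| <= rate_bound.
Proof.
rewrite /log_rate; apply: le_trans (ler_normB _ _) _.
have h : 0 <= sigma i ^+ 2 / 2 by rewrite divr_ge0 ?sqr_ge0.
have := pay_le i; have := sigma_sqr_le i; have := nSQ0.
rewrite (ger0_norm h) KE; have := S0; have := Q0; have := sqr_ge0 (sigma i); lra.
Qed.

Lemma sigma_sqr_bound i : sigma i ^+ 2 <= rate_bound.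
Proof.
by apply: le_trans (sigma_sqr_le i) _; rewrite KE; have := S0; have := Q0; have := nSQ0; lra.
Qed.

End bounds.

(* The [dt]-coefficient of [dZ] for [Z = x_i (1 - p) - x_j p] is again a multiple
   of [Z], up to the discrepancy [ds] between the Euler scheme and the process:
   Ito's correction to the logistic cancels the [- sigma^2 / 2] of [log_rate]. *)
Lemma gap_drift_identity y i j (p ds : R) : let q := 1 - p in
  (1 - p) * (y i * growth_rate y i) - p * (y j * growth_rate y j) -
    p * (1 - p) * (y i + y j + ds) * (log_rate y i - log_rate y j) -
    (p * (1 - p) * (1 - 2 * p) / 2 * (y i + y j + ds) * (sigma i ^+ 2 + sigma j ^+ 2) +
     p * (1 - p) * (sigma i ^+ 2 * (y i * (1 - y i) - y j * y i) -
       sigma j ^+ 2 * (y j * (1 - y j) - y i * y j))) =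
  (y i * q - y j * p) * (q * payoff y i + p * payoff y j - mean_rate y -
     sigma i ^+ 2 * (q * (p + y i)) - sigma j ^+ 2 * (p * (q + y j))) -
  ds * (p * q * (log_rate y i - log_rate y j) + p * q * (1 - 2 * p) / 2 * (sigma i ^+ 2 + sigma j ^+ 2)).
Proof.
rewrite /growth_rate /log_rate.
move: (payoff y i) (payoff y j) (mean_rate y) (sigma i) (sigma j) (y i) (y j) => *.
by field.
Qed.

End coefficients.

(** * Integrability of the parts of a step, and expansion of the second moment *)

Section step_integrability.
Context {d : measure_display} {T : measurableType d} {R : realType} (P : probability T R).
Variables (xi xj p di dj mi mj nu bi bj ai aj : T -> R).
Hypotheses (Lxi : Lall P xi) (Lxj : Lall P xj) (Lp : Lall P p) (Ldi : Lall P di) (Ldj : Lall P dj).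
Hypotheses (Lmi : Lall P mi) (Lmj : Lall P mj) (Lnu : Lall P nu) (Lbi : Lall P bi) (Lbj : Lall P bj).
Hypotheses (Lai : Lall P ai) (Laj : Lall P aj).

Let L1 : Lall P (fun=> 1 : R). Proof. exact: Lall_cst. Qed.
Let Lq : Lall P (fun w => 1 - p w). Proof. exact: LallB. Qed.
Let Lpq : Lall P (fun w => p w * (1 - p w)). Proof. exact: LallM. Qed.
Let Lds : Lall P (fun w => di w + dj w). Proof. exact: LallD. Qed.
Let Lmu : Lall P (fun w => mi w - mj w). Proof. exact: LallB. Qed.
Let Lxs : Lall P (fun w => xi w + xj w + (di w + dj w)). Proof. by do 2?apply: LallD. Qed.

Lemma Lall_step_lin : Lall P (fun w => step_lin (xi w) (xj w) (p w) (di w) (dj w) (mi w) (mj w) (nu w)).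
Proof.
rewrite /step_lin /step_gap /step_mu; apply: LallB.
  apply: LallM; first by apply: LallB; exact: LallM.
  by apply: LallB => //; apply: LallD; exact: LallM.
by apply: LallM => //; exact: LallM.
Qed.

Lemma Lall_step_drift :
  Lall P (fun w => step_drift (xi w) (xj w) (p w) (di w) (dj w) (bi w) (bj w) (ai w) (aj w)).
Proof.
rewrite /step_drift; apply: LallB.
  by apply: LallB; apply: LallM => //; exact: LallM.
by apply: LallM; [exact: LallM|exact: LallB].
Qed.

Lemma Lall_step_quad : Lall P (fun w => step_quad (xi w) (xj w) (p w) (di w) (dj w) (mi w) (mj w) (nu w)).
Proof.
have L12 : Lall P (fun w => 1 - 2 * p w) by apply: LallB => //; exact: LallZ.
rewrite /step_quad /step_mu; apply: LallB.
  apply: LallM; last exact: LallX.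
  apply: LallN; apply: LallM => //; apply: LallM; [exact: LallM|exact: Lall_cst].
apply: LallM => //; apply: LallM => //.
by apply: LallD; apply: LallM => //; exact: LallB.
Qed.

End step_integrability.

Section second_moment_expansion.
Context {d : measure_display} {T : measurableType d} {R : realType}.
Variables (P : probability T R) (Z Z' lin dr quad rem qc : T -> R) (h : R).
Hypotheses (LZ : Lall P Z) (LZ' : Lall P Z') (Llin : Lall P lin) (Ldr : Lall P dr).
Hypotheses (Lquad : Lall P quad) (Lqc : Lall P qc).
Hypothesis Z'Z : forall w, Z' w = Z w + lin w + h * dr w + quad w + rem w.
Hypothesis Zlin : Ex P (fun w => Z w * lin w) = 0.
Hypothesis Zquad : Ex P (fun w => Z w * quad w) = h * Ex P qc.

(** Z' is expanded around Z: against Z the linear noise is centred and the quadratic noise leaves h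
    times the mean of [qc], which joins the drift; the squared increment is kept whole. *)
Lemma second_moment_expansion : Ex P (fun w => Z' w ^+ 2) = Ex P (fun w => Z w ^+ 2) +
  2 * (h * Ex P (fun w => Z w * dr w + qc w) + Ex P (fun w => Z w * rem w)) +
  Ex P (fun w => (Z' w - Z w) ^+ 2).
Proof.
have Lrem : Lall P rem.
  have -> : rem = fun w => Z' w - Z w - lin w - h * dr w - quad w.
    by apply/funext => w; rewrite Z'Z; ring.
  by apply: LallB => //; apply: LallB; [apply: LallB => //; exact: LallB|exact: LallZ].
have LZd := LallM LZ Ldr; have LZq := LallM LZ Lquad; have LZl := LallM LZ Llin.
have LZr := LallM LZ Lrem; have LhZd := LallZ h LZd; have LZ2 := LallX 2 LZ.
have LD := LallX 2 (LallB LZ' LZ).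
have L12 := LallD LZl LhZd; have L123 := LallD L12 LZq; have L1234 := LallD L123 LZr.
have L2 := LallZ 2 L1234; have LS := LallD LZ2 L2.
have -> : h * Ex P (fun w => Z w * dr w + qc w) = Ex P (fun w => Z w * lin w) +
    Ex P (fun w => h * (Z w * dr w)) + Ex P (fun w => Z w * quad w).
  by rewrite Zlin add0r Zquad (ExD LZd Lqc) mulrDr (ExZ _ LZd).
rewrite -(ExD LZl LhZd) -(ExD L12 LZq) -(ExD L123 LZr) -(ExZ _ L1234) -(ExD LZ2 L2) -(ExD LS LD).
by apply: eq_Ex => w; rewrite Z'Z; ring.
Qed.

End second_moment_expansion.

(** * Expected growth of the squared gap over one step *)

Section one_step_expectation.
Context {d : measure_display} {T : measurableType d} {R : realType}.
Variables (P : probability T R) (n : nat) (W : R -> T -> 'cV[R]_n).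
Hypothesis hW : standard_brownian_motion P W.
Variables (A : 'M[R]_n) (sigma : 'I_n -> R) (i j : 'I_n).
Hypothesis ij : i != j.
Local Notation F := (brownian_filtration P W).
Local Notation inc := (increment W).
Local Notation K := (rate_bound A sigma).

Variables (s t : R).
Hypotheses (s0 : 0 <= s) (st : s < t) (ts1 : t - s <= 1).
Let h := t - s.

Variables (x : 'I_n -> T -> R) (Xi Xj p p' : T -> R).
Hypotheses (x01 : forall l w, 0 <= x l w <= 1) (p01 : forall w, 0 <= p w <= 1).
Hypothesis p'01 : forall w, 0 <= p' w <= 1.
Hypotheses (mx : forall l, measurable_wrt (F s) (x l)) (mp : measurable_wrt (F s) p).
Hypotheses (mXi : measurable_wrt (F s) Xi) (mXj : measurable_wrt (F s) Xj).
Hypotheses (LXi : Lall P Xi) (LXj : Lall P Xj) (mp' : measurable_fun setT p').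

Let di w := Xi w - x i w.
Let dj w := Xj w - x j w.
Let m l w := sigma l * inc s t l w.
Let nu w := \sum_l x l w * m l w.
Let be l w := growth_rate A sigma (x^~ w) l.
Let al l w := log_rate A sigma (x^~ w) l.
Let del w := step_del h (m i w) (m j w) (al i w) (al j w).
Let f w := p' w - p w - p w * (1 - p w) * del w - p w * (1 - p w) * (1 - 2 * p w) * del w ^+ 2 / 2.
Hypothesis taylor : forall w, `|f w| <= `|del w| ^+ 3.

Let Z w := Xi w * (1 - p w) - Xj w * p w.
Let Z' w := (Xi w + x i w * (h * be i w + m i w - nu w)) * (1 - p' w) -
  (Xj w + x j w * (h * be j w + m j w - nu w)) * p' w.
Let delta w := di w ^+ 2 + dj w ^+ 2.
Let tau := noise_size W sigma s t.

Let h0 : 0 < h. Proof. by rewrite subr_gt0. Qed.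

Let lin w := step_lin (x i w) (x j w) (p w) (di w) (dj w) (m i w) (m j w) (nu w).
Let drift_ w := step_drift (x i w) (x j w) (p w) (di w) (dj w) (be i w) (be j w) (al i w) (al j w).
Let quad w := step_quad (x i w) (x j w) (p w) (di w) (dj w) (m i w) (m j w) (nu w).
Let rem_ w := step_rem h (x i w) (x j w) (p w) (di w) (dj w) (m i w) (m j w) (nu w)
  (be i w) (be j w) (al i w) (al j w) (f w).
Let gap w := step_gap (x i w) (x j w) (p w).

Let ZE w : Z w = step_Z (x i w) (x j w) (p w) (di w) (dj w).
Proof. by rewrite /Z /step_Z /di /dj; ring. Qed.

Let Z'E w : Z' w = step_Z' h (x i w) (x j w) (p w) (di w) (dj w) (m i w) (m j w) (nu w)
  (be i w) (be j w) (al i w) (al j w) (f w).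
Proof.
rewrite /Z' /step_Z' /step_dp -/(del w).
have -> : p w + (p w * (1 - p w) * del w + p w * (1 - p w) * (1 - 2 * p w) * del w ^+ 2 / 2 + f w) = p' w.
  by rewrite /f; ring.
by rewrite /di /dj; ring.
Qed.

Let Z'Z w : Z' w = Z w + lin w + h * drift_ w + quad w + rem_ w.
Proof. by rewrite /rem_ /step_rem -ZE -Z'E -/(lin w) -/(drift_ w) -/(quad w); ring. Qed.

Let nmx l w : `|m l w| <= tau w - h.
Proof.
rewrite /tau /noise_size /h addrAC subrr add0r.
apply: (@le_trans _ _ (\sum_l `|sigma l| * `|inc s t l w|)).
  by rewrite /m normrM (bigD1 l)//= lerDl; apply: sumr_ge0 => k _; rewrite mulr_ge0.
by rewrite ler_peMl ?ler1n//; apply: sumr_ge0 => k _; rewrite mulr_ge0.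
Qed.

Let nm2 l w : 2 * `|m l w| <= tau w - h.
Proof.
rewrite /tau /noise_size /h addrAC subrr add0r ler_wpM2l//.
by rewrite /m normrM (bigD1 l)//= lerDl; apply: sumr_ge0 => k _; rewrite mulr_ge0.
Qed.

Let nnu2 w : 2 * `|nu w| <= tau w - h.
Proof.
rewrite /tau /noise_size /h addrAC subrr add0r ler_wpM2l//.
apply: le_trans (ler_norm_sum _ _ _) _; apply: ler_sum => l _.
have /andP[x0 x1] := x01 l w.
by rewrite /m !normrM (ger0_norm x0) ler_piMl// mulr_ge0.
Qed.

Let bounds w : [/\ h <= tau w, `|m i w| <= tau w, `|m j w| <= tau w & `|nu w| <= tau w] /\
  [/\ `|m i w - m j w| <= tau w, `|m i w - nu w| <= tau w & `|m j w - nu w| <= tau w].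
Proof.
have := nm2 i w; have := nm2 j w; have := nnu2 w; have := h0.
have := normr_ge0 (m i w); have := normr_ge0 (m j w); have := normr_ge0 (nu w).
move=> a1 a2 a3 a4 a5 a6 a7.
split; first by split; lra.
by split; apply: le_trans (ler_normB _ _) _; lra.
Qed.

Let Lx l : Lall P (x l).
Proof.
have mx' := measurable_wrt_fun (filtration_measurable hW (t := s)) (mx l).
apply: (Lall_bounded P (M := 1) mx') => w.
by have /andP[a b] := x01 l w; rewrite ger0_norm.
Qed.
Let Lp : Lall P p.
Proof.
have mp1 := measurable_wrt_fun (filtration_measurable hW (t := s)) mp.
apply: (Lall_bounded P (M := 1) mp1) => w.
by have /andP[a b] := p01 w; rewrite ger0_norm.
Qed.
Let Lp' : Lall P p'.
Proof.
apply: (Lall_bounded P (M := 1) mp') => w.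
by have /andP[a b] := p'01 w; rewrite ger0_norm.
Qed.
Let Lm l : Lall P (m l). Proof. exact/LallZ/(Lall_increment hW l s0 (ltW st)). Qed.
Let Lnu : Lall P nu. Proof. by apply: Lall_sum => l; exact: LallM. Qed.
Let Ldi : Lall P di. Proof. exact: LallB. Qed.
Let Ldj : Lall P dj. Proof. exact: LallB. Qed.
Let L1 : Lall P (fun=> 1 : R). Proof. exact: Lall_cst. Qed.
Let Lq : Lall P (fun w => 1 - p w). Proof. exact: LallB. Qed.
Let LZ : Lall P Z. Proof. by apply: LallB; exact: LallM. Qed.
Let Lpay l : Lall P (fun w => payoff A (x^~ w) l).
Proof. by apply: Lall_sum => k; exact: LallZ. Qed.
Let Lmean : Lall P (fun w => mean_rate A sigma (x^~ w)).
Proof. by apply: Lall_sum => k; apply: LallM => //; apply: LallB => //; exact: LallZ. Qed.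
Let Lbe l : Lall P (be l).
Proof. by apply: LallB => //; apply: LallB => //; exact: LallZ. Qed.
Let Lal l : Lall P (al l). Proof. by apply: LallB => //; exact: Lall_cst. Qed.
Let LZ' : Lall P Z'.
Proof.
have Lh l : Lall P (fun w => x l w * (h * be l w + m l w - nu w)).
  by apply: LallM => //; apply: LallB => //; apply: LallD => //; exact: LallZ.
by apply: LallB; apply: LallM; rewrite //; [apply: LallD|apply: LallB|apply: LallD].
Qed.
Let Ltau : Lall P tau.
Proof.
apply: LallD; first exact: Lall_cst.
by apply: LallZ; apply: Lall_sum => l; apply: LallZ; apply: Lall_norm; exact: (Lall_increment hW l s0 (ltW st)).
Qed.
Let Lgap : Lall P gap. Proof. by apply: LallB; exact: LallM. Qed.
Let Ldelta : Lall P delta. Proof. by apply: LallD; exact: LallX. Qed.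

Let mq : measurable_wrt (F s) (fun w => 1 - p w).
Proof. by apply: measurable_wrtB => //; exact: measurable_wrt_cst. Qed.
Let mZ : measurable_wrt (F s) Z.
Proof. by apply: measurable_wrtB; exact: measurable_wrtM. Qed.
Let mdi : measurable_wrt (F s) di. Proof. exact: measurable_wrtB. Qed.
Let mdj : measurable_wrt (F s) dj. Proof. exact: measurable_wrtB. Qed.
Let mgap : measurable_wrt (F s) gap.
Proof. by apply: measurable_wrtB; exact: measurable_wrtM. Qed.

Let ind (l k : 'I_n) : R := (l == k)%:R.

Let Ex_Zlin : Ex P (fun w => Z w * lin w) = 0.
Proof.
pose c l w := sigma l * (Z w * (gap w * ((1 - p w) * ind l i + p w * ind l j - x l w) -
  p w * (1 - p w) * (di w + dj w) * (ind l i - ind l j))).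
rewrite (eq_Ex P (g := fun w => \sum_l c l w * inc s t l w)); last first.
  move=> w.
  have E k : m k w = \sum_l ind l k * m l w.
    rewrite (bigD1 k)//= /ind eqxx mul1r big1 ?addr0// => l lk.
    by rewrite (negbTE lk) mul0r.
  rewrite /lin /step_lin -/(gap w) /step_mu [m i w]E [m j w]E /nu.
  rewrite !(mulr_sumr, =^~ sumrB, =^~ big_split)/=.
  apply: eq_bigr => l _; rewrite /c /m; ring.
apply: (Ex_linear_increments hW) => //; first exact: ltW.
  move=> l; repeat first [exact: measurable_wrt_cst | apply: measurable_wrtM | apply: measurable_wrtB | apply: measurable_wrtD | assumption | exact: mx].
move=> l; repeat first [exact: Lall_cst | apply: LallM | apply: LallB | apply: LallD | assumption | exact: Lx].
Qed.

(** The coefficient of the product of the increments [l] and [r] in Z times the quadratic part. On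
    the diagonal it vanishes unless the index is [i] or [j], because of the differences of
    indicators. *)
Let qc l r w := Z w * ((- (p w * (1 - p w) * (1 - 2 * p w) / 2 * (x i w + x j w + (di w + dj w))) *
    ((ind l i - ind l j) * (ind r i - ind r j)) -
  p w * (1 - p w) * ((x i w * (ind l i - x l w) + x j w * (ind l j - x l w)) *
    (ind r i - ind r j))) * (sigma l * sigma r)).

Let Lqc l r : Lall P (qc l r).
Proof.
have Lc (c : R) : Lall P (fun=> c) by exact: Lall_cst.
have L12 : Lall P (fun w => 1 - 2 * p w) := LallB L1 (LallZ 2 Lp).
have Lpq := LallM Lp Lq.
have Lxs : Lall P (fun w => x i w + x j w + (di w + dj w)) := LallD (LallD (Lx i) (Lx j)) (LallD Ldi Ldj).
have Lg k : Lall P (fun w => x k w * (ind l k - x l w)) := LallM (Lx k) (LallB (Lc _) (Lx l)).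
have LA := LallN (LallM (LallM (LallM Lpq L12) (Lc 2^-1)) Lxs).
have LB := LallM Lpq (LallM (LallD (Lg i) (Lg j)) (Lc (ind r i - ind r j))).
exact: LallM LZ (LallM (LallB (LallM LA (Lc ((ind l i - ind l j) * (ind r i - ind r j)))) LB)
  (Lc (sigma l * sigma r))).
Qed.

Let Ex_Zquad : Ex P (fun w => Z w * quad w) = h * Ex P (fun w => qc i i w + qc j j w).
Proof.
rewrite (eq_Ex P (g := fun w => \sum_l \sum_r qc l r w * (inc s t l w * inc s t r w))); last first.
  move=> w.
  have E k : m k w = \sum_l ind l k * m l w.
    rewrite (bigD1 k)//= /ind eqxx mul1r big1 ?addr0// => l lk.
    by rewrite (negbTE lk) mul0r.
  have muE : m i w - m j w = \sum_l (ind l i - ind l j) * m l w.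
    by rewrite [m i w]E [m j w]E -sumrB; apply: eq_bigr => l _; rewrite mulrBl.
  have GE : x i w * (m i w - nu w) + x j w * (m j w - nu w) =
      \sum_l (x i w * (ind l i - x l w) + x j w * (ind l j - x l w)) * m l w.
    rewrite [m i w]E [m j w]E /nu -!sumrB !mulr_sumr -big_split/=.
    by apply: eq_bigr => l _; ring.
  rewrite /quad /step_quad /step_mu GE muE expr2 !big_distrlr/= !mulr_sumr -sumrB mulr_sumr.
  apply: eq_bigr => l _; rewrite !mulr_sumr -sumrB mulr_sumr; apply: eq_bigr => r _.
  rewrite /qc /m; ring.
rewrite (Ex_quadratic_increments hW)//.
- rewrite -/h; congr (_ * _); apply: eq_Ex => w.
  rewrite (bigD1 i)//= (bigD1 j)/=; last by rewrite eq_sym.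
  rewrite big1 ?addr0// => l /andP[/negbTE li /negbTE lj].
  by rewrite /qc /ind li lj; ring.
- move=> l r; repeat first [exact: measurable_wrt_cst | apply: measurable_wrtM | apply: measurable_wrtB | apply: measurable_wrtD | assumption | exact: mx | apply: (measurable_wrt_comp (phi := -%R)); [exact: oppr_measurable|]].
Qed.

Let cc w := (1 - p w) * payoff A (x^~ w) i + p w * payoff A (x^~ w) j - mean_rate A sigma (x^~ w) -
  sigma i ^+ 2 * ((1 - p w) * (p w + x i w)) - sigma j ^+ 2 * (p w * (1 - p w + x j w)).
Let cc' w := p w * (1 - p w) * (al i w - al j w) +
  p w * (1 - p w) * (1 - 2 * p w) / 2 * (sigma i ^+ 2 + sigma j ^+ 2).

(** With the quadratic correction added, [gap_drift_identity] turns the drift into a multiple of the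
    gap plus Euler errors, so that its product with Z is controlled by Z^2 + [delta]. *)
Let Zdrift_eq w : Z w * drift_ w + (qc i i w + qc j j w) = Z w * (gap w * cc w - (di w + dj w) * cc' w).
Proof.
have := gap_drift_identity A sigma (x^~ w) i j (p w) (di w + dj w).
rewrite /= -/(be i w) -/(be j w) -/(al i w) -/(al j w).
rewrite /gap /step_gap /cc /cc' => <-.
have ii k : ind k k = 1 by rewrite /ind eqxx.
have ij0 : ind i j = 0 by rewrite /ind (negbTE ij).
have ji0 : ind j i = 0 by rewrite /ind eq_sym (negbTE ij).
by rewrite /drift_ /step_drift /qc !ii ij0 ji0; field.
Qed.

Let cc_le w : `|cc w| <= 6 * K.
Proof.
have /andP[p0 p1] := p01 w; have /andP[xi0 xi1] := x01 i w; have /andP[xj0 xj1] := x01 j w.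
have y01 k : 0 <= x k w <= 1 by exact: x01.
have hi := payoff_bound A sigma y01 i; have hj := payoff_bound A sigma y01 j.
have hm := mean_rate_bound A sigma y01.
have si := sigma_sqr_bound A sigma i; have sj := sigma_sqr_bound A sigma j.
have mix (u v : R) : `|u| <= K -> `|v| <= K -> `|(1 - p w) * u + p w * v| <= K.
  move=> uK vK; apply: le_trans (ler_normD _ _) _; rewrite !normrM (ger0_norm p0) ger0_norm ?subr_ge0//.
  have : (1 - p w) * `|u| <= (1 - p w) * K by rewrite ler_wpM2l ?subr_ge0.
  have : p w * `|v| <= p w * K by rewrite ler_wpM2l.
  lra.
have sq_le (u a b : R) : 0 <= u -> u <= K -> 0 <= a -> a <= 1 -> 0 <= b -> b <= 2 -> `|u * (a * b)| <= 2 * K.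
  move=> u0 uK a0 a1 b0 b2; rewrite ger0_norm ?mulr_ge0// mulrC ler_pM ?mulr_ge0//.
  by rewrite -[leRHS]mul1r ler_pM.
have e1 : `|sigma i ^+ 2 * ((1 - p w) * (p w + x i w))| <= 2 * K.
  by apply: sq_le => //; rewrite ?sqr_ge0//; lra.
have e2 : `|sigma j ^+ 2 * (p w * (1 - p w + x j w))| <= 2 * K.
  by apply: sq_le => //; rewrite ?sqr_ge0//; lra.
have := mix _ _ hi hj; move: e1 e2 hm; rewrite /cc !ler_norml.
move=> /andP[? ?] /andP[? ?] /andP[? ?] /andP[? ?]; apply/andP; split; lra.
Qed.

Let cc'_le w : `|cc' w| <= 3 * K.
Proof.
have /andP[p0 p1] := p01 w.
have y01 k : 0 <= x k w <= 1 by exact: x01.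
have hi := log_rate_bound A sigma y01 i; have hj := log_rate_bound A sigma y01 j.
have si := sigma_sqr_bound A sigma i; have sj := sigma_sqr_bound A sigma j.
have pq1 : `|p w * (1 - p w)| <= 1.
  by rewrite ger0_norm ?mulr_ge0 ?subr_ge0// -[leRHS]mulr1 ler_pM// ?subr_ge0//; lra.
have p21 : `|(1 - 2 * p w) / 2| <= 2^-1 by rewrite ler_norml; apply/andP; split; lra.
apply: le_trans (ler_normD _ _) _; rewrite -[X in _ + `|X * _|]mulrA !normrM.
have -> : 3 * K = 1 * (2 * K) + 1 * 2^-1 * (2 * K) by field.
apply: lerD; first apply: ler_pM => //.
- by rewrite -normrM.
- by apply: le_trans (ler_normB _ _) _; rewrite /al; lra.
apply: ler_pM; rewrite ?mulr_ge0//.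
  by apply: ler_pM; rewrite ?mulr_ge0// -?normrM.
by rewrite ger0_norm ?addr_ge0 ?sqr_ge0//; lra.
Qed.

Let K1 : 1 <= K. Proof. exact: rate_bound_ge1. Qed.
Let delta0 w : 0 <= delta w. Proof. by rewrite addr_ge0 ?sqr_ge0. Qed.

Let ds2 w : (di w + dj w) ^+ 2 <= 2 * delta w.
Proof. by have := sqr_ge0 (di w - dj w); rewrite /delta !expr2; lra. Qed.

Let e_ w := di w * (1 - p w) - dj w * p w.
Let gapE w : gap w = Z w - e_ w.
Proof. by rewrite /gap /step_gap /Z /e_ /di /dj; ring. Qed.

Let e2 w : e_ w ^+ 2 <= 2 * delta w.
Proof.
have /andP[p0 p1] := p01 w.
have sq_le (a u : R) : 0 <= a -> a <= 1 -> (u * a) ^+ 2 <= u ^+ 2.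
  by move=> a0 a1; rewrite exprMn ler_piMr ?sqr_ge0// exprn_ile1.
have q0 : 0 <= 1 - p w by lra.
have q1 : 1 - p w <= 1 by lra.
have := sq_le _ (di w) q0 q1; have := sq_le _ (dj w) p0 p1.
have := sqr_ge0 (di w * (1 - p w) + dj w * p w).
by rewrite /e_ /delta !expr2; lra.
Qed.

Let drift_le w : Z w * (gap w * cc w - (di w + dj w) * cc' w) <= 20 * K * (Z w ^+ 2 + delta w).
Proof.
have prod_le (z u c a : R) : `|c| <= a -> z * u * c <= a * (z ^+ 2 / 2 + u ^+ 2 / 2).
  move=> ca; apply: le_trans (ler_norm _) _; rewrite normrM mulrC ler_pM//.
  have := sqr_ge0 (z - u); have := sqr_ge0 (z + u); rewrite ler_norml !expr2.
  by move=> ? ?; apply/andP; split; lra.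
have h1 := prod_le (Z w) (Z w) _ _ (cc_le w).
have ncc : `|- cc w| <= 6 * K by rewrite normrN.
have ncc' : `|- cc' w| <= 3 * K by rewrite normrN.
have h2 := prod_le (Z w) (e_ w) _ _ ncc.
have h3 := prod_le (Z w) (di w + dj w) _ _ ncc'.
have -> : Z w * (gap w * cc w - (di w + dj w) * cc' w) =
  Z w * Z w * cc w + Z w * e_ w * - cc w + Z w * (di w + dj w) * - cc' w.
  by rewrite gapE; ring.
have K0 : 0 <= K by exact: le_trans K1.
have := ler_wpM2l K0 (ds2 w); have := ler_wpM2l K0 (e2 w).
have := mulr_ge0 K0 (delta0 w); have := mulr_ge0 K0 (sqr_ge0 (Z w)).
move: h1 h2 h3; rewrite -!expr2.
have E (k u v : R) : k * K * (u / 2 + v / 2) = k / 2 * (K * u) + k / 2 * (K * v) by field.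
rewrite !E; have -> : 20 * K * (Z w ^+ 2 + delta w) = 20 * (K * Z w ^+ 2) + 20 * (K * delta w) by ring.
have E2 u : K * (2 * u) = 2 * (K * u) by ring.
rewrite !E2; move: (K * _) (K * _) (K * _) (K * _) => u v u' v'.
lra.
Qed.

Let rho w := h * tau w + tau w ^+ 3 + tau w ^+ 4.
Let rho2 w := (h + tau w ^+ 2 + tau w ^+ 4) ^+ 2.

Let tau0 w : 0 <= tau w. Proof. exact: noise_size_ge0 (ltW st). Qed.
Let rho0 w : 0 <= rho w. Proof. by rewrite !addr_ge0 ?mulr_ge0 ?exprn_ge0// ltW. Qed.

Let rem_le w : Z w * rem_ w <= 300 * K ^+ 4 * ((1 + Z w ^+ 2 + delta w) * rho w).
Proof.
have /andP[p0 p1] := p01 w; have /andP[xi0 xi1] := x01 i w; have /andP[xj0 xj1] := x01 j w.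
have y01 k : 0 <= x k w <= 1 by exact: x01.
have [[b1 b2 b3 b4] [b5 b6 b7]] := bounds w.
have hr := step_rem_bound (di w) (dj w) (ltW h0) b1 K1 xi0 xi1 xj0 xj1 p0 p1
  (growth_rate_bound A sigma y01 i) (growth_rate_bound A sigma y01 j)
  (log_rate_bound A sigma y01 i) (log_rate_bound A sigma y01 j) b5 b6 b7 (taylor w).
apply: le_trans (ler_norm _) _; rewrite normrM.
apply: le_trans (ler_wpM2l (normr_ge0 _) hr) _.
have k0 : 0 <= 300 * K ^+ 4.
  by apply: mulr_ge0; [exact: ler0n|apply: exprn_ge0; exact: le_trans K1].
rewrite -/(rho w) mulrCA; apply: ler_wpM2l k0 _ _ _.
rewrite mulrA; apply: ler_wpM2r => //.
have := ds2 w; have := sqr_ge0 (`|Z w| - 1); have := sqr_ge0 (`|Z w| - `|di w + dj w|).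
have n2 (u : R) : `|u| * `|u| = u * u by rewrite -!expr2 real_normK ?num_real.
rewrite !expr2 => h1 h2 h3; rewrite mulrDr mulr1.
have := n2 (Z w); have := n2 (di w + dj w); lra.
Qed.

Let C8 : R := 4 * 610 ^+ 2 * K ^+ 8.
Let C80 : 0 <= C8.
Proof.
rewrite /C8; move: (610 : R) => c; apply: mulr_ge0; first by rewrite mulr_ge0 ?sqr_ge0.
by apply: exprn_ge0; exact: le_trans K1.
Qed.

Let sqr_le w : (Z' w - Z w) ^+ 2 <= (72 * Z w ^+ 2 + 216 * delta w) * tau w ^+ 2 +
  (C8 + 2 * C8 * delta w) * rho2 w.
Proof.
have /andP[p0 p1] := p01 w; have /andP[xi0 xi1] := x01 i w; have /andP[xj0 xj1] := x01 j w.
have y01 k : 0 <= x k w <= 1 by exact: x01.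
have [[b1 b2 b3 b4] [b5 b6 b7]] := bounds w.
have hr := step_sqr_bound (di w) (dj w) (ltW h0) b1 K1 xi0 xi1 xj0 xj1 p0 p1
  (growth_rate_bound A sigma y01 i) (growth_rate_bound A sigma y01 j)
  (log_rate_bound A sigma y01 i) (log_rate_bound A sigma y01 j) b2 b3 b4 b5 b6 b7 (taylor w).
rewrite Z'E ZE; apply: le_trans hr _.
rewrite -/C8 -/(rho2 w) -/(gap w) -ZE mulrA; apply: lerD.
  rewrite ler_wpM2r ?sqr_ge0//.
  have := sqr_ge0 (Z w + e_ w); have := ds2 w; have := e2 w.
  by rewrite gapE !expr2; lra.
rewrite mulrA ler_wpM2r ?sqr_ge0//.
have -> : C8 + 2 * C8 * delta w = C8 * (1 + 2 * delta w) by ring.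
by rewrite ler_wpM2l// lerD2l.
Qed.

Variable C : R.
Hypothesis C0 : 0 <= C.
Hypothesis tau2 : Ex P (fun w => tau w ^+ 2) <= C * h.
Hypothesis tau34 : Ex P rho <= C * (h * Num.sqrt h).
Hypothesis tau8 : Ex P rho2 <= C * h ^+ 2.

Definition one_step_cst : R := 40 * K + 600 * K ^+ 4 * C + 216 * C + 2 * C8 * C.

(** The noise size is independent of the past, so its moments factor out of the pathwise bounds on
    the remainder and on the squared increment. Only the remainder and the second order terms
    contribute additively, at most h sqrt h up to a constant. *)
Lemma one_step_moment : Ex P (fun w => Z' w ^+ 2) <=
  Ex P (fun w => Z w ^+ 2) +
  one_step_cst * (h * (Ex P (fun w => Z w ^+ 2) + Ex P delta + Num.sqrt h)).
Proof.
have LZ2 := LallX 2 LZ.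
have Llin : Lall P lin by exact: Lall_step_lin.
have Ldr : Lall P drift_ by exact: Lall_step_drift.
have Lquad : Lall P quad by exact: Lall_step_quad.
have Lrem : Lall P rem_.
  have -> : rem_ = fun w => Z' w - Z w - lin w - h * drift_ w - quad w.
    by apply/funext => w; rewrite Z'Z; ring.
  exact: LallB (LallB (LallB (LallB LZ' LZ) Llin) (LallZ h Ldr)) Lquad.
have Lqc2 : Lall P (fun w => qc i i w + qc j j w) := LallD (Lqc i i) (Lqc j j).
have Lt n' := LallX n' Ltau.
have Lrho : Lall P rho := LallD (LallD (LallZ h Ltau) (Lt 3%N)) (Lt 4%N).
have Lrho2 : Lall P rho2 := LallX 2 (LallD (LallD (Lall_cst P h) (Lt 2%N)) (Lt 4%N)).
have mtau : measurable_wrt (sigma_increments W s t) tau by exact: noise_size_wrt.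
have mX k : measurable_wrt (sigma_increments W s t) (fun w => tau w ^+ k).
  by apply: (measurable_wrt_comp (phi := fun y => y ^+ k)) => //; exact: exprn_measurable.
have mrho : measurable_wrt (sigma_increments W s t) rho.
  apply: measurable_wrtD => //; apply: measurable_wrtD => //; apply: measurable_wrtM => //.
  exact: measurable_wrt_cst.
have mrho2 : measurable_wrt (sigma_increments W s t) rho2.
  apply: (measurable_wrt_comp (phi := fun y => y ^+ 2)); first exact: exprn_measurable.
  by apply: measurable_wrtD => //; apply: measurable_wrtD => //; exact: measurable_wrt_cst.
have mZ2 : measurable_wrt (F s) (fun w => Z w ^+ 2).
  by apply: (measurable_wrt_comp (phi := fun y => y ^+ 2)) => //; exact: exprn_measurable.
have mdl : measurable_wrt (F s) delta.
  by apply: measurable_wrtD; apply: (measurable_wrt_comp (phi := fun y => y ^+ 2)) => //; exact: exprn_measurable.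
set z := Ex P (fun w => Z w ^+ 2); set D := Ex P delta.
have z0 : 0 <= z by apply: Ex_ge0 => w; exact: sqr_ge0.
have D0 : 0 <= D by exact: Ex_ge0.
have b1 : Ex P (fun w => Z w * drift_ w + (qc i i w + qc j j w)) <= 20 * K * (z + D).
  apply: (@le_trans _ _ (Ex P (fun w => 20 * K * (Z w ^+ 2 + delta w)))).
    apply: Ex_le (LallD (LallM LZ Ldr) Lqc2) (LallZ _ (LallD LZ2 Ldelta)) _ => w.
    by rewrite Zdrift_eq.
  by rewrite (ExZ _ (LallD LZ2 Ldelta)) (ExD LZ2 Ldelta).
have b2 : Ex P (fun w => Z w * rem_ w) <= 300 * K ^+ 4 * ((1 + z + D) * Ex P rho).
  apply: (@le_trans _ _ (Ex P (fun w => 300 * K ^+ 4 * ((1 + Z w ^+ 2 + delta w) * rho w)))).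
    exact: Ex_le (LallM LZ Lrem) (LallZ _ (LallM (LallD (LallD L1 LZ2) Ldelta) Lrho)) _.
  have LS := LallD (LallD L1 LZ2) Ldelta.
  rewrite (ExZ _ (LallM LS Lrho)).
  rewrite (Ex_filtration_indep hW s0 st _ mrho LS Lrho); last first.
    by apply: measurable_wrtD => //; apply: measurable_wrtD => //; exact: measurable_wrt_cst.
  by rewrite (ExD (LallD L1 LZ2) Ldelta) (ExD L1 LZ2) Ex_cst.
have b3 : Ex P (fun w => (Z' w - Z w) ^+ 2) <=
    (72 * z + 216 * D) * Ex P (fun w => tau w ^+ 2) + (C8 + 2 * C8 * D) * Ex P rho2.
  have LS1 := LallD (LallZ 72 LZ2) (LallZ 216 Ldelta).
  have LS2 := LallD (Lall_cst P C8) (LallZ (2 * C8) Ldelta).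
  have Lt2 := LallX 2 Ltau.
  apply: (@le_trans _ _ (Ex P (fun w => (72 * Z w ^+ 2 + 216 * delta w) * tau w ^+ 2 +
    (C8 + 2 * C8 * delta w) * rho2 w))).
    exact: Ex_le (LallX 2 (LallB LZ' LZ)) (LallD (LallM LS1 Lt2) (LallM LS2 Lrho2)) _.
  rewrite (ExD (LallM LS1 Lt2) (LallM LS2 Lrho2)).
  rewrite (Ex_filtration_indep hW s0 st _ (mX 2%N) LS1 Lt2); last first.
    by apply: measurable_wrtD; apply: measurable_wrtM => //; exact: measurable_wrt_cst.
  rewrite (Ex_filtration_indep hW s0 st _ mrho2 LS2 Lrho2); last first.
    apply: measurable_wrtD; first exact: measurable_wrt_cst.
    by apply: measurable_wrtM => //; exact: measurable_wrt_cst.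
  by rewrite (ExD (LallZ _ LZ2) (LallZ _ Ldelta)) !(ExZ _ LZ2, ExZ _ Ldelta) (ExD (Lall_cst P _) (LallZ _ Ldelta)) Ex_cst (ExZ _ Ldelta).
rewrite (second_moment_expansion LZ LZ' Llin Ldr Lquad Lqc2 Z'Z Ex_Zlin Ex_Zquad).
have r0 : 0 <= Num.sqrt h by exact: sqrtr_ge0.
have r1 : Num.sqrt h <= 1 by rewrite -sqrtr1 ler_sqrt.
have r2 : Num.sqrt h ^+ 2 = h by rewrite sqr_sqrtr// ltW.
have hr : h <= Num.sqrt h by rewrite -{1}r2 expr2 ler_piMl.
apply: le_trans (lerD (lerD (lexx _) (ler_wpM2l _ (lerD (ler_wpM2l (ltW h0) b1) b2))) b3) _ => //.
have K40 : 0 <= K ^+ 4 by apply: exprn_ge0; exact: le_trans K1.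
set r := Num.sqrt h in r0 r1 r2 hr *.
have tau34' : Ex P rho <= C * (h * r) by exact: tau34.
set S := h * (z + D + r).
have h0' := ltW h0.
have S0 : 0 <= S by rewrite mulr_ge0// !addr_ge0.
have K0 : 0 <= K by exact: le_trans K1.
have T1 : 2 * (h * (20 * K * (z + D))) <= 40 * K * S.
  have -> : 2 * (h * (20 * K * (z + D))) = 40 * K * (h * (z + D)) by ring.
  by apply: ler_wpM2l; [exact: mulr_ge0|rewrite /S ler_wpM2l// lerDl].
have T2 : 2 * (300 * K ^+ 4 * ((1 + z + D) * Ex P rho)) <= 600 * K ^+ 4 * C * S.
  have u0 : 0 <= 1 + z + D by rewrite !addr_ge0.
  have v : (1 + z + D) * Ex P rho <= C * S.
    apply: le_trans (ler_wpM2l u0 tau34') _.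
    rewrite mulrCA ler_wpM2l// /S mulrCA ler_wpM2l// mulrDl mulrDl mul1r.
    have : z * r <= z by rewrite ler_piMr.
    have : D * r <= D by rewrite ler_piMr.
    lra.
  have := ler_wpM2l K40 v; move: (_ * Ex P rho) => y.
  have -> : 600 * K ^+ 4 * C * S = 600 * (K ^+ 4 * (C * S)) by ring.
  have -> : 2 * (300 * K ^+ 4 * y) = 600 * (K ^+ 4 * y) by ring.
  by apply: ler_wpM2l; exact: ler0n.
have T3 : (72 * z + 216 * D) * Ex P (fun w => tau w ^+ 2) <= 216 * C * S.
  have u0 : 0 <= 72 * z + 216 * D.
    by apply: addr_ge0; apply: mulr_ge0; rewrite ?ler0n.
  apply: le_trans (ler_wpM2l u0 tau2) _.
  have -> : (72 * z + 216 * D) * (C * h) = C * h * (72 * z + 216 * D) by ring.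
  have -> : 216 * C * S = C * h * (216 * (z + D + r)) by rewrite /S; ring.
  apply: ler_wpM2l; first exact: mulr_ge0.
  by have := r0; have := z0; lra.
have T4 : (C8 + 2 * C8 * D) * Ex P rho2 <= 2 * C8 * C * S.
  have u0 := addr_ge0 C80 (mulr_ge0 (mulr_ge0 (ler0n R 2) C80) D0).
  apply: le_trans (ler_wpM2l u0 tau8) _.
  have -> : (C8 + 2 * C8 * D) * (C * h ^+ 2) = C8 * C * h * (h + 2 * (h * D)) by ring.
  have -> : 2 * C8 * C * S = C8 * C * h * (2 * (z + D + r)) by rewrite /S; ring.
  apply: ler_wpM2l; first exact: mulr_ge0 (mulr_ge0 C80 C0) h0'.
  have : h * D <= D by rewrite ler_piMl.
  by have := z0; have := r0; lra.
have -> : one_step_cst * S = 40 * K * S + 600 * K ^+ 4 * C * S + 216 * C * S + 2 * C8 * C * S.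
  by rewrite /one_step_cst; move: C8 (K ^+ 4) => *; ring.
rewrite -/z [2 * (h * _ + _)]mulrDr; move: T1 T2 T3 T4.
move: (2 * (h * _)) (2 * (300 * _ * _)) ((72 * z + _) * _) ((C8 + _) * _) => t1 t2 t3 t4.
move: (40 * _ * S) (600 * _ * _ * S) (216 * _ * _) (2 * _ * _ * S) => *.
lra.
Qed.

End one_step_expectation.

(** * The Euler sums and the discrete Gronwall argument *)

Section euler_scheme.
Context {d : measure_display} {T : measurableType d} {R : realType}.
Variables (P : probability T R) (n : nat) (W : R -> T -> 'cV[R]_n).
Hypothesis hW : standard_brownian_motion P W.
Variables (A : 'M[R]_n) (sigma : 'I_n -> R) (t : R) (N : nat).
Hypothesis t0 : 0 < t.
Local Notation F := (brownian_filtration P W).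
Local Notation h := (mesh t N).
Local Notation gr := (grid t N).

Variables (x : nat -> 'I_n -> T -> R) (x0 : 'I_n -> R).
Hypotheses (x01 : forall k l w, 0 <= x k l w <= 1).
Hypotheses (mx : forall k l, measurable_wrt (F (gr k)) (x k l)).

Definition noise k l w := sigma l * increment W (gr k) (gr k.+1) l w.
(** The coefficients are evaluated at the sampled process [x] and not at the scheme, so [euler] is a
    sum of Riemann and Ito sums, and its convergence involves no stability estimate for the
    equation. *)
Definition euler_step k l w :=
  x k l w * (h * growth_rate A sigma (x k ^~ w) l + noise k l w - \sum_r x k r w * noise k r w).
Definition euler k l w := x0 l + \sum_(r < k) euler_step r l w.

Variables i j : 'I_n.
Hypothesis ij : i != j.

Definition log_step k w := step_del h (noise k i w) (noise k j w)
  (log_rate A sigma (x k ^~ w) i) (log_rate A sigma (x k ^~ w) j).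
Definition log_ratio k w := ln (x0 i / x0 j) + \sum_(r < k) log_step r w.
Definition euler_gap k w :=
  euler k i w * (1 - logistic (log_ratio k w)) - euler k j w * logistic (log_ratio k w).

Lemma eulerS k l w : euler k.+1 l w = euler k l w + euler_step k l w.
Proof. by rewrite /euler big_ord_recr addrA. Qed.

Lemma log_ratioS k w : log_ratio k.+1 w = log_ratio k w + log_step k w.
Proof. by rewrite /log_ratio big_ord_recr addrA. Qed.

Let gr0 k : 0 <= gr k. Proof. exact/grid_ge0/ltW. Qed.
Let grS k : gr k < gr k.+1. Proof. by rewrite gridS ltrDl mesh_gt0. Qed.
Let FS k : F (gr k) `<=` F (gr k.+1). Proof. by apply: filtration_sub; exact: ltW (grS k). Qed.

Let noise_wrt k l : measurable_wrt (F (gr k.+1)) (noise k l).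
Proof.
apply: measurable_wrtM; first exact: measurable_wrt_cst.
by apply: measurable_wrtB; apply: bm_adapted; rewrite ?gr0 ?lexx ?(ltW (grS k)).
Qed.

Let x_wrt k l : measurable_wrt (F (gr k.+1)) (x k l).
Proof. exact: measurable_wrt_sub (@FS k) (@mx k l). Qed.

Let payoff_wrt k l : measurable_wrt (F (gr k.+1)) (fun w => payoff A (x k ^~ w) l).
Proof.
by apply: measurable_wrt_sum => r; apply: measurable_wrtM; [exact: measurable_wrt_cst|exact: x_wrt].
Qed.

Let growth_wrt k l : measurable_wrt (F (gr k.+1)) (fun w => growth_rate A sigma (x k ^~ w) l).
Proof.
have sx r : measurable_wrt (F (gr k.+1)) (fun w => sigma r ^+ 2 * x k r w).
  by apply: measurable_wrtM; [exact: measurable_wrt_cst|exact: x_wrt].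
have px r := measurable_wrtB (@payoff_wrt k r) (sx r).
apply: measurable_wrtB; first exact: px.
by apply: measurable_wrt_sum => r; apply: measurable_wrtM; [exact: x_wrt|exact: px].
Qed.

Let log_rate_wrt k l : measurable_wrt (F (gr k.+1)) (fun w => log_rate A sigma (x k ^~ w) l).
Proof. by apply: measurable_wrtB; [exact: payoff_wrt|exact: measurable_wrt_cst]. Qed.

Lemma euler_step_wrt k l : measurable_wrt (F (gr k.+1)) (euler_step k l).
Proof.
apply: measurable_wrtM; first exact: x_wrt.
apply: measurable_wrtB.
  apply: measurable_wrtD; last exact: noise_wrt.
  by apply: measurable_wrtM; [exact: measurable_wrt_cst|exact: growth_wrt].
by apply: measurable_wrt_sum => r; apply: measurable_wrtM; [exact: x_wrt|exact: noise_wrt].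
Qed.

Lemma euler_wrt k l : measurable_wrt (F (gr k)) (euler k l).
Proof.
apply: measurable_wrtD; first exact: measurable_wrt_cst.
apply: measurable_wrt_sum => r; apply: measurable_wrt_sub (@euler_step_wrt r l).
by apply: filtration_sub; exact: grid_mono (ltW t0) (ltn_ord r).
Qed.

Lemma log_ratio_wrt k : measurable_wrt (F (gr k)) (log_ratio k).
Proof.
apply: measurable_wrtD; first exact: measurable_wrt_cst.
apply: measurable_wrt_sum => r.
have : F (gr r.+1) `<=` F (gr k) by apply: filtration_sub; exact: grid_mono (ltW t0) (ltn_ord r).
move/measurable_wrt_sub; apply; apply: measurable_wrtD.
  apply: measurable_wrtM; first exact: measurable_wrt_cst.
  by apply: measurable_wrtB; exact: log_rate_wrt.
by apply: measurable_wrtB; exact: noise_wrt.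
Qed.

Lemma Lall_grid k l : Lall P (x k l).
Proof.
have mx' := measurable_wrt_fun (filtration_measurable hW (t := gr k)) (@mx k l).
apply: (Lall_bounded P (M := 1) mx') => w.
by have /andP[a b] := x01 k l w; rewrite ger0_norm.
Qed.

Lemma Lall_noise k l : Lall P (noise k l).
Proof. exact/LallZ/(Lall_increment hW l (gr0 k) (ltW (grS k))). Qed.

Lemma Lall_euler_step k l : Lall P (euler_step k l).
Proof.
have Lx := Lall_grid k.
have Lg : Lall P (fun w => growth_rate A sigma (x k ^~ w) l).
  have mg := measurable_wrt_fun (filtration_measurable hW (t := gr k.+1)) (@growth_wrt k l).
  apply: (Lall_bounded P (M := rate_bound A sigma) mg) => w.
  by apply: growth_rate_bound => r; exact: x01.
apply: (LallM (Lx l)); apply: LallB.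
  exact: LallD (LallZ h Lg) (Lall_noise k l).
by apply: Lall_sum => r; exact: LallM (Lx r) (Lall_noise k r).
Qed.

Lemma Lall_euler k l : Lall P (euler k l).
Proof.
apply: (LallD (Lall_cst P (x0 l))); apply: Lall_sum => r; exact: Lall_euler_step.
Qed.

Hypotheses (x0i : 0 < x0 i) (x0j : 0 < x0 j).
Hypothesis h1 : h <= 1.

Lemma euler_gap0 w : euler_gap 0 w = 0.
Proof.
rewrite /euler_gap /euler /log_ratio !big_ord0 !addr0 /logistic lnK ?posrE ?divr_gt0//.
by field; rewrite !gt_eqF ?addr_gt0.
Qed.

Variables (C eps : R).
Hypothesis C0 : 0 <= C.
Hypothesis hC : forall s t, 0 <= s -> s < t -> t - s <= 1 ->
  let h := t - s in let tau := noise_size W sigma s t in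
  [/\ Ex P (fun w => tau w ^+ 2) <= C * h,
      Ex P (fun w => h * tau w + tau w ^+ 3 + tau w ^+ 4) <= C * (h * Num.sqrt h) &
      Ex P (fun w => (h + tau w ^+ 2 + tau w ^+ 4) ^+ 2) <= C * h ^+ 2].
Hypothesis heps : forall k, (k <= N)%N ->
  Ex P (fun w => (euler k i w - x k i w) ^+ 2 + (euler k j w - x k j w) ^+ 2) <= eps.

Lemma euler_gap_step k : Ex P (fun w => euler_gap k.+1 w ^+ 2) <=
  Ex P (fun w => euler_gap k w ^+ 2) + one_step_cst A sigma C * (h * (Ex P (fun w => euler_gap k w ^+ 2) +
   Ex P (fun w => (euler k i w - x k i w) ^+ 2 + (euler k j w - x k j w) ^+ 2) + Num.sqrt h)).
Proof.
have hE : gr k.+1 - gr k = h by rewrite gridS addrAC subrr add0r.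
have hle : gr k.+1 - gr k <= 1 by rewrite hE.
have [c1 c2 c3] := hC (gr0 k) (grS k) hle.
have lg01 (L : R) : 0 <= logistic L <= 1 by rewrite logistic_ge0 logistic_le1.
have mlg m : measurable_wrt (F (gr m)) (fun w => logistic (log_ratio m w)).
  by apply: measurable_wrt_comp; [exact: measurable_logistic|exact: log_ratio_wrt].
have mlg' := measurable_wrt_fun (filtration_measurable hW (t := gr k.+1)) (mlg k.+1).
have key := one_step_moment hW ij (gr0 k) (grS k) hle (x01 k)
  (fun w => lg01 (log_ratio k w)) (fun w => lg01 (log_ratio k.+1 w)) (@mx k) (mlg k)
  (@euler_wrt k i) (@euler_wrt k j) (Lall_euler k i) (Lall_euler k j) mlg' _ C0 c1 c2 c3.
rewrite hE in key; apply: le_trans _ (key A _).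
  rewrite le_eqVlt; apply/orP; left; apply/eqP; apply: eq_Ex => w.
  by rewrite /euler_gap !eulerS.
by move=> w; rewrite log_ratioS; exact: logistic_taylor.
Qed.

(** With eta = eps + sqrt h, the one-step bound gives u_k + eta <= (1 + c h)^k eta by induction from
    u_0 = 0, the logistic of ln(x0_i / x0_j) being x0_i / (x0_i + x0_j). Finally (1 + c h)^(N+1) <=
    exp(c t), because (N + 1) h = t. *)
Lemma euler_gap_bound :
  Ex P (fun w => euler_gap N.+1 w ^+ 2) <= (eps + Num.sqrt h) * expR (one_step_cst A sigma C * t).
Proof.
set c := one_step_cst A sigma C.
have K1 := rate_bound_ge1 A sigma.
have c0 : 0 <= c.
  have K0 m : 0 <= rate_bound A sigma ^+ m by apply: exprn_ge0; exact: le_trans K1.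
  have n0 m : 0 <= m%:R :> R by exact: ler0n.
  have M := @mulr_ge0 R; have K01 := le_trans ler01 K1.
  rewrite /c /one_step_cst; cbv zeta; move: (610 : R) => b.
  exact: addr_ge0 (addr_ge0 (addr_ge0 (M _ _ (n0 40) K01) (M _ _ (M _ _ (n0 600) (K0 4%N)) C0))
    (M _ _ (n0 216) C0)) (M _ _ (M _ _ (n0 2) (M _ _ (M _ _ (n0 4) (sqr_ge0 b)) (K0 8%N))) C0).
have step k := @euler_gap_step k; rewrite -/c in step; clearbody c.
have h0 : 0 <= h by exact/ltW/mesh_gt0.
have r0 := sqrtr_ge0 h.
set u := fun k => Ex P (fun w => euler_gap k w ^+ 2).
have u0 : u 0%N = 0.
  rewrite /u (eq_Ex P (g := fun=> 0)) ?Ex_cst// => w.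
  by rewrite euler_gap0 expr0n.
pose eta := eps + Num.sqrt h.
have e0 : 0 <= eps.
  by apply: le_trans (heps (leq0n N)); apply: Ex_ge0 => w; rewrite addr_ge0 ?sqr_ge0.
have eta0 : 0 <= eta by rewrite addr_ge0.
have grow k : (k <= N.+1)%N -> u k + eta <= (1 + c * h) ^+ k * eta.
  elim: k => [|k IH kN]; first by rewrite u0 add0r expr0 mul1r.
  have {}IH := IH (ltnW kN).
  have s1 : u k.+1 <= u k + c * (h * (u k + eta)).
    apply: le_trans (step k) _; rewrite lerD2l ler_wpM2l// ler_wpM2l//.
    by rewrite -addrA lerD2l lerD2r; exact: heps.
  apply: (@le_trans _ _ ((1 + c * h) * (u k + eta))).
    rewrite mulrDl mul1r -mulrA.
    by move: s1; rewrite -(lerD2r eta) [u k + _ + _]addrAC.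
  rewrite exprS -mulrA ler_wpM2l// addr_ge0// mulr_ge0//.
have := grow _ (leqnn _); rewrite -/(u N.+1) => hN.
apply: (@le_trans _ _ (u N.+1 + eta)); first by rewrite lerDl.
apply: le_trans hN _; rewrite mulrC ler_wpM2l//.
apply: (@le_trans _ _ (expR (c * h) ^+ N.+1)).
  have ch0 : 0 <= 1 + c * h by rewrite addr_ge0// mulr_ge0.
  by apply: lerXn2r; [exact: ch0|exact: expR_ge0|exact: expR_ge1Dx].
rewrite -expRM_natl; suff -> : N.+1%:R * (c * h) = c * t by [].
by rewrite mulrCA -/(grid t N N.+1) grid_last.
Qed.

End euler_scheme.

(** * Entries and continuity of the coefficients of the equation *)

Section coefficients_entries.
Context {R : realType} {n : nat}.
Implicit Types (A : 'M[R]_n) (sigma : 'I_n -> R) (y : 'cV[R]_n).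

Lemma replicator_mx_mul y (v : 'cV[R]_n) l :
  (replicator_mx y *m v) l 0 = y l 0 * (v l 0 - \sum_k y k 0 * v k 0).
Proof.
rewrite /replicator_mx mulmxBl mul_diag_mx -mulmxA !mxE big_ord1 !mxE mulrBr.
by congr (_ - _ * _); apply: eq_bigr => k _; rewrite mxE.
Qed.

Lemma drift_entry A sigma y l :
  drift A sigma y l 0 = y l 0 * growth_rate A sigma (fun k => y k 0) l.
Proof.
rewrite /drift -mulmxA replicator_mx_mul.
have E k : ((A - diag_mx (\row_i (sigma i ^+ 2))) *m y) k 0 =
    payoff A (fun k => y k 0) k - sigma k ^+ 2 * y k 0.
  by rewrite mulmxBl mul_diag_mx !mxE.
by rewrite E; under eq_bigr do rewrite E.
Qed.

Lemma diffusion_entry sigma y l k :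
  diffusion sigma y l k = y l 0 * ((l == k)%:R - y k 0) * sigma k.
Proof.
rewrite /diffusion mul_mx_diag /replicator_mx !mxE big_ord1 !mxE; case: eqP => [->|_].
  by rewrite mulr1n mulrBr mulr1.
by rewrite mulr0n !sub0r mulrN.
Qed.

End coefficients_entries.

Section continuous_rates.
Context {R : realType} {n : nat} {U : topologicalType}.
Variables (A : 'M[R]_n) (sigma : 'I_n -> R) (y : U -> 'I_n -> R).
Hypothesis cy : forall l, continuous (fun r => y r l).

Lemma continuous_sum (I : Type) (s : seq I) (f : I -> U -> R) :
  (forall k, continuous (f k)) -> continuous (fun r => \sum_(k <- s) f k r).
Proof.
move=> cf; elim: s => [|k s IH].
  by under eq_fun do rewrite big_nil; exact: cst_continuous.
under eq_fun do rewrite big_cons.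
by move=> r; apply: cvgD; [exact: cf|exact: IH].
Qed.

Lemma continuous_payoff l : continuous (fun r => payoff A (y r) l).
Proof.
apply: continuous_sum => k r; apply: cvgM; [exact: cvg_cst|exact: cy].
Qed.

Lemma continuous_log_rate l : continuous (fun r => log_rate A sigma (y r) l).
Proof. by move=> r; apply: cvgB; [exact: continuous_payoff|exact: cvg_cst]. Qed.

Lemma continuous_growth_rate l : continuous (fun r => growth_rate A sigma (y r) l).
Proof.
have cp k : continuous (fun r => payoff A (y r) k - sigma k ^+ 2 * y r k).
  move=> r; apply: cvgB; first exact: continuous_payoff.
  by apply: cvgM; [exact: cvg_cst|exact: cy].
move=> r; apply: cvgB; first exact: cp.
apply: continuous_sum => k {}r; apply: cvgM; [exact: cy|exact: cp].
Qed.

End continuous_rates.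

(** * Truncation to the unit interval, and the square of a sum *)

Section clamp.
Context {R : realType}.
Implicit Types y : R.

(** The process lies in the simplex only almost surely; truncation gives bounds at every outcome and
    preserves adaptedness. *)
Definition clamp y := Num.max 0 (Num.min 1 y).

Lemma clamp01 y : 0 <= clamp y <= 1.
Proof. by rewrite /clamp le_max lexx/= ge_max ler01 ge_min lexx. Qed.

Lemma clamp_id y : 0 <= y <= 1 -> clamp y = y.
Proof. by move=> /andP[y0 y1]; rewrite /clamp min_r// max_r. Qed.

Lemma measurable_clamp : measurable_fun setT clamp.
Proof.
have m1 := measurable_minr (measurable_cst (1 : R)) (@measurable_id _ R setT).
by have := measurable_maxr (measurable_cst (0 : R)) m1; apply.
Qed.

End clamp.

Section sqr_sum.
Context {R : realFieldType}.

Lemma sqr_sum_le (I : Type) (s : seq I) (a : I -> R) :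
  (\sum_(k <- s) a k) ^+ 2 <= 2 ^+ size s * \sum_(k <- s) a k ^+ 2.
Proof.
elim: s => [|k s IH]; first by rewrite !big_nil expr0n mulr0.
have sq_le (x y : R) : (x + y) ^+ 2 <= 2 * x ^+ 2 + 2 * y ^+ 2.
  by have := sqr_ge0 (x - y); rewrite !expr2; lra.
have E : 2 ^+ (size s).+1 = 2 * 2 ^+ size s :> R by rewrite exprS.
rewrite !big_cons /= E; apply: le_trans (sq_le _ _) _; rewrite -mulrA -mulrDr ler_wpM2l//.
by rewrite mulrDr lerD// ler_peMl ?sqr_ge0// exprn_ege1// ler1n.
Qed.

End sqr_sum.

(** * Mean square convergence of the Euler sums to the process *)

Section replicator_scheme.
Context {d : measure_display} {T : measurableType d} {R : realType}.
Variables (P : probability T R) (n : nat) (W : R -> T -> 'cV[R]_n).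
Hypothesis hW : standard_brownian_motion P W.
Variables (A : 'M[R]_n) (sigma : 'I_n -> R) (x0 : 'cV[R]_n).
Variables (X : R -> T -> 'cV[R]_n) (I : 'I_n -> 'I_n -> R -> T -> R).
Local Notation F := (brownian_filtration P W).
Local Notation mu := (@lebesgue_measure R).

(** Collects the almost sure properties of the solution, so that pathwise arguments can be carried
    out for one fixed outcome. *)
Definition replicator_path w := [/\ forall l, {within `[0, +oo[, continuous (fun t => X t w l 0)},
  forall t, 0 <= t -> simplex (X t w), X 0 w = x0 &
  forall t, 0 <= t -> forall l, X t w l 0 = x0 l 0 +
    Rintegral mu `[0, t] (fun s => drift A sigma (X s w) l 0) + \sum_j I l j t w].

Hypothesis hXa : forall l, adapted F (fun t w => X t w l 0).
Hypothesis hI : forall l j, ito_integral P F (fun t w => W t w j 0)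
  (fun t w => diffusion sigma (X t w) l j) (I l j).
Hypothesis hX : {ae P, forall w, replicator_path w}.

Definition clamped (r : R) l w := clamp (X r w l 0).

Lemma clamped01 r l w : 0 <= clamped r l w <= 1. Proof. exact: clamp01. Qed.

Lemma clamped_wrt r l : 0 <= r -> measurable_wrt (F r) (clamped r l).
Proof. by move=> r0; apply: measurable_wrt_comp; [exact: measurable_clamp|exact: hXa]. Qed.

Lemma replicator_path01 w r l : replicator_path w -> 0 <= r -> 0 <= X r w l 0 <= 1.
Proof. by move=> [_ h _ _] r0; have [] := h r r0. Qed.

Lemma clampedE w r l : replicator_path w -> 0 <= r -> clamped r l w = X r w l 0.
Proof. by move=> hw r0; apply/clamp_id/replicator_path01. Qed.

Let b l w r := X r w l 0 * growth_rate A sigma (fun k => X r w k 0) l.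
Let Hc l j r w := clamped r l w * ((l == j)%:R - clamped r j w) * sigma j.
Let x t N k l w := clamped (grid t N k) l w.

Let continuous_b l w : replicator_path w -> {within `[0, +oo[, continuous (b l w)}.
Proof.
move=> [cX _ _ _] r; apply: cvgM; first exact: cX.
by have := @continuous_growth_rate R n _ A sigma (fun (r : subspace (`[0, +oo[%classic : set R)) k => X r w k 0) cX l r; apply.
Qed.

Let b_bound l w r : replicator_path w -> 0 <= r -> `|b l w r| <= rate_bound A sigma.
Proof.
move=> hw r0; have /andP[X0 X1] := replicator_path01 l hw r0.
rewrite normrM -[leRHS]mul1r; apply: ler_pM => //; first by rewrite ger0_norm.
by apply: growth_rate_bound => k; exact: replicator_path01.
Qed.

Let Hc_wrt l j r : 0 <= r -> measurable_wrt (F r) (Hc l j r).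
Proof.
move=> r0; apply: measurable_wrtM; last exact: measurable_wrt_cst.
apply: measurable_wrtM; first exact: clamped_wrt.
by apply: measurable_wrtB; [exact: measurable_wrt_cst|exact: clamped_wrt].
Qed.

Let Hc_bound l j r w : `|Hc l j r w| <= `|sigma j|.
Proof.
rewrite normrM ler_piMl// normrM; have /andP[a0 a1] := clamped01 r l w.
have /andP[c0 c1] := clamped01 r j w.
rewrite -[leRHS]mul1r; apply: ler_pM => //; first by rewrite ger0_norm.
by rewrite ler_norml; case: (l == j); rewrite ?mulr1n ?mulr0n; apply/andP; split; lra.
Qed.

Let eulerE t N k l w : euler W A sigma t N (x t N) (fun l => x0 l 0) k l w =
  x0 l 0 + \sum_(r < k) (x t N r l w * growth_rate A sigma (x t N r ^~ w) l) * mesh t N +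
  \sum_j \sum_(r < k) Hc l j (grid t N r) w * increment W (grid t N r) (grid t N r.+1) j w.
Proof.
rewrite /euler -addrA; congr (_ + _); rewrite exchange_big/= -big_split/=.
apply: eq_bigr => r _; rewrite /euler_step.
have nE : noise W sigma t N r l w = \sum_j (l == j)%:R * noise W sigma t N r j w.
  rewrite (bigD1 l)//= eqxx mul1r big1 ?addr0// => j jl.
  by rewrite eq_sym (negbTE jl) mul0r.
rewrite nE -addrA -sumrB mulrDr mulr_sumr; congr (_ + _); first by ring.
by apply: eq_bigr => j _; rewrite /Hc /noise -/(x t N r l w) -/(x t N r j w); ring.
Qed.

(** What is left of the Euler error once each Ito integral has been compared with its sum. Where the
    integral equation holds, this is the error of the Riemann sum of the drift. *)
Let D t N k l w := clamped (grid t N k) l w - euler W A sigma t N (x t N) (fun l => x0 l 0) k l w -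
  \sum_j (I l j (grid t N k) w -
    \sum_(r < k) Hc l j (grid t N r) w * increment W (grid t N r) (grid t N r.+1) j w).

Let D_bound t N k l w : 0 < t -> (k <= N.+1)%N -> replicator_path w ->
  `|D t N k l w| <= grid_L1 t (b l w) N.
Proof.
move=> t0 kN hw; have g0 m := grid_ge0 N m (ltW t0).
rewrite /D eulerE clampedE//; have [_ _ _ ->//] := hw.
have -> : Rintegral mu `[0, grid t N k] (fun s => drift A sigma (X s w) l 0) =
    Rintegral mu `[0, grid t N k] (b l w).
  by congr (Rintegral mu _ _); apply/funext => s; rewrite drift_entry.
rewrite sumrB; set S1 := \sum_j _ ; set S2 := \sum_j _.
set B := \sum_(r < k) _; have -> : B = \sum_(r < k) b l w (grid t N r) * mesh t N.
  apply: eq_bigr => r _; rewrite /b /x clampedE//; congr (_ * _ * _).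
  by congr growth_rate; apply/funext => m; rewrite clampedE.
apply: le_trans (riemann_error t0 (continuous_b (l := l) hw) (fun r => @b_bound l w r hw) kN).
rewrite le_eqVlt; apply/orP; left; apply/eqP; rewrite -[RHS]normrN; congr (`|_|).
by move: S1 S2 (Rintegral _ _ _) (\sum_(r < k) _) => *; ring.
Qed.

Let D_measurable t N k l : 0 < t -> measurable_fun setT (D t N k l).
Proof.
move=> t0; have g0 m := grid_ge0 N m (ltW t0).
have mF r := filtration_measurable hW (t := r).
apply: measurable_funB; last first.
  apply: measurable_sum => j; apply: measurable_funB.
    by have [_ _ _ _ /(_ _ (g0 k)) [+ _]] := hI l j.
  apply: measurable_sum => r; apply: measurable_funM; last by have := increment_measurable hW j (g0 r) (g0 r.+1); apply.
  exact: measurable_wrt_fun (mF _) (@Hc_wrt l j _ (g0 r)).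
apply: measurable_funB; first exact: measurable_wrt_fun (mF _) (@clamped_wrt _ l (g0 k)).
have mx m l' : measurable_wrt (F (grid t N m)) (x t N m l') by exact: clamped_wrt.
exact: measurable_wrt_fun (mF _) (@euler_wrt d T R P n W A sigma t N t0 (x t N) (fun l => x0 l 0) mx k l).
Qed.

(** Dominated convergence, from the pathwise bound by [grid_L1]. The grid index is allowed to vary
    with [N], so that the worst one can be taken later. *)
Let D_cvg t l (kk : nat -> nat) : 0 < t -> (forall N, (kk N <= N.+1)%N) ->
  (fun N => \int[P]_w ((D t N (kk N) l w) ^+ 2)%:E)%E @ \oo --> 0%E.
Proof.
move=> t0 kkN; set B := 2 * rate_bound A sigma * t.
have dae : {ae P, forall w, forall N, `|D t N (kk N) l w| <= B /\
    (fun N => D t N (kk N) l w) @ \oo --> (0 : R)}.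
  apply: filterS hX => w hw N.
  have bb s : 0 <= s -> `|b l w s| <= rate_bound A sigma by exact: b_bound.
  split.
    apply: le_trans (D_bound l t0 (kkN N) hw) _.
    exact: grid_L1_le t0 (continuous_b (l := l) hw) bb.
  apply: (@squeeze_cvgr _ _ _ _ (fun N => - grid_L1 t (b l w) N) (fun N => grid_L1 t (b l w) N)).
  + apply: nearW => m; rewrite -ler_norml; exact: D_bound.
  + by rewrite -[X in _ --> X]oppr0; apply: cvgN; exact: grid_L1_cvg t0 (continuous_b (l := l) hw) bb.
  + exact: grid_L1_cvg t0 (continuous_b (l := l) hw) bb.
have [] := @dominated_convergence _ _ _ P setT measurableT
  (fun N w => ((D t N (kk N) l w) ^+ 2)%:E)%E (cst 0%E) (fun w => (B ^+ 2)%:E).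
- by move=> N; apply/measurable_EFinP; apply: measurable_funX; exact: D_measurable.
- exact: measurable_cst.
- apply: filterS dae => w h _; apply: cvg_EFin; first exact: nearW.
  by have [_ h0] := h 0%N; have := cvgM h0 h0; rewrite mulr0; apply.
- exact: finite_measure_integrable_cst.
- apply: filterS dae => w h N _; have [h1 _] := h N.
  by rewrite /= ger0_norm ?sqr_ge0// lee_fin -real_normK ?num_real// lerXn2r ?nnegrE// (le_trans _ h1).
by move=> _ _; rewrite integral0.
Qed.

Let step t N l j r w := (\sum_(m < N.+1) Hc l j (grid t N m) w *
   \1_(`]grid t N m, grid t N m.+1]) r)%R.

Let Ito_dist t N k l j : 0 < t -> (k <= N.+1)%N ->
  (\int[P]_w ((I l j (grid t N k) w -
    \sum_(r < k) Hc l j (grid t N r) w * increment W (grid t N r) (grid t N r.+1) j w) ^+ 2)%:E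
  <= 4%:E * sqdist2 P t (fun r w => diffusion sigma (X r w) l j) (step t N l j))%E.
Proof.
move=> t0 kN; have g0 m := grid_ge0 N m (ltW t0).
have mc (r : 'I_k) := @Hc_wrt l j _ (g0 r).
have Lc (r : 'I_k) : Lall P (Hc l j (grid t N r)).
  apply: (Lall_bounded P (M := `|sigma j|)); last exact: Hc_bound.
  exact: measurable_wrt_fun (filtration_measurable hW (t := grid t N r)) (mc r).
have gS (r : 'I_k) : grid t N r <= grid t N r.+1 by apply: grid_mono (ltW t0) _.
have gk (r : 'I_k) : grid t N r.+1 <= grid t N k by apply: grid_mono (ltW t0) _.
have h := ito_integral_dist hW (g0 k) (hI l j) (fun r : 'I_k => g0 r) gS gk mc Lc.
apply: le_trans h _.
apply: lee_wpmul2l; first by rewrite lee_fin.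
apply: (@grid_sqdist2_mono _ _ _ P (fun r w => diffusion sigma (X r w) l j) (Hc l j)) => //.
  by have [] := hI l j.
by move=> r r0; exact: measurable_wrt_fun (filtration_measurable hW (t := r)) (@Hc_wrt l j r r0).
Qed.

Let step_cvg t l j : 0 < t -> (fun N => sqdist2 P t
  (fun r w => diffusion sigma (X r w) l j) (step t N l j)) @ \oo --> 0%E.
Proof.
move=> t0; apply: (@grid_sqdist2_cvg _ _ _ P (fun r w => diffusion sigma (X r w) l j) (Hc l j) t `|sigma j|) => //.
- by have [] := hI l j.
- by move=> r r0; exact: measurable_wrt_fun (filtration_measurable hW (t := r)) (@Hc_wrt l j r r0).
apply: filterS hX => w hw.
have HE r : 0 <= r -> Hc l j r w = diffusion sigma (X r w) l j.
  by move=> r0; rewrite diffusion_entry /Hc !clampedE.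
split => // [|r r0]; last by rewrite -HE.
have [cX _ _ _] := hw.
rewrite (_ : (fun r => _) = (fun r => X r w l 0 * ((l == j)%:R - X r w j 0) * sigma j)); last first.
  by apply/funext => r; rewrite diffusion_entry.
move=> r; apply: cvgM; last exact: cvg_cst.
by apply: cvgM; [exact: cX|apply: cvgB; [exact: cvg_cst|exact: cX]].
Qed.

Let sqr_error_le t N k l w :
  (euler W A sigma t N (x t N) (fun l => x0 l 0) k l w - x t N k l w) ^+ 2 <=
  2 * 2 ^+ size (index_enum 'I_n) * (D t N k l w ^+ 2 + \sum_j (I l j (grid t N k) w -
    \sum_(r < k) Hc l j (grid t N r) w * increment W (grid t N r) (grid t N r.+1) j w) ^+ 2).
Proof.
pose M j := I l j (grid t N k) w -
    \sum_(r < k) Hc l j (grid t N r) w * increment W (grid t N r) (grid t N r.+1) j w.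
have -> : euler W A sigma t N (x t N) (fun l => x0 l 0) k l w - x t N k l w =
    - (D t N k l w + \sum_j M j) by rewrite /D /x; ring.
rewrite sqrrN; apply: le_trans (sqr_add_le _ _) _; rewrite mulrDr; apply: lerD.
  by rewrite -mulrA ler_wpM2l// ler_peMl ?sqr_ge0// exprn_ege1// ler1n.
by rewrite -mulrA ler_wpM2l//; exact: sqr_sum_le.
Qed.

(** Both parts of the error are bounded uniformly over the grid times: the drift part by its value
    at the worst index [kk N], the Ito part by the mean square distance of the integrands over all
    of [0, t]. The resulting bound [u N] tends to 0. *)
Lemma euler_error t eps : 0 < t -> 0 < eps -> \forall N \near \oo,
  forall l k, (k <= N.+1)%N -> Ex P (fun w => (euler W A sigma t N
    (fun k l w => clamped (grid t N k) l w) (fun l => x0 l 0) k l w -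
    clamped (grid t N k) l w) ^+ 2) <= eps.
Proof.
move=> t0 eps0; apply: filter_forall => l.
have g0 N m := grid_ge0 N m (ltW t0).
pose e N k := (\int[P]_w ((D t N k l w) ^+ 2)%:E)%E.
have : forall N, exists k, (k <= N.+1)%N /\ forall k', (k' <= N.+1)%N -> (e N k' <= e N k)%E.
  move=> N; case: (Order.TotalTheory.arg_maxP (i0 := @ord0 N.+1) (P := xpredT) (e N \o val) isT) => k _ hk.
  exists k; split; first by rewrite -ltnS.
  by move=> k' k'N; have := hk (Ordinal (k'N : (k' < N.+2)%N)) isT.
move=> /choice[kk hkk]; have kkN N : (kk N <= N.+1)%N by have [] := hkk N.
set c := 2 * 2 ^+ size (index_enum 'I_n) : R.
have c0 : 0 <= c by rewrite mulr_ge0// exprn_ge0.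
pose s N j := sqdist2 P t (fun r w => diffusion sigma (X r w) l j) (step t N l j).
pose u N := (c%:E * (e N (kk N) + \sum_j 4%:E * s N j))%E.
have s0 N j : (0 <= s N j)%E.
  by apply: integral_ge0 => w _; apply: integral_ge0 => r _; rewrite lee_fin sqr_ge0.
have ucvg : u @ \oo --> 0%E.
  rewrite -(mule0 c%:E); apply: cvgeZl => //.
  rewrite -[X in _ --> X]adde0; apply: cvgeD => //; first exact: D_cvg t0 kkN.
  have E0 : (\sum_(j < n) 0 = 0 :> \bar R)%E by rewrite big1_eq.
  rewrite -[X in _ --> X]E0.
  apply: cvg_nnesum => j _; last first.
    by rewrite -(mule0 4%:E); apply: cvgeZl => //; exact: step_cvg.
  by apply: nearW => N; rewrite mule_ge0// lee_fin.
have /fine_cvgP[finu /cvgr_lt/(_ _ eps0) ltu] := ucvg.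
near=> N => k kN.
have fu : u N \is a fin_num by near: N.
have lu : fine (u N) < eps by near: N.
rewrite -lee_fin; have x01 m l' w : 0 <= x t N m l' w <= 1 by exact: clamped01.
have mx m l' : measurable_wrt (F (grid t N m)) (x t N m l') by exact: clamped_wrt.
have Le := Lall_euler hW A sigma t0 (fun l => x0 l 0) x01 mx k l.
have Lx := Lall_grid hW x01 mx k l.
rewrite -Ex_EFin; last by apply: LallX; exact: LallB.
apply: (@le_trans _ _ (u N)); last by rewrite -(fineK fu) lee_fin ltW.
set M := fun j w => I l j (grid t N k) w -
    \sum_(r < k) Hc l j (grid t N r) w * increment W (grid t N r) (grid t N r.+1) j w.
have mF r := filtration_measurable hW (t := r).
have mM j : measurable_fun setT (M j).
  apply: measurable_funB; first by have [_ _ _ _ /(_ _ (g0 N k)) [+ _]] := hI l j.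
  apply: measurable_sum => r; apply: measurable_funM.
    exact: measurable_wrt_fun (mF _) (@Hc_wrt l j _ (g0 N r)).
  by have := increment_measurable hW j (g0 N r) (g0 N r.+1); apply.
have mM2 j : measurable_fun setT (fun w => (M j w ^+ 2)%:E).
  by apply/measurable_EFinP; exact: measurable_funX.
have mD2 : measurable_fun setT (fun w => (D t N k l w ^+ 2)%:E).
  by apply/measurable_EFinP; apply: measurable_funX; exact: D_measurable.
have mS : measurable_fun setT (fun w => \sum_j (M j w ^+ 2)%:E)%E.
  by apply: emeasurable_sum => j; exact: mM2.
apply: (@le_trans _ _ (\int[P]_w (c%:E * ((D t N k l w ^+ 2)%:E + \sum_j (M j w ^+ 2)%:E)))%E).
  apply: ge0_le_integral => //.
  - by move=> w _; rewrite lee_fin sqr_ge0.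
  - by apply/measurable_EFinP; apply: measurable_funX; have [mB _] := LallB Le Lx; exact: mB.
  - by apply: measurable_funeM; exact: emeasurable_funD.
  by move=> w _; rewrite sumEFin -EFinD -EFinM lee_fin; exact: sqr_error_le.
have M20 j w : (0 <= (M j w ^+ 2)%:E)%E by rewrite lee_fin sqr_ge0.
have D20 w : (0 <= (D t N k l w ^+ 2)%:E)%E by rewrite lee_fin sqr_ge0.
rewrite ge0_integralZl//; last 2 first.
- exact: emeasurable_funD.
- by move=> w _; rewrite adde_ge0// sume_ge0.
apply: lee_wpmul2l; first by rewrite lee_fin.
rewrite ge0_integralD//; last by move=> w _; rewrite sume_ge0.
rewrite ge0_integral_sum//; apply: leeD.
  by have [_] := hkk N; apply.
by apply: lee_sum => j _; exact: Ito_dist.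
Unshelve. all: by end_near. Qed.

End replicator_scheme.

(** * Almost sure limits *)

Section almost_everywhere_limits.
Context {d : measure_display} {T : measurableType d} {R : realType}.
Variable P : probability T R.

Lemma ae_foralln (Q : nat -> T -> Prop) :
  (forall k, {ae P, forall w, Q k w}) -> {ae P, forall w, forall k, Q k w}.
Proof.
move=> h; have := negligible_bigcup (mu := P) (F := fun k => ~` [set w | Q k w]) h.
by apply: negligibleS => w /= /existsNP[k nQ]; exists k.
Qed.

(** By Fatou's lemma the lower limit of the squares has integral 0, and almost everywhere it is the
    square of the limit. *)
Lemma ae_lim_eq0 (z : nat -> T -> R) (l : T -> R) :
  (forall N, measurable_fun setT (z N)) ->
  (fun N => \int[P]_w (z N w ^+ 2)%:E)%E @ \oo --> 0%E ->
  {ae P, forall w, (fun N => z N w) @ \oo --> l w} -> {ae P, forall w, l w = 0}.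
Proof.
move=> mz iz zl; pose f N w := (z N w ^+ 2)%:E.
have mf N : measurable_fun setT (f N) by apply/measurable_EFinP; exact: measurable_funX.
have f0 N w : (0 <= f N w)%E by rewrite lee_fin sqr_ge0.
pose g w := limn_einf (fun N => f N w).
have g0 w : (0 <= g w)%E.
  rewrite /g limn_einf_lim; apply: lime_ge; first exact: is_cvg_einfs.
  by apply: nearW => N; apply: le_ereal_inf_tmp => _ [k _ <-].
have mg : measurable_fun setT g.
  rewrite (_ : g = fun w => (- limn_esup (fun N => - f N w))%E); last first.
    by apply/funext => w; rewrite -limn_einfN; congr limn_einf; apply/funext => N; rewrite /comp oppeK.
  apply: measurableT_comp => //; apply: measurable_fun_limn_esup => N.
  exact: measurableT_comp.
have ig : (\int[P]_w `|g w| = 0)%E.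
  apply/eqP; rewrite eq_le integral_ge0 ?andbT//.
  under eq_integral do rewrite gee0_abs//.
  apply: le_trans (fatou P measurableT mf (fun N w _ => f0 N w)) _.
  by have [-> _] := cvg_limn_einf_sup iz.
have /(ae_eq_integral_abs P measurableT mg) ae0 := ig.
apply: filterS2 ae0 zl => w /(_ I)/= gw zlw.
have fl : (fun N => f N w) @ \oo --> (l w ^+ 2)%:E.
  by apply: cvg_EFin; [exact: nearW|have := cvgM zlw zlw; apply].
have [gE _] := cvg_limn_einf_sup fl.
by move: gw; rewrite /g gE => -[] /eqP; rewrite sqrf_eq0 => /eqP.
Qed.

End almost_everywhere_limits.

(** * Integrals and identities of continuous paths *)

Section continuous_identities.
Context {R : realType}.
Local Notation mu := (@lebesgue_measure R).
Implicit Type f : R -> R.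

(** [B] ensures integrability on [0, t], while [M] bounds [f] from [s] on; keeping them apart gives
    a sharp estimate for functions that are small at late times. *)
Lemma integral_lipschitz f (B M s t : R) : {within `[0, +oo[, continuous f} ->
  (forall r, 0 <= r -> `|f r| <= B) -> 0 <= s -> s <= t -> (forall r, s <= r -> `|f r| <= M) ->
  `|Rintegral mu `[0, t] f - Rintegral mu `[0, s] f| <= M * (t - s).
Proof.
move=> cf fB s0 st fM; have t0 := le_trans s0 st.
have M0 : 0 <= M by exact: le_trans (fM s (lexx s)).
have it : mu.-integrable `[0, t] (EFin \o f).
  by apply: (bounded_itv_integrable (M := B)); [exact: grid_measurable|move=> r /andP[r0 _]; exact: fB].
have sub g : mu.-integrable `[0, t] (EFin \o g) -> mu.-integrable `]s, t] (EFin \o g).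
  move=> ig; apply: integrableS ig => //; move=> r /=; rewrite !in_itv/= => /andP[sr ->].
  by rewrite andbT ltW// (le_lt_trans s0).
have ist := sub _ it.
have iM : mu.-integrable `[0, t] (EFin \o fun=> M).
  by apply: (bounded_itv_integrable (M := M)) => // r _; rewrite ger0_norm.
have -> : Rintegral mu `[0, t] f - Rintegral mu `[0, s] f = Rintegral mu `]s, t] f.
  by rewrite -(Rintegral_itvB it)//= bnd_simp.
apply: le_trans; first exact: (le_normr_Rintegral _ ist).
have -> : M * (t - s) = Rintegral mu `]s, t] (fun=> M).
  rewrite Rintegral_cst//= lebesgue_measure_itv/= lte_fin; case: ltP => [_|ts]//=.
  by have -> : s = t; [apply/le_anti/andP|rewrite subrr].
apply: le_Rintegral => //.
- by have := integrable_norm ist; apply.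
- by have := sub _ iM; apply.
by move=> r /=; rewrite in_itv/= => /andP[sr _]; apply: fM; exact: ltW.
Qed.

Lemma integral_continuous f (M : R) : {within `[0, +oo[, continuous f} ->
  (forall r, 0 <= r -> `|f r| <= M) ->
  {within `[0, +oo[, continuous (fun t => Rintegral mu `[0, t] f)}.
Proof.
move=> cf fM; have M0 : 0 <= M by exact: le_trans (fM 0 (lexx 0)).
apply/subspace_continuousP => t /=; rewrite in_itv/= andbT => t0; apply/cvgrPdist_le => e e0.
rewrite near_withinE; apply/nbhs_ballP; exists (e / (M + 1)) => /=.
  by rewrite divr_gt0// ltr_wpDl.
move=> s /= ts; rewrite in_itv/= andbT => s0.
have {}ts : M * `|t - s| <= e.
  apply: (@le_trans _ _ ((M + 1) * `|t - s|)); first by rewrite ler_wpM2r// lerDl.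
  by rewrite mulrC -ler_pdivlMr ?ltr_wpDl// ltW.
apply: le_trans ts; have [st|/ltW ts] := leP s t.
  by rewrite [X in _ <= _ * X]ger0_norm ?subr_ge0//; apply: (integral_lipschitz cf fM) => // r sr; apply: fM; exact: le_trans sr.
by rewrite distrC [X in _ <= _ * X]distrC [X in _ <= _ * X]ger0_norm ?subr_ge0//; apply: (integral_lipschitz cf fM) => // r sr; apply: fM; exact: le_trans sr.
Qed.

Lemma continuous_seq f (s : nat -> R) (t : R) : {within `[0, +oo[, continuous f} -> 0 <= t ->
  (forall m, 0 <= s m) -> s @ \oo --> t -> (fun m => f (s m)) @ \oo --> f t.
Proof.
move=> cf t0 s0 st.
have tin : `[0, +oo[%classic t by rewrite /= in_itv/= t0.
have h : f r @[r --> within `[0, +oo[%classic (nbhs t)] --> f t.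
  by have := cf t; rewrite /continuous_at /= nbhs_subspace_in.
have sw : s @ \oo --> within `[0, +oo[%classic (nbhs t).
  move=> B /= wB; change (\forall m \near \oo, B (s m)).
  have : \forall m \near \oo, `[0, +oo[%classic (s m) -> B (s m) by exact: st _ wB.
  by apply: filterS => m; apply; rewrite /= in_itv/= andbT; exact: s0.
exact: cvg_comp sw h.
Qed.

(* A path vanishing at the positive rational times vanishes. *)
Lemma continuous_rational_eq0 f : {within `[0, +oo[, continuous f} ->
  (forall k m : nat, f (k.+1%:R / m.+1%:R) = 0) -> forall t, 0 <= t -> f t = 0.
Proof.
move=> cf f0 t t0.
(* Rounding strictly upwards keeps these times positive even when t = 0. *)
pose s m : R := (Num.truncn (t * m.+1%:R)).+1%:R / m.+1%:R.
have s0 m : 0 <= s m by rewrite divr_ge0.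
have sb m : t <= s m <= t + m.+1%:R^-1.
  have /andP[h1 h2] := truncn_itv (mulr_ge0 t0 (ler0n R m.+1)).
  rewrite /s ler_pdivlMr// (ltW h2)/= ler_pdivrMr// mulrDl mulVf//.
  by rewrite -natr1 lerD2r.
have st : s @ \oo --> t.
  apply: (@squeeze_cvgr _ _ _ _ (fun=> t) (fun m => t + m.+1%:R^-1)).
  - by apply: nearW => m; exact: sb.
  - exact: cvg_cst.
  - by rewrite -[X in _ --> X]addr0; apply: cvgD; [exact: cvg_cst|exact: cvg_harmonic].
have h2 := continuous_seq cf t0 s0 st.
have h3 : (fun m => f (s m)) @ \oo --> (0 : R).
  by rewrite (_ : (fun m => _) = fun=> 0); [exact: cvg_cst|apply/funext => m; exact: f0].
by apply: (cvg_unique _ h2 h3).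
Qed.

End continuous_identities.

(** * The formula for the logarithmic ratio of two components *)

Section replicator_log_ratio.
Context {d : measure_display} {T : measurableType d} {R : realType}.
Variables (P : probability T R) (n : nat) (W : R -> T -> 'cV[R]_n).
Hypothesis hW : standard_brownian_motion P W.
Variables (A : 'M[R]_n) (sigma : 'I_n -> R) (x0 : 'cV[R]_n).
Variables (X : R -> T -> 'cV[R]_n) (I : 'I_n -> 'I_n -> R -> T -> R).
Local Notation F := (brownian_filtration P W).
Local Notation mu := (@lebesgue_measure R).

Hypothesis hXa : forall l, adapted F (fun t w => X t w l 0).
Hypothesis hI : forall l j, ito_integral P F (fun t w => W t w j 0)
  (fun t w => diffusion sigma (X t w) l j) (I l j).
Hypothesis hX : {ae P, forall w, replicator_path A sigma x0 X I w}.
Variables (i j : 'I_n).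
Hypotheses (ij : i != j) (x0i : 0 < x0 i 0) (x0j : 0 < x0 j 0).

Definition log_drift w s := log_rate A sigma (fun k => X s w k 0) i - log_rate A sigma (fun k => X s w k 0) j.
(** The right-hand side of Ito's formula for ln(X_i / X_j). *)
Definition log_path t w := ln (x0 i 0 / x0 j 0) + Rintegral mu `[0, t] (log_drift w) +
  (sigma i * W t w i 0 - sigma j * W t w j 0).

Let gap x y L : R := x * (1 - logistic L) - y * logistic L.
Let xg t N k l w := clamped X (grid t N k) l w.
Let L_ t N w := log_ratio W A sigma t N (xg t N) (fun l => x0 l 0) i j N.+1 w.
(** The gap of the process itself, rather than of its Euler sums, against the discrete log ratio at
    the final grid time [t]. *)
Let z t N w := gap (clamped X t i w) (clamped X t j w) (L_ t N w).

Let logistic_continuous : continuous (@logistic R).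
Proof.
move=> L; apply/differentiable_continuous/derivable1_diffP.
by have [] := is_derive_logistic L.
Qed.

Let gap_bound_aux (t : R) N w : 0 < t -> z t N w ^+ 2 <=
  2 * euler_gap W A sigma t N (xg t N) (fun l => x0 l 0) i j N.+1 w ^+ 2 +
  4 * ((euler W A sigma t N (xg t N) (fun l => x0 l 0) N.+1 i w - clamped X t i w) ^+ 2 +
       (euler W A sigma t N (xg t N) (fun l => x0 l 0) N.+1 j w - clamped X t j w) ^+ 2).
Proof.
move=> t0; rewrite /z /gap /euler_gap -/(L_ t N w).
set p := logistic _; set ei := euler _ _ _ _ _ _ _ _ i w; set ej := euler _ _ _ _ _ _ _ _ j w.
move: (clamped X t i w) (clamped X t j w) => xi xj.
have p0 : 0 <= p by exact: logistic_ge0.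
have p1 : p <= 1 by exact: logistic_le1.
have -> : xi * (1 - p) - xj * p = (ei * (1 - p) - ej * p) + ((xi - ei) * (1 - p) - (xj - ej) * p) by ring.
apply: le_trans (sqr_add_le _ _) _; rewrite lerD2l.
have sq_le (a u : R) : 0 <= a -> a <= 1 -> (u * a) ^+ 2 <= u ^+ 2.
  by move=> a0 a1; rewrite exprMn ler_piMr ?sqr_ge0// exprn_ile1.
have q0 : 0 <= 1 - p by lra.
have q1 : 1 - p <= 1 by lra.
have h1 := sq_le _ (xj - ej) p0 p1; have h2 := sq_le _ (xi - ei) q0 q1.
have := sqr_add_le ((xi - ei) * (1 - p)) (- ((xj - ej) * p)); rewrite sqrrN => h3.
rewrite -(opprB xi) -(opprB xj) !sqrrN.
apply: le_trans (ler_wpM2l _ h3) _ => //; lra.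
Qed.

Let mesh_cvg (t : R) : (fun N => mesh t N) @ \oo --> (0 : R).
Proof.
by rewrite -(mulr0 t); apply: cvgM; [exact: cvg_cst|exact: cvg_harmonic].
Qed.

Let x01 t N k l w : 0 <= xg t N k l w <= 1. Proof. exact: clamped01. Qed.

Let mx (t : R) N : 0 < t -> forall k l, measurable_wrt (F (grid t N k)) (xg t N k l).
Proof. by move=> t0 k l; apply: clamped_wrt => //; exact: grid_ge0 (ltW t0). Qed.

Let mL (t : R) N : 0 < t -> measurable_fun setT (L_ t N).
Proof.
move=> t0; apply: (measurable_wrt_fun (filtration_measurable hW (t := grid t N N.+1))).
by apply: (log_ratio_wrt A sigma t0); exact: mx.
Qed.

Let mz (t : R) N : 0 < t -> measurable_fun setT (z t N).
Proof.
move=> t0; have mF r := filtration_measurable hW (t := r).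
have mp : measurable_fun setT (fun w => logistic (L_ t N w)).
  exact: (measurableT_comp measurable_logistic (mL N t0)).
have mX l : measurable_fun setT (clamped X t l).
  exact: measurable_wrt_fun (mF t) (@clamped_wrt _ _ _ _ _ _ _ hXa t l (ltW t0)).
apply: measurable_funB; apply: measurable_funM => //.
by apply: measurable_funB => //; exact: measurable_cst.
Qed.

Let Lz t N : 0 < t -> Lall P (z t N).
Proof.
move=> t0; apply: (Lall_bounded P (M := 2) (mz N t0)) => w.
have /andP[a0 a1] := clamped01 X t i w; have /andP[b0 b1] := clamped01 X t j w.
rewrite /z /gap; set p := logistic _.
have p0 : 0 <= p by exact: logistic_ge0.
have p1 : p <= 1 by exact: logistic_le1.
apply: le_trans (ler_normB _ _) _; rewrite !ger0_norm ?mulr_ge0 ?subr_ge0//.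
have -> : 2 = 1 * 1 + 1 * 1 :> R by ring.
by apply: lerD; apply: ler_pM => //; rewrite ?subr_ge0// gerBl.
Qed.

Let z_cvg t : 0 < t -> (fun N => \int[P]_w (z t N w ^+ 2)%:E)%E @ \oo --> 0%E.
Proof.
move=> t0; have [C C0 hC] := noise_moments hW sigma.
set c := expR (one_step_cst A sigma C * t); have c0 : 0 < c by exact: expR_gt0.
have bound N : mesh t N <= 1 -> forall eps, (forall l k, (k <= N.+1)%N ->
    Ex P (fun w => (euler W A sigma t N (xg t N) (fun l => x0 l 0) k l w - clamped X (grid t N k) l w) ^+ 2) <= eps) ->
    Ex P (fun w => z t N w ^+ 2) <= 2 * ((2 * eps + Num.sqrt (mesh t N)) * c) + 8 * eps.
  move=> h1 eps heps.
  have Le k l := Lall_euler hW A sigma t0 (fun l => x0 l 0) (x01 t N) (@mx t N t0) k l.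
  have Lx k l := Lall_grid hW (x01 t N) (@mx t N t0) k l.
  have Ld k l := LallX 2 (LallB (Le k l) (Lx k l)).
  have d2 k : (k <= N.+1)%N -> Ex P (fun w =>
     (euler W A sigma t N (xg t N) (fun l => x0 l 0) k i w - xg t N k i w) ^+ 2 +
     (euler W A sigma t N (xg t N) (fun l => x0 l 0) k j w - xg t N k j w) ^+ 2) <= 2 * eps.
    move=> kN; rewrite (ExD (Ld k i) (Ld k j)).
    have -> : 2 * eps = eps + eps by ring.
    by apply: lerD; exact: heps.
  have hb := euler_gap_bound hW t0 (x01 t N) (@mx t N t0) ij x0i x0j h1 C0 hC
    (fun k kN => d2 k (leqW kN)).
  have Lg : Lall P (fun w => euler_gap W A sigma t N (xg t N) (fun l => x0 l 0) i j N.+1 w).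
    have mp : measurable_fun setT (fun w => logistic (L_ t N w)).
      exact: (measurableT_comp measurable_logistic (mL N t0)).
    have Lp : Lall P (fun w => logistic (L_ t N w)).
      apply: (Lall_bounded P (M := 1) mp) => w.
      by rewrite ger0_norm ?logistic_le1 ?logistic_ge0.
    exact: LallB (LallM (Le _ _) (LallB (Lall_cst P 1) Lp)) (LallM (Le _ _) Lp).
  have Lg2 := LallX 2 Lg; have Ldd := LallD (Ld N.+1 i) (Ld N.+1 j).
  have e1 : Ex P (fun w => z t N w ^+ 2) <= Ex P (fun w =>
      2 * euler_gap W A sigma t N (xg t N) (fun l => x0 l 0) i j N.+1 w ^+ 2 +
      4 * ((euler W A sigma t N (xg t N) (fun l => x0 l 0) N.+1 i w - xg t N N.+1 i w) ^+ 2 +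
      (euler W A sigma t N (xg t N) (fun l => x0 l 0) N.+1 j w - xg t N N.+1 j w) ^+ 2)).
    apply: Ex_le (LallX 2 (Lz N t0)) (LallD (LallZ 2 Lg2) (LallZ 4 Ldd)) _ => w.
    by rewrite /xg grid_last; exact: gap_bound_aux.
  apply: le_trans e1 _; rewrite (ExD (LallZ 2 Lg2) (LallZ 4 Ldd)) (ExZ _ Lg2) (ExZ _ Ldd).
  have := d2 N.+1 (leqnn _); rewrite -/c in hb; move: hb.
  by move: (Ex P _) (Ex P _) => u v hu hv; lra.
clearbody c.
rewrite (_ : (fun N => _) = (fun N => (Ex P (fun w => z t N w ^+ 2))%:E)); last first.
  by apply/funext => N; rewrite Ex_EFin//; exact: LallX 2 (Lz N t0).
apply: cvg_EFin; first exact: nearW.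
apply/cvgrPdist_le => e e0 /=.
(* With d this tolerance, 4 c d + 8 d = e / 2; the other half of [e] is left for the square root of
   the mesh. *)
have d0 : 0 < e / (8 * c + 16) by rewrite divr_gt0// addr_gt0// mulr_gt0.
have r0 : 0 < (e / (4 * c)) ^+ 2 by rewrite exprn_gt0// divr_gt0// mulr_gt0.
have herr := euler_error hW hXa hI hX t0 d0.
have hm := mesh_cvg t.
near=> N.
have m1 : mesh t N <= 1.
  by near: N; exact: cvgr_le hm _ ltr01.
have m2 : mesh t N <= (e / (4 * c)) ^+ 2.
  by near: N; exact: cvgr_le hm _ r0.
have hN : forall l k, (k <= N.+1)%N -> Ex P (fun w => (euler W A sigma t N
    (xg t N) (fun l => x0 l 0) k l w - clamped X (grid t N k) l w) ^+ 2) <= e / (8 * c + 16).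
  by near: N; exact: herr.
rewrite sub0r normrN ger0_norm; last by apply: Ex_ge0 => w; exact: sqr_ge0.
apply: le_trans (bound N m1 _ hN) _.
have s1 : Num.sqrt (mesh t N) <= e / (4 * c).
  have q0 : 0 <= e / (4 * c) by rewrite divr_ge0 ?mulr_ge0// ltW.
  by have := ler_wsqrtr m2; rewrite sqrtr_sqr ger0_norm.
have -> : 2 * ((2 * (e / (8 * c + 16)) + Num.sqrt (mesh t N)) * c) + 8 * (e / (8 * c + 16)) =
   e / 2 + 2 * c * Num.sqrt (mesh t N).
  by field; rewrite gt_eqF// addr_gt0// mulr_gt0.
have : 2 * c * Num.sqrt (mesh t N) <= 2 * c * (e / (4 * c)) by rewrite ler_wpM2l// mulr_ge0// ltW.
have -> : 2 * c * (e / (4 * c)) = e / 2 by field; rewrite gt_eqF.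
lra.
Unshelve. all: by end_near. Qed.

Let log_drift_continuous w : replicator_path A sigma x0 X I w ->
  {within `[0, +oo[, continuous (log_drift w)}.
Proof.
move=> [cX _ _ _] r.
have h l := @continuous_log_rate R n _ A sigma
  (fun (r : subspace (`[0, +oo[%classic : set R)) k => X r w k 0) cX l r.
by have := cvgB (h i) (h j); apply.
Qed.

Let log_drift_bound w r : replicator_path A sigma x0 X I w -> 0 <= r ->
  `|log_drift w r| <= 2 * rate_bound A sigma.
Proof.
move=> hw r0; have y01 k : 0 <= X r w k 0 <= 1 by exact: replicator_path01 hw r0.
apply: le_trans (ler_normB _ _) _.
have := log_rate_bound A sigma y01 i; have := log_rate_bound A sigma y01 j; lra.
Qed.

(** The drift sums are Riemann sums of a continuous bounded path, and the noises telescope to the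
    value of W at [t], since W starts at 0 for this outcome. *)
Let L_cvg (t : R) w : 0 < t -> replicator_path A sigma x0 X I w -> W 0 w i 0 = 0 -> W 0 w j 0 = 0 ->
  (fun N => L_ t N w) @ \oo --> log_path t w.
Proof.
move=> t0 hw Wi Wj.
have LE N : L_ t N w = ln (x0 i 0 / x0 j 0) + \sum_(r < N.+1) log_drift w (grid t N r) * mesh t N +
    (sigma i * W t w i 0 - sigma j * W t w j 0).
  have tel l : W 0 w l 0 = 0 -> \sum_(r < N.+1) noise W sigma t N r l w = sigma l * W t w l 0.
    move=> Wl; rewrite -mulr_sumr -(big_mkord xpredT (fun r => increment W (grid t N r) (grid t N r.+1) l w)).
    rewrite (telescope_sumr (fun r => W (grid t N r) w l 0))// grid_last grid0 Wl subr0//.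
  rewrite -(tel i Wi) -(tel j Wj) -sumrB -addrA -big_split/=; congr (_ + _).
  apply: eq_bigr => r _; rewrite /log_step /step_del /step_mu mulrC; congr (_ * _ + _).
  have xE : (fun k => xg t N r k w) = fun k => X (grid t N r) w k 0.
    by apply/funext => k; rewrite /xg (clampedE _ hw)// grid_ge0// ltW.
  by rewrite /log_drift -xE.
rewrite (_ : (fun N => _) = fun N => ln (x0 i 0 / x0 j 0) +
    \sum_(r < N.+1) log_drift w (grid t N r) * mesh t N +
    (sigma i * W t w i 0 - sigma j * W t w j 0)); last by apply/funext => N.
apply: cvgD; last exact: cvg_cst.
apply: cvgD; first exact: cvg_cst.
have cl := log_drift_continuous hw; have bl r := @log_drift_bound w r hw.
apply/cvgrPdist_le => e e0.
have := grid_L1_cvg t0 cl bl; move/cvgrPdist_le/(_ _ e0); apply: filterS => N.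
rewrite sub0r normrN => hN; rewrite distrC.
have := riemann_error t0 cl bl (leqnn N.+1); rewrite grid_last => /le_trans; apply.
exact: le_trans (ler_norm _) hN.
Qed.

Let W_ae l : {ae P, forall w, W 0 w l 0 = 0 /\ {within `[0, +oo[, continuous (fun t => W t w l 0)}}.
Proof. by have [h _] := hW; have [_ h1 h2 _ _] := h l; apply: filterS2 h1 h2 => w. Qed.

(** At a fixed time [z] tends to 0 in mean square and almost surely to the gap at [log_path], so
    that gap is almost surely 0. This is used at the countably many positive rational times;
    continuity of both sides covers the others. *)
Lemma replicator_ratio : {ae P, forall w, forall t, 0 <= t ->
  X t w i 0 = X t w j 0 * expR (log_path t w)}.
Proof.
have fixed k m : {ae P, forall w, let t := k.+1%:R / m.+1%:R in
    gap (X t w i 0) (X t w j 0) (log_path t w) = 0}.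
  have t0 : (0 : R) < k.+1%:R / m.+1%:R by rewrite divr_gt0.
  have := ae_lim_eq0 (fun N => mz N t0) (z_cvg t0); apply.
  apply: filterS3 hX (W_ae i) (W_ae j) => w hw [Wi _] [Wj _].
  have pc := cvg_comp _ _ (L_cvg t0 hw Wi Wj) (@logistic_continuous _).
  rewrite /z /gap !(clampedE _ hw (ltW t0)); apply: cvgB; apply: cvgM; try exact: cvg_cst.
    by apply: cvgB; [exact: cvg_cst|exact: pc].
  exact: pc.
have := ae_foralln (fun k => ae_foralln (fun m => fixed k m)).
move=> hrat; apply: filterS2 (filterI hrat hX) (filterI (W_ae i) (W_ae j)) => w [hz hw] [[_ cWi] [_ cWj]] t t0.
apply: logistic_ratio.
have cL : {within `[0, +oo[, continuous (fun t => log_path t w)}.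
  have cI := integral_continuous (log_drift_continuous hw) (fun r => @log_drift_bound w r hw).
  move=> r; apply: cvgD; first by apply: cvgD; [exact: cvg_cst|exact: cI].
  by apply: cvgB; apply: cvgM; try exact: cvg_cst; [exact: cWi|exact: cWj].
have cp : {within `[0, +oo[, continuous (fun t => logistic (log_path t w))}.
  by move=> r; have := cvg_comp _ _ (cL r) (@logistic_continuous (log_path r w)); apply.
have [cX _ _ _] := hw.
apply: (@continuous_rational_eq0 _ (fun t => gap (X t w i 0) (X t w j 0) (log_path t w))) => //.
  move=> r; apply: cvgB; apply: cvgM; try exact: cX; try exact: cp.
  by apply: cvgB; [exact: cvg_cst|exact: cp].
Qed.

End replicator_log_ratio.

(** * Almost sure bounds from summable expectations *)

Section double_series.
Context {d : measure_display} {T : measurableType d} {R : realType}.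
Variable P : probability T R.

Lemma nneseries_geometric_le (c q : R) : 0 <= c -> 0 < q -> q < 1 ->
  (\sum_(0 <= k <oo) (c * q ^+ k)%:E <= (c / (1 - q))%:E)%E.
Proof.
move=> c0 q0 q1; apply: lime_le.
  by apply: is_cvg_nneseries => k _ _; rewrite lee_fin mulr_ge0// exprn_ge0// ltW.
apply: nearW => m; rewrite sumEFin lee_fin.
by apply: (geometric_le_lim m c0 q0); rewrite ger0_norm// ltW.
Qed.

Lemma nneseries_term (u : nat -> \bar R) k : (forall m, 0 <= u m)%E ->
  (u k <= \sum_(0 <= m <oo) u m)%E.
Proof.
move=> u0; apply: le_trans (nneseries_lim_ge k.+1 (fun m _ _ => u0 m)).
by rewrite big_nat_recr//= leeDr// sume_ge0.
Qed.

(** The expectations have a finite sum, so the double series is almost surely finite, and it bounds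
    each of its nonnegative terms. *)
Lemma ae_bounded_array (Y : nat -> nat -> T -> R) (c q : R) : 0 <= c -> 0 < q -> q < 1 ->
  (forall N m, measurable_fun setT (Y N m)) -> (forall N m w, 0 <= Y N m w) ->
  (forall N m, (\int[P]_w (Y N m w)%:E <= (c * q ^+ N * q ^+ m)%:E)%E) ->
  {ae P, forall w, exists K, forall N m, Y N m w <= K}.
Proof.
move=> c0 q0 q1 mY Y0 iY.
have Ym N m : measurable_fun setT (fun w => (Y N m w)%:E) by apply/measurable_EFinP; exact: mY.
pose row N w := (\sum_(0 <= m <oo) (Y N m w)%:E)%E.
have row0 N w : (0 <= row N w)%E by apply: nneseries_ge0 => m _ _; rewrite lee_fin.
have mrow N : measurable_fun setT (row N).
  by apply: ge0_emeasurable_sum => // m w _ _; rewrite lee_fin.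
pose S w := (\sum_(0 <= N <oo) row N w)%E.
have S0 w : (0 <= S w)%E by exact: nneseries_ge0.
have mS : measurable_fun setT S by exact: ge0_emeasurable_sum.
have irow N : (\int[P]_w row N w <= (c / (1 - q) * q ^+ N)%:E)%E.
  rewrite integral_nneseries//; last by move=> m w _; rewrite lee_fin.
  apply: (@le_trans _ _ (\sum_(0 <= m <oo) (c * q ^+ N * q ^+ m)%:E)%E).
    by apply: lee_nneseries => // m _ _; apply: integral_ge0 => w _; rewrite lee_fin.
  apply: le_trans (nneseries_geometric_le _ q0 q1) _; first by rewrite mulr_ge0// exprn_ge0// ltW.
  by rewrite mulrAC.
have iS : (\int[P]_w S w < +oo)%E.
  rewrite integral_nneseries//.
  apply: (@le_lt_trans _ _ (\sum_(0 <= N <oo) (c / (1 - q) * q ^+ N)%:E)%E).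
    by apply: lee_nneseries => // N _ _; apply: integral_ge0 => w _.
  apply: le_lt_trans (nneseries_geometric_le _ q0 q1) _; last by rewrite ltry.
  by rewrite divr_ge0// subr_ge0 ltW.
have intS : P.-integrable setT S.
  by apply/integrableP; split => //; under eq_integral do rewrite gee0_abs//.
have := integrable_ae measurableT intS; apply: filterS => w /(_ I) fS.
exists (fine (S w)) => N m; rewrite -lee_fin fineK//.
apply: le_trans (nneseries_term N (row0 ^~ w)).
by apply: (nneseries_term m (u := fun m => (Y N m w)%:E)) => k; rewrite lee_fin.
Qed.

End double_series.

(** * Dyadic chaining for one continuous path *)

Section chaining.
Context {R : realType}.
Variables (f : R -> R) (S C r : R).
Hypotheses (cf : {within `[0, +oo[, continuous f}) (f0 : f 0 = 0).
Hypotheses (S0 : 0 < S) (C0 : 0 <= C) (r0 : 0 < r) (r1 : r < 1).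

Let pt m k := k%:R * (S / 2 ^+ m).
Hypothesis hf : forall m k, (k < 2 ^ m)%N -> `|f (pt m k.+1) - f (pt m k)| <= C * r ^+ m.

(** Induction on the level: an even point of level m + 1 is a point of level m, and an odd one is a
    single step away from it. Each level adds one term of the geometric series. *)
Let dyadic m k : (k <= 2 ^ m)%N -> `|f (pt m k)| <= series (geometric C r) m.+1.
Proof.
elim: m k => [|m IH] k km.
  rewrite /series/= big_nat_recr//= big_geq// add0r expr0 mulr1.
  case: k km => [|[|k]] km //; first by rewrite /pt mul0r f0 normr0.
  by have := hf (m := 0) (k := 0) isT; rewrite {2}/pt mul0r f0 subr0 expr0 mulr1.
have even l : pt m.+1 l.*2 = pt m l.
  by rewrite /pt -muln2 natrM exprS; field; rewrite expf_neq0.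
have rm : 0 <= C * r ^+ m.+1 by rewrite mulr_ge0// exprn_ge0// ltW.
rewrite /series/= big_nat_recr//=; rewrite -[\sum_(0 <= _ < m.+1) _]/(series (geometric C r) m.+1).
have kE := odd_double_half k; have k2 : (k./2 <= 2 ^ m)%N.
  by rewrite leq_half_double (leq_trans km)// expnS mul2n; case: (_ ^ _)%N.
rewrite -kE; case: (odd k) kE km => /= kE km.
  rewrite add1n; have h2 : (k./2.*2 < 2 ^ m.+1)%N by rewrite -[ltnRHS]/(2 ^ m.+1)%N -add1n kE.
  have := hf h2; rewrite even => h.
  rewrite -[f _](subrK (f (pt m k./2))) addrC.
  by apply: le_trans (ler_normD _ _) _; apply: lerD => //; exact: IH.
by rewrite add0n even; apply: le_trans (IH _ k2) _; rewrite lerDl.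
Qed.

Lemma dyadic_chaining t : 0 <= t -> t <= S -> `|f t| <= C / (1 - r).
Proof.
move=> t0 tS.
pose s m := pt m (Num.truncn (t / (S / 2 ^+ m))).
have u0 m : 0 < S / 2 ^+ m by rewrite divr_gt0// exprn_gt0.
have v0 m : 0 <= t / (S / 2 ^+ m) by rewrite divr_ge0// ltW.
have sb m : s m <= t <= s m + S / 2 ^+ m.
  have /andP[h1 h2] := truncn_itv (v0 m).
  rewrite /s /pt -ler_pdivlMr// h1/= -[X in _ + X]mul1r -mulrDl -ler_pdivrMr//.
  by rewrite natr1 ltW.
have s0 m : 0 <= s m by rewrite mulr_ge0// ltW.
have pc : (fun m => S / 2 ^+ m) @ \oo --> (0 : R).
  rewrite -(mulr0 S); apply: cvgM; first exact: cvg_cst.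
  rewrite (_ : (fun m => _) = geometric 1 2^-1); last first.
    by apply/funext => m; rewrite /geometric/= mul1r exprVn.
  by apply: cvg_geometric; rewrite ger0_norm ?invf_lt1 ?invr_ge0// ltr1n.
have st : s @ \oo --> t.
  apply: (@squeeze_cvgr _ _ _ _ (fun m => t - S / 2 ^+ m) (fun=> t)).
  - by apply: nearW => m; have /andP[h1 h2] := sb m; rewrite h1 lerBlDr h2.
  - by rewrite -[X in _ --> X]subr0; apply: cvgB => //; exact: cvg_cst.
  - exact: cvg_cst.
have fs := continuous_seq cf t0 s0 st.
have nfs : (fun m => `|f (s m)|) @ \oo --> `|f t| by exact: cvg_norm.
apply: (cvgr_to_le nfs); apply: nearW => m.
apply: le_trans (dyadic _) _.
  rewrite -(ler_nat R) natrX (le_trans (_ : _ <= t / (S / 2 ^+ m)))//.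
    by have /andP[] := truncn_itv (v0 m).
  by rewrite ler_pdivrMr// mulrCA divff ?mulr1// expf_neq0.
by apply: geometric_le_lim => //; rewrite ger0_norm// ltW.
Qed.

End chaining.

(** * The strong law of large numbers for Brownian motion *)

Section brownian_growth.
Context {d : measure_display} {T : measurableType d} {R : realType}.
Variables (P : probability T R) (n : nat) (W : R -> T -> 'cV[R]_n).
Hypothesis hW : standard_brownian_motion P W.
Variable i : 'I_n.

Let r : R := 9 / 10.
Let r0 : 0 < r. Proof. by rewrite divr_gt0. Qed.
Let r1 : r < 1. Proof. by rewrite ltr_pdivrMr// mul1r ltr_nat. Qed.
(* [r] is close enough to 1 for the fourth moments below to be summable. *)
Let a := r ^+ 4.
Let a0 : 0 < a. Proof. exact: exprn_gt0. Qed.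
Let a12 : 1 < 2 * a. Proof. rewrite /a /r; lra. Qed.
Let q := (2 * a)^-1.

Let pt N m k : R := k%:R * (2 ^+ N / 2 ^+ m).
Let inc N m k := increment W (pt N m k) (pt N m k.+1) i.
(** Fourth powers of the level [m] increments over [0, 2^N], divided by the size (2 r)^N r^m aimed
    at: a bound on [Y] uniform in both indices gives the hypothesis of the chaining argument. *)
Let Y N m w := \sum_(k < 2 ^ m) (inc N m k w / (2 ^+ N * r ^+ N * r ^+ m)) ^+ 4.

Let pt0 N m k : 0 <= pt N m k.
Proof. by rewrite mulr_ge0// divr_ge0// exprn_ge0. Qed.

Let ptS N m k : pt N m k.+1 - pt N m k = 2 ^+ N / 2 ^+ m.
Proof. by rewrite /pt -natr1 mulrDl mul1r addrAC subrr add0r. Qed.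

Let ptle N m k : pt N m k <= pt N m k.+1.
Proof. by rewrite -subr_ge0 ptS divr_ge0// exprn_ge0. Qed.

Let Linc N m k (c : R) : Lall P (fun w => (inc N m k w / c) ^+ 4).
Proof.
exact: LallX 4 (LallM (Lall_increment hW i (pt0 N m k) (ptle N m k)) (Lall_cst P c^-1)).
Qed.

Let LY N m : Lall P (Y N m).
Proof. by apply: Lall_sum => k; exact: Linc. Qed.

(** Each fourth moment is at most a constant times the squared length 4^N / 4^m, and there are 2^m
    increments. After normalization q^N q^m remains, with a factor 2^-N to spare. *)
Let Y_moment N m : (\int[P]_w (Y N m w)%:E <= (normal_moment_cst 2 * q ^+ N * q ^+ m)%:E)%E.
Proof.
rewrite Ex_EFin// lee_fin Ex_sum; last by move=> k; exact: Linc.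
set c := normal_moment_cst 2.
have c0 : 0 <= c by rewrite /c /normal_moment_cst !mulr_ge0 ?exprn_ge0.
set u : R := 2 ^+ N; set v : R := 2 ^+ m; set D := u * r ^+ N * r ^+ m.
have u1 : 1 <= u by rewrite exprn_ege1// ler1n.
have u0 : 0 < u by exact: exprn_gt0.
have v0 : 0 < v by exact: exprn_gt0.
have D0 : 0 < D by rewrite !mulr_gt0// exprn_gt0.
have term (k : 'I_(2 ^ m)) : Ex P (fun w => (inc N m k w / D) ^+ 4) <= c * (u / v) ^+ 2 / D ^+ 4.
  rewrite (eq_Ex P (g := fun w => (D ^+ 4)^-1 * inc N m k w ^+ 4)); last first.
    by move=> w; rewrite exprMn exprVn mulrC.
  rewrite ExZ; last exact: LallX 4 (Lall_increment hW i (pt0 N m k) (ptle N m k)).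
  rewrite mulrC ler_wpM2r ?invr_ge0 ?exprn_ge0 ?(ltW D0)//.
  by have := increment_even_moment hW i 2 (pt0 N m k) (ptle N m k); rewrite ptS.
apply: le_trans (ler_sum _ (fun k _ => term k)) _.
rewrite sumr_const card_ord -[_ *+ _]mulr_natr natrX -/v.
have -> : D ^+ 4 = u ^+ 4 * a ^+ N * a ^+ m.
  have pw (y : R) k : (y ^+ 4) ^+ k = (y ^+ k) ^+ 4 by rewrite -!exprM mulnC.
  by rewrite /D /a !pw; move: (r ^+ N) (r ^+ m) => x y; rewrite !exprMn.
have -> : q ^+ N = (u * a ^+ N)^-1 by rewrite /q exprVn exprMn.
have -> : q ^+ m = (v * a ^+ m)^-1 by rewrite /q exprVn exprMn.
have aN : 0 < a ^+ N by exact: exprn_gt0.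
have am : 0 < a ^+ m by exact: exprn_gt0.
have -> : c * (u / v) ^+ 2 / (u ^+ 4 * a ^+ N * a ^+ m) * v =
    u^-1 * (c * (u * a ^+ N)^-1 * (v * a ^+ m)^-1).
  by field; rewrite !gt_eqF.
rewrite ler_piMl ?invf_le1// mulr_ge0// ?invr_ge0 ?mulr_ge0 ?invr_ge0 ?mulr_ge0// ltW//.
Qed.

Let growth_bound : {ae P, forall w, exists2 K, 0 <= K &
  forall N t, 0 <= t -> t <= 2 ^+ N -> `|W t w i 0| <= K * (2 ^+ N * r ^+ N)}.
Proof.
have c0 : 0 <= normal_moment_cst 2 :> R by rewrite /normal_moment_cst !mulr_ge0 ?exprn_ge0.
have q0 : 0 < q by rewrite invr_gt0 mulr_gt0.
have q1 : q < 1 by rewrite invf_lt1 ?mulr_gt0.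
have mY N m : measurable_fun setT (Y N m) by have [] := LY N m.
have Y0 N m w : 0 <= Y N m w by apply: sumr_ge0 => k _; rewrite exprn_even_ge0.
have [h _] := hW; have [_ h1 h2 _ _] := h i.
apply: filterS3 (ae_bounded_array c0 q0 q1 mY Y0 Y_moment) h1 h2 => w [K hK] w0 cw.
pose K1 := Num.max 1 K.
have K11 : 1 <= K1 by rewrite le_max lexx.
exists (K1 / (1 - r)); first by rewrite divr_ge0 ?subr_ge0 ?(ltW r1)// (le_trans ler01).
move=> N t t0 tN.
have D0 m : 0 < 2 ^+ N * r ^+ N * r ^+ m by rewrite !mulr_gt0// exprn_gt0.
have hf m k : (k < 2 ^ m)%N ->
    `|W (k.+1%:R * (2 ^+ N / 2 ^+ m)) w i 0 - W (k%:R * (2 ^+ N / 2 ^+ m)) w i 0| <=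
    K1 * (2 ^+ N * r ^+ N) * r ^+ m.
  move=> km; rewrite -/(pt N m k) -/(pt N m k.+1) -[X in `|X|]/(inc N m k w).
  have : (inc N m k w / (2 ^+ N * r ^+ N * r ^+ m)) ^+ 4 <= K1.
    apply: (@le_trans _ _ (Y N m w)); last by rewrite le_max hK orbT.
    rewrite /Y (bigD1 (Ordinal km))//= lerDl; apply: sumr_ge0 => l _.
    by rewrite exprn_even_ge0.
  set x := inc N m k w; set D := 2 ^+ N * r ^+ N * r ^+ m => hx.
  (* Since K1 >= 1, a fourth power at most K1 forces an absolute value at most K1. *)
  have {}hx : `|x / D| <= K1.
    rewrite leNgt; apply/negP => lt; have x1 := le_trans K11 (ltW lt).
    have : `|x / D| ^+ 4 <= K1 by rewrite -normrX ger0_norm// exprn_even_ge0.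
    by apply/negP; rewrite -ltNge (lt_le_trans lt)// exprS ler_peMr// exprn_ege1.
  rewrite -mulrA -/D; have := D0 m; rewrite -/D => Dp.
  by rewrite -ler_pdivrMr// -[X in _ / X](ger0_norm (ltW Dp)) -normf_div.
have S0 : (0 : R) < 2 ^+ N by exact: exprn_gt0.
have C0 : 0 <= K1 * (2 ^+ N * r ^+ N).
  exact: mulr_ge0 (le_trans ler01 K11) (mulr_ge0 (exprn_ge0 _ (ler0n _ _)) (exprn_ge0 _ (ltW r0))).
have := dyadic_chaining cw w0 S0 C0 r0 r1 hf t0 tN.
by rewrite mulrAC.
Qed.

(** For t between 2^N and 2^(N+1), the growth bound on [0, 2^(N+1)] gives |W_t| / t <= 2 K r^(N+1),
    and r < 1. *)
Lemma brownian_slln : {ae P, forall w, W t w i 0 / t @[t --> +oo] --> (0 : R)}.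
Proof.
apply: filterS growth_bound => w [K K0 hK].
apply/cvgrPdist_le => e e0.
have rg : (fun N => r ^+ N) @ \oo --> (0 : R).
  have -> : (fun N => r ^+ N) = geometric 1 r.
    by apply/funext => N; rewrite /geometric/= mul1r.
  by apply: cvg_geometric; rewrite ger0_norm// ltW.
have rc : (fun N => 2 * K * r ^+ N) @ \oo --> (0 : R).
  by rewrite -(mulr0 (2 * K)); apply: cvgM; [exact: cvg_cst|exact: rg].
have /cvgrPdist_le/(_ _ e0)[N0 _ hN0] := rc.
near=> t.
have t1 : 2 ^+ N0 <= t by near: t; exact: nbhs_pinfty_ge.
have tp : 0 < t by apply: lt_le_trans t1; exact: exprn_gt0.
pose k := Num.truncn t.
have /andP[kt tk] := truncn_itv (ltW tp).
have Nk : (2 ^ N0 <= k)%N.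
  by rewrite -ltnS -(ltr_nat R) natrX (le_lt_trans t1).
have k0 : (0 < k)%N by apply: leq_trans Nk; rewrite expn_gt0.
pose N := trunc_log 2 k.
have N0N : (N0 <= N)%N by exact: trunc_log_max.
have lo : 2 ^+ N <= t.
  by apply: le_trans kt; rewrite -natrX ler_nat; exact: trunc_logP.
have hi : t <= 2 ^+ N.+1.
  apply: le_trans (ltW tk) _; rewrite -natrX ler_nat; exact: trunc_log_ltn.
rewrite sub0r normrN normf_div (ger0_norm (ltW tp)) ler_pdivrMr//.
apply: le_trans (hK N.+1 t (ltW tp) hi) _.
have hN : 2 * K * r ^+ N.+1 <= e.
  have := hN0 N.+1 (leqW N0N); rewrite /= sub0r normrN ger0_norm//.
  by rewrite !mulr_ge0// exprn_ge0// ltW.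
apply: (@le_trans _ _ (2 * K * r ^+ N.+1 * 2 ^+ N)).
  by rewrite exprS; lra.
have c1 : 0 <= 2 * K * r ^+ N.+1 := mulr_ge0 (mulr_ge0 (ler0n _ 2) K0) (exprn_ge0 _ (ltW r0)).
have c2 : (0 : R) <= 2 ^+ N by exact: exprn_ge0.
exact: ler_pM c1 c2 hN lo.
Unshelve. all: by end_near. Qed.

End brownian_growth.

(** * Nash equilibria through best replies *)

Section nash_support.
Context {R : realType} {n : nat}.
Variables (M : 'M[R]_n) (y : 'cV[R]_n).
Hypothesis sy : simplex y.

(** Every q earns at most the largest entry of M y, and y earns exactly that because it charges only
    maximal entries. *)
Lemma nash_equilibrium_support :
  (forall i j, (M *m y) i 0 < (M *m y) j 0 -> y i 0 = 0) -> nash_equilibrium M y.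
Proof.
move=> supp; split=> // q [q01 q1]; have [y01 y1] := sy.
have bil (z : 'cV[R]_n) : (z^T *m M *m y) 0 0 = \sum_i z i 0 * (M *m y) i 0.
  by rewrite -mulmxA mxE; apply: eq_bigr => i _; rewrite mxE.
have [i0 _] : exists i : 'I_n, True.
  case: (pickP (xpredT : pred 'I_n)) => [i _|n0]; first by exists i.
  by move: y1; rewrite big1 => [/eqP|i _]; [rewrite eq_sym oner_eq0|have := n0 i].
case: (Order.TotalTheory.arg_maxP (i0 := i0) (P := xpredT) (fun i => (M *m y) i 0) isT) => j _ hj.
rewrite !bil; apply: (@le_trans _ _ ((M *m y) j 0)).
  rewrite -[leRHS]mul1r -q1 mulr_suml; apply: ler_sum => i _.
  by apply: ler_wpM2l; [have /andP[] := q01 i|exact: hj i isT].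
rewrite -[leLHS]mul1r -y1 mulr_suml; apply: ler_sum => i _.
have [lt|ge] := ltP ((M *m y) i 0) ((M *m y) j 0); first by rewrite (supp i j lt) !mul0r.
by apply: ler_wpM2l => //; have /andP[] := y01 i.
Qed.

End nash_support.

Lemma cvg_finite_sum (R : realType) (U J : Type) (F : set_system U) (s : seq J) (f : J -> U -> R) (l : J -> R) :
  Filter F -> (forall k, f k t @[t --> F] --> l k) ->
  \sum_(k <- s) f k t @[t --> F] --> \sum_(k <- s) l k.
Proof.
move=> FF fl; elim: s => [|k s IH].
  under eq_fun do rewrite big_nil; rewrite big_nil; exact: cvg_cst.
under eq_fun do rewrite big_cons; rewrite big_cons.
by apply: cvgD; [exact: fl|exact: IH].
Qed.

(** * Time averages of a path in the simplex *)

Section averages.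
Context {R : realType} {n : nat}.
Variables (A : 'M[R]_n) (sigma : 'I_n -> R) (x : R -> 'cV[R]_n).
Local Notation mu := (@lebesgue_measure R).
Local Notation avg := (time_average x).
Hypothesis cx : forall l, {within `[0, +oo[, continuous (fun t => x t l 0)}.
Hypothesis sx : forall t, 0 <= t -> simplex (x t).

Lemma modified_payoff_log_rate (y : 'cV[R]_n) i : \sum_k y k 0 = 1 ->
  (modified_payoff A sigma *m y) i 0 = log_rate A sigma (fun k => y k 0) i.
Proof.
move=> y1; rewrite mxE /log_rate /payoff.
have -> : sigma i ^+ 2 / 2 = \sum_k sigma i ^+ 2 / 2 * y k 0 by rewrite -mulr_sumr y1 mulr1.
by rewrite -sumrB; apply: eq_bigr => k _; rewrite mxE; ring.
Qed.

Let x01 l t : 0 <= t -> 0 <= x t l 0 <= 1. Proof. by move=> t0; have [] := sx t0. Qed.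
Let nx l t : 0 <= t -> `|x t l 0| <= 1.
Proof. by move=> t0; have /andP[a b] := x01 l t0; rewrite ger0_norm. Qed.

Let int_x l t : mu.-integrable `[0, t] (EFin \o (fun s => x s l 0)).
Proof.
apply: (bounded_itv_integrable (M := 1)); first exact: grid_measurable.
by move=> r /andP[r0 _]; exact: nx.
Qed.

Let integral_comb t (c : 'I_n -> R) : Rintegral mu `[0, t] (fun s => \sum_k c k * x s k 0) =
  \sum_k c k * Rintegral mu `[0, t] (fun s => x s k 0).
Proof.
suff H (s : seq 'I_n) : mu.-integrable `[0, t] (EFin \o (fun u => \sum_(k <- s) c k * x u k 0)) /\
   Rintegral mu `[0, t] (fun u => \sum_(k <- s) c k * x u k 0) =
   \sum_(k <- s) c k * Rintegral mu `[0, t] (fun s => x s k 0) by have [] := H (index_enum _).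
elim: s => [|k s [IHi IHe]].
  have -> : (fun u => \sum_(k <- [::]) c k * x u k 0) = fun=> 0 by apply/funext => u; rewrite big_nil.
  rewrite big_nil.
  by split; [exact: integrable0|rewrite Rintegral_cst//= mul0r].
have -> : (fun u => \sum_(k <- k :: s) c k * x u k 0) =
    fun u => c k * x u k 0 + \sum_(k <- s) c k * x u k 0 by apply/funext => u; rewrite big_cons.
rewrite big_cons.
have iZ : mu.-integrable `[0, t] (EFin \o (fun u => c k * x u k 0)).
  by have := integrableZl _ (c k) (int_x k t); apply.
split; first by have := integrableD _ iZ IHi; apply.
by rewrite RintegralD// IHe RintegralZl.
Qed.

Let avgE t l : avg t l 0 = t^-1 * Rintegral mu `[0, t] (fun s => x s l 0).
Proof. by rewrite /time_average !mxE. Qed.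

Let integral1 t : 0 < t -> Rintegral mu `[0, t] (fun=> 1 : R) = t.
Proof.
by move=> t0; rewrite Rintegral_cst//= lebesgue_measure_itv/= lte_fin t0 -EFinB/= subr0 mul1r.
Qed.

Lemma time_average_simplex t : 0 < t -> simplex (avg t).
Proof.
move=> t0; split=> [l|].
  rewrite avgE mulrC; apply/andP; split.
    rewrite divr_ge0 ?(ltW t0)//; apply: Rintegral_ge0 => s; rewrite /= in_itv/= => /andP[s0 _].
    by have /andP[] := x01 l s0.
  rewrite ler_pdivrMr// mul1r -[leRHS](integral1 t0); apply: le_Rintegral => //.
    by apply: (bounded_itv_integrable (f := fun=> 1) (M := 1)) => // r _; rewrite normr1.
  by move=> s; rewrite /= in_itv/= => /andP[s0 _]; have /andP[] := x01 l s0.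
under eq_bigr do rewrite avgE.
rewrite -mulr_sumr.
have -> : \sum_l Rintegral mu `[0, t] (fun s => x s l 0) = Rintegral mu `[0, t] (fun=> 1 : R).
  transitivity (Rintegral mu `[0, t] (fun s => \sum_k 1 * x s k 0)).
    rewrite (integral_comb t (fun=> 1)). by apply: eq_bigr => l _; exact: esym (mul1r _).
  rewrite /Rintegral; congr fine; apply: eq_integral => s; rewrite inE/= in_itv/= => /andP[s0 _].
  congr EFin; have [_ s1] := sx s0; rewrite -[RHS]s1.
  by apply: eq_bigr => k _; rewrite mul1r.
by rewrite integral1// mulVf// gt_eqF.
Qed.

(** [log_rate] is affine in the state, so it commutes with time averages. *)
Lemma integral_log_rate t i : 0 < t ->
  t^-1 * Rintegral mu `[0, t] (fun s => log_rate A sigma (fun k => x s k 0) i) =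
  log_rate A sigma (fun k => avg t k 0) i.
Proof.
move=> t0; rewrite /log_rate /payoff.
have ip : mu.-integrable `[0, t] (EFin \o (fun s => \sum_k A i k * x s k 0)).
  apply: (bounded_itv_integrable (M := rate_bound A sigma)).
    apply: grid_measurable => r.
    by have := @continuous_payoff R n _ A (fun (r : subspace (`[0, +oo[%classic : set R)) k => x r k 0) cx i r; apply.
  by move=> r /andP[r0 _]; apply: (payoff_bound A sigma) => k; exact: x01.
rewrite RintegralB//; last first.
  apply: (bounded_itv_integrable (f := fun=> sigma i ^+ 2 / 2) (M := `|sigma i ^+ 2 / 2|)) => //.
rewrite integral_comb mulrBr mulr_sumr; congr (_ - _).
  by apply: eq_bigr => k _; rewrite avgE mulrCA.
rewrite Rintegral_cst//= lebesgue_measure_itv/= lte_fin t0 -EFinB/= subr0.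
by rewrite mulrCA mulVf ?mulr1// gt_eqF.
Qed.

Lemma integral_log_rateB t i j : 0 < t ->
  Rintegral mu `[0, t] (fun s => log_rate A sigma (fun k => x s k 0) i - log_rate A sigma (fun k => x s k 0) j) =
  t * (log_rate A sigma (fun k => avg t k 0) i - log_rate A sigma (fun k => avg t k 0) j).
Proof.
move=> t0; have il l : mu.-integrable `[0, t] (EFin \o (fun s => log_rate A sigma (fun k => x s k 0) l)).
  apply: (bounded_itv_integrable (M := rate_bound A sigma)).
    apply: grid_measurable => r.
    by have := @continuous_log_rate R n _ A sigma
      (fun (r : subspace (`[0, +oo[%classic : set R)) k => x r k 0) cx l r; apply.
  by move=> r /andP[r0 _]; apply: log_rate_bound => k; exact: x01.
rewrite -!integral_log_rate// -mulrBr mulrA divff ?gt_eqF// mul1r.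
exact: (RintegralB _ (il i) (il j)).
Qed.

Section limits.
Variables (F : set_system R) (FF : ProperFilter F) (y : 'cV[R]_n).
Hypotheses (Foo : F --> +oo) (Fy : avg t @[t --> F] --> y).

Let Fpos (M : R) : \forall t \near F, M < t.
Proof. by have := Foo (nbhs_pinfty_gt (num_real M)); apply. Qed.

Let Fyl l : avg t l 0 @[t --> F] --> y l 0.
Proof. by have := cvg_comp _ _ Fy (@coord_continuous R _ _ l 0 y); apply. Qed.

(** The averages lie in the simplex, which is closed. A general filter tending to infinity covers
    both the limit over all times and the one along a sequence. *)
Lemma average_limit_simplex : simplex y.
Proof.
have sav : \forall t \near F, simplex (avg t).
  by apply: filterS (Fpos 0) => t; exact: time_average_simplex.
split=> [l|].
  apply/andP; split.
    have := @cvgr_to_ge R F FF R (fun t => avg t l 0) (y l 0) 0 (@Fyl l); apply.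
    by apply: filterS sav => t [h _]; have /andP[] := h l.
  have := @cvgr_to_le R F FF R (fun t => avg t l 0) (y l 0) 1 (@Fyl l); apply.
  by apply: filterS sav => t [h _]; have /andP[] := h l.
have h1 : \sum_l avg t l 0 @[t --> F] --> \sum_l y l 0.
  by apply: cvg_finite_sum => l; exact: Fyl.
have h2 : \sum_l avg t l 0 @[t --> F] --> (1 : R).
  apply: cvg_near_cst; apply: filterS sav => t [_ ->] //.
exact: (cvg_unique _ h1 h2).
Qed.

Lemma average_log_rate_cvg i : log_rate A sigma (fun k => avg t k 0) i @[t --> F] -->
  (modified_payoff A sigma *m y) i 0.
Proof.
rewrite modified_payoff_log_rate; last by have [] := average_limit_simplex.
apply: cvgB; last exact: cvg_cst.
by apply: cvg_finite_sum => k; apply: cvgM; [exact: cvg_cst|exact: Fyl].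
Qed.

End limits.

(** Cesaro's argument: beyond some time s the integrand is at most e / 2, and the initial piece
    contributes at most s, which is below e t / 2 for large t. *)
Lemma average_limit_vanish (y : 'cV[R]_n) i : avg t @[t --> +oo] --> y ->
  x t i 0 @[t --> +oo] --> (0 : R) -> y i 0 = 0.
Proof.
move=> ay xi; have yi : avg t i 0 @[t --> +oo] --> y i 0.
  by have := cvg_comp _ _ ay (@coord_continuous R _ _ i 0 y); apply.
suff h : avg t i 0 @[t --> +oo] --> (0 : R) by exact: (cvg_unique _ yi h).
apply/cvgrPdist_le => e e0.
have e2 : 0 < e / 2 by rewrite divr_gt0.
have /cvgrPdist_le/(_ _ e2)[S [_ hS]] := xi.
pose s := Num.max 0 (S + 1); have s0 : 0 <= s by rewrite le_max lexx.
have fM r : s <= r -> `|x r i 0| <= e / 2.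
  move=> sr; have := hS r; rewrite sub0r normrN; apply.
  by apply: lt_le_trans sr; rewrite lt_max ltrDl ltr01 orbT.
near=> t.
have t0 : 0 < t by near: t; exact: (nbhs_pinfty_gt (num_real 0)).
have st : s <= t by near: t; exact: (nbhs_pinfty_ge (num_real s)).
have s2t : s <= e / 2 * t.
  by rewrite mulrC -ler_pdivrMr//; near: t; exact: (nbhs_pinfty_ge (num_real _)).
have sx' := sx; have nx' r (r0 : 0 <= r) := @nx i r r0.
have h1 := integral_lipschitz (@cx i) nx' s0 st fM.
have h2 := integral_lipschitz (@cx i) nx' (lexx 0) s0 nx'.
rewrite sub0r normrN avgE normrM ger0_norm ?invr_ge0 ?(ltW t0)// mulrC ler_pdivrMr//.
have z0 : Rintegral mu `[0, 0] (fun r => x r i 0) = 0 by rewrite set_itv1 Rintegral_set1.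
rewrite z0 !subr0 mul1r in h2.
rewrite -[X in `|X|](subrK (Rintegral mu `[0, s] (fun r => x r i 0))).
apply: le_trans (ler_normD _ _) _.
have : e / 2 * (t - s) <= e / 2 * t by rewrite ler_wpM2l ?(ltW e2)// gerBl.
move: h1 h2; set a := `|_|; set b := `|_| => h1 h2 h3.
have -> : e * t = e / 2 * t + e / 2 * t by field.
by apply: lerD; [exact: le_trans h1 h3|exact: le_trans h2 s2t].
Unshelve. all: by end_near. Qed.

End averages.

(** * The deterministic conclusion: a path with log ratios [L], initial values [c] and noises [e] *)

Section path_averages.
Context {R : realType} {n : nat}.
Variables (A : 'M[R]_n) (sigma : 'I_n -> R) (x : R -> 'cV[R]_n).
Local Notation avg := (time_average x).
Local Notation tA := (modified_payoff A sigma).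
Hypothesis cx : forall l, {within `[0, +oo[, continuous (fun t => x t l 0)}.
Hypothesis sx : forall t, 0 <= t -> simplex (x t).
Variables (c : 'I_n -> 'I_n -> R) (e : 'I_n -> R -> R) (L : 'I_n -> 'I_n -> R -> R).
Hypothesis he : forall i, e i t / t @[t --> +oo] --> (0 : R).
Hypothesis hL : forall i j t, 0 < t -> L i j t = c i j +
  t * (log_rate A sigma (fun k => avg t k 0) i - log_rate A sigma (fun k => avg t k 0) j) + (e i t - e j t).
Hypothesis hx : forall i j, i != j -> forall t, 0 <= t -> x t i 0 = x t j 0 * expR (L i j t).

(** If one component vanished at time [t], the ratio formula would make all of them vanish, although
    they sum to 1. *)
Lemma path_pos i t : 0 <= t -> 0 < x t i 0.
Proof.
move=> t0; have [x01 x1] := sx t0; rewrite lt_neqAle; have /andP[-> _] := x01 i; rewrite andbT.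
apply/negP => /eqP xi0; have : \sum_k x t k 0 = 0.
  rewrite big1// => k _; have [->//|ki] := eqVneq k i.
  by rewrite (hx ki t0) -xi0 mul0r.
by rewrite x1 => /eqP; rewrite oner_eq0.
Qed.

(** Divided by t, the initial term and the noises disappear, and the rates of the averages converge
    because they are affine. *)
Lemma log_rate_difference_cvg (F : set_system R) (y : 'cV[R]_n) i j : ProperFilter F ->
  F --> +oo -> avg t @[t --> F] --> y ->
  L i j t / t @[t --> F] --> (tA *m y) i 0 - (tA *m y) j 0.
Proof.
move=> FF Foo Fy.
have Fpos : \forall t \near F, 0 < t by have := Foo _ (nbhs_pinfty_gt (num_real 0)); apply.
have inv0 : t^-1 @[t --> F] --> (0 : R).
  apply/cvgrPdist_le => r r0.
  have : \forall t \near F, r^-1 <= t by have := Foo _ (nbhs_pinfty_ge (num_real r^-1)); apply.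
  apply: filterS2 Fpos => t t0 rt; rewrite sub0r normrN ger0_norm ?invr_ge0 ?(ltW t0)//.
  by rewrite -[r]invrK lef_pV2 ?posrE ?invr_gt0.
have eF k : e k t / t @[t --> F] --> (0 : R) by exact: cvg_trans (cvg_app _ Foo) (he k).
have lim : c i j * t^-1 + (log_rate A sigma (fun k => avg t k 0) i - log_rate A sigma (fun k => avg t k 0) j) +
    (e i t / t - e j t / t) @[t --> F] --> c i j * 0 + ((tA *m y) i 0 - (tA *m y) j 0) + (0 - 0).
  apply: cvgD; last by apply: cvgB; exact: eF.
  apply: cvgD; first by apply: cvgM; [exact: cvg_cst|exact: inv0].
  have hr k := @average_log_rate_cvg R n A sigma x cx sx F FF y Foo Fy k.
  by apply: cvgB; exact: hr.
rewrite mulr0 add0r subrr addr0 in lim.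
apply: cvg_trans lim; apply: near_eq_cvg; apply: filterS Fpos => t t0.
by rewrite hL//; field; rewrite gt_eqF.
Qed.

(** If the payoff of i is below that of j by a positive amount, then [L i j] is eventually at most a
    negative multiple of t, so x_i <= exp(L i j) tends to 0. The average of x_i tends to 0 as well,
    whence y_i = 0, the support condition. *)
Lemma time_average_nash (y : 'cV[R]_n) : avg t @[t --> +oo] --> y -> nash_equilibrium tA y.
Proof.
move=> ay; have poo : (+oo : set_system R) --> +oo by [].
have sy : simplex y by exact: (average_limit_simplex cx sx _ poo ay).
apply: (nash_equilibrium_support sy) => i j lt.
have ij : i != j by apply: contraTneq lt => ->; rewrite ltxx.
apply: (average_limit_vanish cx sx ay).
set d := (tA *m y) i 0 - (tA *m y) j 0; have d0 : d < 0 by rewrite subr_lt0.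
have d2 : d < d / 2 by lra.
have lim : L i j t / t @[t --> +oo] --> d by have := @log_rate_difference_cvg _ y i j proper_pinfty_nbhs poo ay; apply.
have hd : \forall t \near +oo, L i j t / t <= d / 2 by exact: cvgr_le lim _ d2.
apply/cvgrPdist_le => r r0; near=> t.
have t0 : 0 < t by near: t; exact: (nbhs_pinfty_gt (num_real 0)).
have c0 : 0 < - (d / 2) by lra.
have tr : (- (d / 2) * r)^-1 <= t by near: t; exact: (nbhs_pinfty_ge (num_real _)).
have Lt : L i j t / t <= d / 2 by near: t.
have xp := path_pos i (ltW t0).
rewrite sub0r normrN (ger0_norm (ltW xp)) (hx ij (ltW t0)).
have /andP[xj0 xj1] : 0 <= x t j 0 <= 1 by have [] := sx (ltW t0).
apply: (@le_trans _ _ (expR (L i j t))); first by rewrite ler_piMl ?expR_ge0.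
have Lle : L i j t <= - (- (d / 2) * t) by rewrite mulNr opprK -ler_pdivrMr.
apply: (@le_trans _ _ (expR (- (- (d / 2) * t)))); first by rewrite ler_expR.
have ct : 0 < - (d / 2) * t by rewrite mulr_gt0.
(* The decay is only needed in the weak form exp(-u) <= 1 / u for u > 0. *)
rewrite expRN; apply: (@le_trans _ _ (- (d / 2) * t)^-1).
  rewrite lef_pV2 ?posrE ?expR_gt0//; apply: le_trans (expR_ge1Dx _).
  by rewrite lerDr.
by rewrite -[r]invrK lef_pV2 ?posrE ?invr_gt0// mulrC -ler_pdivrMr//.
Unshelve. all: by end_near. Qed.

(** [L i j] is the difference of the logarithms of x_i and x_j, so the hypothesis on the logarithms
    makes its rate vanish, and all payoffs at y agree. The support condition then holds
    vacuously. *)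
Lemma subsequence_nash (tau : nat -> R) (y : 'cV[R]_n) : (forall k, 0 < tau k) ->
  tau k @[k --> \oo] --> +oo ->
  (forall i, ln (x (tau k) i 0) / tau k @[k --> \oo] --> (0 : R)) ->
  avg (tau k) @[k --> \oo] --> y ->
  nash_equilibrium tA y /\ (forall i j, (tA *m y) i 0 = (tA *m y) j 0).
Proof.
move=> t0 too hln ay.
have eqp i j : (tA *m y) i 0 = (tA *m y) j 0.
  have [->//|ij] := eqVneq i j.
  have lim : L i j (tau k) / tau k @[k --> \oo] --> (tA *m y) i 0 - (tA *m y) j 0.
    exact: (@log_rate_difference_cvg (tau @ \oo) y i j _ too ay).
  have lim0 : L i j (tau k) / tau k @[k --> \oo] --> (0 : R).
    have := cvgB (hln i) (hln j); rewrite subrr.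
    rewrite (_ : (fun k => L i j (tau k) / tau k) =
      (fun k => ln (x (tau k) i 0) / tau k - ln (x (tau k) j 0) / tau k)); first by apply.
    apply/funext => k; have k0 := ltW (t0 k).
    by rewrite -mulrBl (hx ij k0) lnM ?posrE ?expR_gt0 ?path_pos// expRK addrAC subrr add0r.
  by apply/eqP; rewrite -subr_eq0; apply/eqP; exact: (cvg_unique _ lim lim0).
split=> //; apply: nash_equilibrium_support; last by move=> i j; rewrite (eqp i j) ltxx.
exact: (@average_limit_simplex R n x cx sx (tau @ \oo) _ y too ay).
Qed.

End path_averages.

Theorem theorem2p1 (d : measure_display) (Omega : measurableType d)
    (R : realType) (P : probability Omega R)
    (n : nat) (hn : (2 <= n)%N)
    (A : 'M[R]_n) (sigma : 'I_n -> R) (hsigma : forall i, 0 < sigma i)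
    (W : R -> Omega -> 'cV[R]_n) (hW : standard_brownian_motion P W)
    (x0 : 'cV[R]_n) (hx0 : int_simplex x0)
    (X : R -> Omega -> 'cV[R]_n) (hX : replicator_process P A sigma W x0 X) :
  {ae P, forall w, forall y : 'cV[R]_n,
     time_average (fun t => X t w) T @[T --> +oo] --> y ->
     nash_equilibrium (modified_payoff A sigma) y} /\
  {ae P, forall w, forall (tau : nat -> R) (y : 'cV[R]_n),
     (forall k, 0 < tau k) ->
     nondecreasing_seq tau ->
     tau k @[k --> \oo] --> +oo ->
     (forall i, ln (X (tau k) w i 0) / tau k @[k --> \oo] --> 0) ->
     time_average (fun t => X t w) (tau k) @[k --> \oo] --> y ->
     nash_equilibrium (modified_payoff A sigma) y /\
     (forall i j, (modified_payoff A sigma *m y) i 0 =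
                  (modified_payoff A sigma *m y) j 0)}.
Proof.
have [hXa hXc hXs hX0 [I [hI hXI]]] := hX; have [_ x0p] := hx0.
have path : {ae P, forall w, replicator_path A sigma x0 X I w}.
  have cX : {ae P, forall w, forall i, {within `[0, +oo[, continuous (fun t => X t w i 0)}}.
    by apply: filter_forall => i; exact: hXc.
  by apply: filterS2 (filterI cX hXs) (filterI hX0 hXI) => w [h1 h2] [h3 h4]; split.
have ratio : {ae P, forall w, forall i j, i != j -> forall t, 0 <= t ->
    X t w i 0 = X t w j 0 * expR (log_path W A sigma x0 X i j t w)}.
  apply: filter_forall => i; apply: filter_forall => j.
  have [->|ij] := eqVneq i j; first exact: aeW.
  by apply: filterS (replicator_ratio hW hXa hI path ij (x0p i) (x0p j)) => w h _.
have slln : {ae P, forall w, forall i, W t w i 0 / t @[t --> +oo] --> (0 : R)}.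
  by apply: filter_forall => i; exact: brownian_slln.
have log_pathE w : replicator_path A sigma x0 X I w -> forall i j t, 0 < t ->
    log_path W A sigma x0 X i j t w = ln (x0 i 0 / x0 j 0) +
    t * (log_rate A sigma (fun k => time_average (fun t => X t w) t k 0) i -
         log_rate A sigma (fun k => time_average (fun t => X t w) t k 0) j) +
    (sigma i * W t w i 0 - sigma j * W t w j 0).
  move=> [cX sX _ _] i j t t0; rewrite /log_path; congr (_ + _ + _).
  exact: integral_log_rateB.
have noise_cvg w : (forall i, W t w i 0 / t @[t --> +oo] --> (0 : R)) ->
    forall i, sigma i * W t w i 0 / t @[t --> +oo] --> (0 : R).
  move=> h i; rewrite -(mulr0 (sigma i)).
  under eq_fun do rewrite -mulrA.
  by apply: cvgM; [exact: cvg_cst|exact: h].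
(* From here on the argument is deterministic, for a fixed outcome in the three almost sure
   events. *)
split; apply: filterS3 path ratio slln => w hp hr hs; have [cX sX _ _] := hp.
  move=> y; exact: (time_average_nash cX sX (noise_cvg w hs) (log_pathE w hp) hr).
move=> tau y t0 _.
exact: (subsequence_nash cX sX (noise_cvg w hs) (log_pathE w hp) hr t0).
Qed.
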